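(* Let $n,m\ge 1$ be integers, $p\in[1,\infty)$, $Q\in\mathcal{K}_o^{1,m}$, and let $K\subset M_{n,1}(\mathbb{R})=\mathbb{R}^n$ be compact. Then $$C_{p,Q}(K)\le d_{n,p}(Q)\,C_p(K).$$
   Context: $M_{n,m}(\mathbb{R})$ is the space of real $n\times m$ matrices with inner product $\mathrm{tr}(x^{\mathrm T}y)$ and the induced norm; $S^{nm-1}$ is its unit sphere and $du$ the spherical (Hausdorff) measure on it. $M_{n,1}(\mathbb{R})$ and $M_{1,m}(\mathbb{R})$ are identified with $\mathbb{R}^n$ and $\mathbb{R}^m$. $V_n$ and $V_{nm}$ denote volume (Lebesgue measure), $B_2^n$ is the Euclidean unit ball of $\mathbb{R}^n$, $\omega_n=V_n(B_2^n)$. $\mathcal{K}_o^{1,m}$ is the set of compact convex sets with nonempty interior in $M_{1,m}(\mathbb{R})$ containing the origin $o$. The support function is $h_Q(x)=\max\{x\cdot y:y\in Q\}$. For a smooth compactly supported $f:\mathbb{R}^n\to\mathbb{R}$ (i.e. $f\in C_c^\infty$) and $u\in S^{nm-1}$, put $\nabla_u f(x)=(\nabla f(x))^{\mathrm T}u\in M_{1,m}(\mathbb{R})$ (matrix product) and $\|h_Q(\nabla_u f)\|_p=\big(\int_{\mathbb{R}^n}h_Q(\nabla_u f(x))^p\,dx\big)^{1/p}$. For compact $K\subset\mathbb{R}^n$ and $p\in[1,\infty)$, the $m$th order $p$-affine capacity is $$C_{p,Q}(K)=\inf\Big\{\Big(\int_{S^{nm-1}}\|h_Q(\nabla_u f)\|_p^{-nm}\,du\Big)^{-\frac{p}{nm}}: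 f\in C_c^\infty,\ f\ge 1\text{ on }K\Big\},$$ with the conventions $0^{-a}=\infty$, $\infty^{-a}=0$ for $a>0$, and the $p$-variational capacity is $$C_p(K)=\inf\Big\{\int_{\mathbb{R}^n}|\nabla f(x)|^p\,dx: f\in C_c^\infty,\ f\ge1\text{ on }K\Big\}.$$ The body $\Pi_{p,Q}B_2^n\subset M_{n,m}(\mathbb{R})$ is the convex body with support function $h_{\Pi_{p,Q}B_2^n}(x)=\big(\int_{S^{n-1}}h_Q(v^{\mathrm T}x)^p\,dv\big)^{1/p}$, $\Pi^*_{p,Q}B_2^n$ is its polar body, so $nm\,V_{nm}(\Pi_{p,Q}^*B_2^n)=\int_{S^{nm-1}}h_{\Pi_{p,Q}B_2^n}(u)^{-nm}\,du$, and $$d_{n,p}(Q)=(n\omega_n)^{-1}\big(nm\,V_{nm}(\Pi_{p,Q}^*B_2^n)\big)^{-\frac{p}{nm}}.$$ *)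

(* Defs.v *)
From HB Require Import structures.
From mathcomp Require Import all_boot all_order all_algebra.
From mathcomp Require Import all_classical all_reals all_analysis.

Set Implicit Arguments.
Unset Strict Implicit.
Unset Printing Implicit Defensive.

Import Order.TTheory GRing.Theory Num.Theory.
Import numFieldNormedType.Exports.

Local Open Scope classical_set_scope.
Local Open Scope ring_scope.

(* The topology on matrices is the product topology. *)
Section borel_matrix.
Context (R : realType) (n m : nat).

Definition borel_mx : set (set 'M[R]_(n, m)) := <<s open >>.

Let borel_mx0 : borel_mx set0.
Proof. exact: sigma_algebra0. Qed.

Let borel_mxC A : borel_mx A -> borel_mx (~` A).
Proof. exact: sigma_algebraC. Qed.

Let borel_mx_bigcup (F : (set 'M[R]_(n, m))^nat) :
  (forall i, borel_mx (F i)) -> borel_mx (\bigcup_i F i).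
Proof. exact: sigma_algebra_bigcup. Qed.

HB.instance Definition _ := @isMeasurable.Build default_measure_display
  'M[R]_(n, m) borel_mx borel_mx0 borel_mxC borel_mx_bigcup.

End borel_matrix.

Section matrix_space.
Context (R : realType).

(* The library norm on matrices is the sup norm, so the Euclidean structure
   is set up separately. *)
Definition mxdot n m (x y : 'M[R]_(n, m)) : R := \tr (x^T *m y).

Definition mxnorm2 n m (x : 'M[R]_(n, m)) : R := Num.sqrt (mxdot x x).

Definition mxball n m : set 'M[R]_(n, m) := [set x | mxnorm2 x <= 1].

Definition mxsphere n m : set 'M[R]_(n, m) := [set x | mxnorm2 x = 1].

Local Open Scope ereal_scope.

(* k-fold product of the one-dimensional Lebesgue measure, the identification
   of R x R^k with R^(k+1) being (a, x) |-> (a, x_1, ..., x_k). *)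
Fixpoint lebesgue_rV (k : nat) : set 'rV[R]_k -> \bar R :=
  match k with
  | 0 => dirac (0%R : 'rV[R]_0)
  | k'.+1 => pushforward (@lebesgue_measure R \x lebesgue_rV (k := k'))
      (fun a => row_mx (a.1%:M : 'rV[R]_1) a.2 : 'rV[R]_k'.+1)
  end.

Definition lebesgue_mx (n m : nat) : set 'M[R]_(n, m) -> \bar R :=
  pushforward (@lebesgue_rV (n * m)) vec_mx.

Definition omega (k : nat) : \bar R := lebesgue_mx (@mxball k 1).

Definition diameter n m (A : set 'M[R]_(n, m)) : \bar R :=
  ereal_sup [set (mxnorm2 (x - y))%:E | x in A & y in A].

(* The volume of a k-dimensional ball with the diameter of A; the empty set is
   singled out because diameter set0 = -oo, and because 0 ^+ 0 = 1. *)
Definition hausdorff_weight n m (k : nat) (A : set 'M[R]_(n, m)) : \bar R :=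
  if A == set0 then 0
  else omega k * (2 ^- k)%:E * diameter A ^+ k.

Definition hausdorff_content n m (k : nat) (delta : R)
    (A : set 'M[R]_(n, m)) : \bar R :=
  ereal_inf [set \sum_(0 <= i <oo) hausdorff_weight k (F i) |
    F in [set F : (set 'M[R]_(n, m))^nat |
      A `<=` \bigcup_i F i /\ forall i, diameter (F i) <= delta%:E]].

(* An outer measure defined on all sets and normalized so as to agree with the
   Lebesgue measure in dimension k; integrals against it only evaluate it on
   Borel sets, where it is countably additive. *)
Definition hausdorff n m (k : nat) (A : set 'M[R]_(n, m)) : \bar R :=
  ereal_sup [set hausdorff_content k delta A | delta in [set d : R | (0 < d)%R]].

(* x^(-a) for x in [0, +oo] and a > 0, with 0^(-a) = +oo and +oo^(-a) = 0;
   the library poweR sends both (0, - a) to 0 and (+oo, - a) to +oo. *)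
Definition poweRV (x : \bar R) (a : R) : \bar R :=
  if x == 0 then +oo else if x == +oo then 0 else poweR x (- a).

End matrix_space.

Section smooth_functions.
Context (R : realType) (n : nat).
Implicit Types f : 'cV[R]_n -> R.

Definition partial (i : 'I_n) f : 'cV[R]_n -> R :=
  fun x => 'D_(delta_mx i 0) f x.

Definition smooth f := forall s : seq 'I_n,
  continuous (foldr partial f s) /\
  forall i x, derivable (foldr partial f s) x (delta_mx i 0).

Definition Cc_infty f := smooth f /\ compact (closure [set x | f x != 0]).

Definition gradient f (x : 'cV[R]_n) : 'cV[R]_n := \col_i partial i f x.

End smooth_functions.

Section affine_capacity.
Context (R : realType).

Definition convex_body_o m (Q : set 'rV[R]_m) :=
  [/\ compact Q, convex_set (Q : set (convex_lmodType 'rV[R]_m)),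
      interior Q !=set0 & Q 0].

Definition support_fun n m (Q : set 'M[R]_(n, m)) (x : 'M[R]_(n, m)) : R :=
  sup [set mxdot x y | y in Q].

Definition dir_gradient n m (u : 'M[R]_(n, m)) (f : 'cV[R]_n -> R)
    (x : 'cV[R]_n) : 'rV[R]_m := (gradient f x)^T *m u.

Definition admissible n (K : set 'cV[R]_n) : set ('cV[R]_n -> R) :=
  [set f | Cc_infty f /\ forall x, K x -> 1 <= f x].

Local Open Scope ereal_scope.

Definition support_Lp n m (p : R) (Q : set 'rV[R]_m) (f : 'cV[R]_n -> R)
    (u : 'M[R]_(n, m)) : \bar R :=
  poweR (\int[@lebesgue_mx R n 1]_x
    (powR (support_fun Q (dir_gradient u f x)) p)%:E) p^-1.

Definition affine_capacity n m (p : R) (Q : set 'rV[R]_m) (K : set 'cV[R]_n) :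
    \bar R :=
  ereal_inf [set poweRV
      (\int[@hausdorff R n m (n * m).-1]_(u in @mxsphere R n m)
         poweRV (support_Lp p Q f u) (n * m)%:R)
      (p / (n * m)%:R) | f in admissible K].

Definition variational_capacity n (p : R) (K : set 'cV[R]_n) : \bar R :=
  ereal_inf [set \int[@lebesgue_mx R n 1]_x
      (powR (mxnorm2 (gradient f x)) p)%:E | f in admissible K].

(* For h sublinear this is the unique compact convex set whose support function
   is h. The function is extended-valued because the library integral is. *)
Definition body_of_support n m (h : 'M[R]_(n, m) -> \bar R) :
    set 'M[R]_(n, m) :=
  [set y | forall x, (mxdot x y)%:E <= h x].

Definition polar n m (P : set 'M[R]_(n, m)) : set 'M[R]_(n, m) :=
  [set x | forall y, P y -> (mxdot x y <= 1)%R].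

Definition projection_body_ball n m (p : R) (Q : set 'rV[R]_m) :
    set 'M[R]_(n, m) :=
  body_of_support (fun x => poweR
    (\int[@hausdorff R n 1 n.-1]_(v in @mxsphere R n 1)
       (powR (support_fun Q (v^T *m x)) p)%:E) p^-1).

Definition d_const n m (p : R) (Q : set 'rV[R]_m) : \bar R :=
  (n%:R%:E * omega R n)^-1 *
  poweRV ((n * m)%:R%:E * lebesgue_mx (polar (@projection_body_ball n m p Q)))
    (p / (n * m)%:R).

End affine_capacity.

(* Main.v *)
(* Write N = n m, let sigma be a rotation invariant measure on S^(n-1), and let
   h(u)^p be the integral of h_Q(v^T u)^p against sigma(dv).  For admissible f
   put G(u) = || h_Q(nabla_u f) ||_p.  Averaging over a random rotation X gives
   E[G(X^T u)^p] = h(u)^p E(f) / sigma(S^(n-1)), E(f) being the p-energy of f.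
   Jensen's inequality for the tent s |-> max(1 - s, 0), composed with G^p and
   integrated over the space, then bounds the volume of {h < 1}, suitably
   rescaled, by that of {G < 1}.  In polar coordinates the latter is (1/N) times
   the integral of G^(-N) over the sphere, which is the claimed inequality for f.

   Here the sphere carries the cone measure N vol({r u : u in A, 0 <= r <= 1}).
   It is only shown to be at most the Hausdorff measure, by the isodiametric
   inequality (Steiner symmetrization); this direction suffices, both for the
   integral defining C_(p,Q) and for the body whose polar enters d_(n,p)(Q). *)
From HB Require Import structures.
Require Import Defs.
From mathcomp Require Import all_boot all_order all_algebra.
From mathcomp Require Import all_classical all_reals all_analysis.
From mathcomp Require Import measurable_realfun perm ring lra.

Set Implicit Arguments.
Unset Strict Implicit.
Unset Printing Implicit Defensive.

Import Order.TTheory GRing.Theory Num.Theory.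
Import numFieldNormedType.Exports.

Local Open Scope classical_set_scope.
Local Open Scope ring_scope.


(** * Borel sets and Lebesgue measure on matrix spaces *)

(** The function G^(-N) is singular where G vanishes; the tent avoids this. For G positively
    homogeneous of degree 1 the set where tent (G^p) exceeds t is a dilate of {G < 1}, so the
    integral of tent (G^p) is the volume of {G < 1} times a positive finite constant that is the
    same for every G. Jensen's inequality for the tent thus becomes an inequality between volumes.

    The cone measure is chosen because its rotation invariance is inherited from volume, its total
    mass is n omega_n at once, and polar coordinates for it amount to cutting a region into cones.
    Domination by the Hausdorff measure goes the right way twice: the larger measure increases the
    integral of G^(-N), which lowers its power -p/N; it also increases the support function of the
    projection body, hence shrinks the polar body and raises d_(n,p)(Q). The Hausdorff measure
    enters only as a set function, so integrals against it are compared through simple functions. *)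

Section borel_mx_theory.
Context (R : realType).

Lemma open_measurable_mx n m (A : set 'M[R]_(n, m)) : open A -> measurable A.
Proof. by move=> oA; apply: sub_sigma_algebra. Qed.

Lemma closed_measurable_mx n m (A : set 'M[R]_(n, m)) :
  closed A -> measurable A.
Proof.
move=> cA; rewrite -(setCK A); apply: measurableC; apply: open_measurable_mx.
by rewrite openC.
Qed.

Lemma continuous_measurable_mx n m (f : 'M[R]_(n, m) -> R) :
  continuous f -> measurable_fun setT f.
Proof.
move=> cf; apply: (measurability _ (RGenOpens.measurableE R)).
move=> _ [_ [a [b ->]] <-]; rewrite setTI; apply: open_measurable_mx.
by apply: open_comp; [move=> x _; exact: cf | exact: interval_open].
Qed.

Lemma measurable_coord n m i j :
  measurable_fun setT (fun x : 'M[R]_(n, m) => x i j).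
Proof. by apply: continuous_measurable_mx; exact: coord_continuous. Qed.

Definition rat_box n m (ck : 'M[rat]_(n, m) * nat) : set 'M[R]_(n, m) :=
  [set x | forall i j, `|x i j - ratr (ck.1 i j)| < ck.2.+1%:R^-1].

(** There are only countably many rational boxes; this is what makes a map into matrices measurable
    as soon as its entries are. *)
Lemma open_mx_bigcup n m (U : set 'M[R]_(n, m)) : open U ->
  U = \bigcup_(ck in [set ck | rat_box ck `<=` U]) rat_box ck.
Proof.
move=> oU; apply/seteqP; split; last by move=> x [ck]; apply.
move=> x Ux.
have : nbhs x U by exact: open_nbhs_nbhs.
rewrite -nbhs_ballE => -[e /= e0 eU].
(* A radius below e / 2: a box whose centre is within that radius of x stays in the e-ball around
   x. *)
have [k ke] : exists k, k.+1%:R^-1 < e / 2.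
  exists (Num.truncn (e / 2)^-1).
  rewrite invf_plt ?posrE ?divr_gt0//; exact: truncnS_gt.
have k0 : (0 : R) < k.+1%:R^-1 by rewrite invr_gt0.
have qE i j : {q : rat | `|x i j - ratr q| < k.+1%:R^-1}.
  apply: cid.
  have [|q] := @rat_in_itvoo R (x i j - k.+1%:R^-1) (x i j + k.+1%:R^-1).
    by rewrite ltrBlDr -addrA ltrDl addr_gt0.
  by rewrite in_itv/= => /andP[q1 q2]; exists q; rewrite distrC ltr_distl q1 q2.
exists (\matrix_(i, j) sval (qE i j), k) => /=; last first.
  by move=> i j; rewrite mxE; case: (qE i j).
move=> y /= yq; apply: eU; split => // i j; rewrite /ball /=.
have := yq i j; rewrite mxE; case: (qE i j) => q /= xq yqij.
rewrite -(subrKA (ratr q)) (le_lt_trans (ler_normD _ _))//.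
by rewrite (splitr e) ltrD// ?(lt_trans xq)// distrC (lt_trans yqij).
Qed.

Lemma measurable_fun_mx d (T : measurableType d) n m (f : T -> 'M[R]_(n, m)) :
  (forall i j, measurable_fun setT (fun t => f t i j)) -> measurable_fun setT f.
Proof.
move=> mf; apply: (@measurability _ _ T _ setT f open erefl) => _ [U oU <-].
rewrite setTI (open_mx_bigcup oU) preimage_bigcup bigcup_mkcond.
apply: countable_bigcupT_measurable => [|[c k]]; first exact: countableP.
case: ifP => _ //.
have -> : f @^-1` (rat_box (c, k)) =
   \bigcap_(i in [set: 'I_n]) \bigcap_(j in [set: 'I_m])
   ((fun t => f t i j) @^-1` (ball (ratr (c i j) : R) k.+1%:R^-1)).
  apply/seteqP; split=> t /= h.
    by move=> i _ j _ /=; rewrite -ball_normE/= distrC; exact: h.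
  by move=> i j; have := h i I j I; rewrite /= -ball_normE/= distrC.
apply: fin_bigcap_measurable => // i _; apply: fin_bigcap_measurable => // j _.
rewrite -[X in measurable X]setTI; apply: mf => //.
by apply: open_measurable; apply: ball_open; rewrite invr_gt0.
Qed.
End borel_mx_theory.

Lemma measurable_preimage d1 d2 (T1 : measurableType d1)
    (T2 : measurableType d2) (f : T1 -> T2) (A : set T2) :
  measurable_fun setT f -> measurable A -> measurable (f @^-1` A).
Proof. by move=> mf mA; rewrite -[X in measurable X]setTI; exact: mf. Qed.

(* Passing [h] as a dummy argument of the carrier lets instance inference
   recover the proof of sigma-finiteness. *)
Section sigma_finite_pack.
Context d (T : measurableType d) (R : realType) (mu : {measure set T -> \bar R}).
Hypothesis h : sigma_finite setT mu.

Definition sigma_finite_pack of sigma_finite setT mu : set T -> \bar R := mu.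

HB.instance Definition _ := Measure.on (sigma_finite_pack h).

HB.instance Definition _ :=
  Measure_isSigmaFinite.Build _ _ _ (sigma_finite_pack h) h.

End sigma_finite_pack.

Section measure_complements.
Context d1 d2 (T1 : measurableType d1) (T2 : measurableType d2) (R : realType).
Local Open Scope ereal_scope.

Lemma pushforward_measure_ex (mu : {measure set T1 -> \bar R}) (f : T1 -> T2) :
  measurable_fun setT f ->
  {nu : {measure set T2 -> \bar R} | forall A, nu A = mu (f @^-1` A)}.
Proof.
move=> mf.
by unshelve eexists (pushforward mu f : {measure set T2 -> \bar R}).
Qed.

(** Keeps sigma-finiteness through products, so that the measures built by iterating products remain
    subject to Fubini. *)
Lemma product_sigma_finite_ex (m1 : {sigma_finite_measure set T1 -> \bar R})
    (m2 : {sigma_finite_measure set T2 -> \bar R}) :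
  {nu : {sigma_finite_measure set (T1 * T2)%type -> \bar R} |
    forall A, nu A = (m1 \x m2) A}.
Proof.
have h : sigma_finite setT (m1 \x m2).
  have /sigma_finiteP[F [TF ndF Foo]] := sigma_finiteT m1.
  have /sigma_finiteP[G [TG ndG Goo]] := sigma_finiteT m2.
  exists (fun n => F n `*` G n).
    apply/seteqP; split=> // -[x y] _.
    have [n _ Fx] : (\bigcup_i F i) x by rewrite -TF.
    have [k _ Gy] : (\bigcup_i G i) y by rewrite -TG.
    exists (maxn n k) => //; split => /=.
      by have /subsetPset := ndF _ _ (leq_maxl n k); exact.
    by have /subsetPset := ndG _ _ (leq_maxr n k); exact.
  move=> n; have [mF Fn] := Foo n; have [mG Gn] := Goo n.
  split; first exact: measurableX.
  by rewrite product_measure1E// lte_mul_pinfty// ge0_fin_numE.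
by exists (sigma_finite_pack h).
Qed.

(** The measurable left inverse [g] pulls an exhaustion of the source back to one of the target. *)
Lemma pushforward_sigma_finite_ex (mu : {sigma_finite_measure set T1 -> \bar R})
    (f : T1 -> T2) (g : T2 -> T1) :
  measurable_fun setT f -> measurable_fun setT g -> cancel f g ->
  {nu : {sigma_finite_measure set T2 -> \bar R} | forall A, nu A = mu (f @^-1` A)}.
Proof.
move=> mf mg fK; have [nu nuE] := pushforward_measure_ex mu mf.
have h : sigma_finite setT nu.
  have [F TF Foo] := sigma_finiteT mu.
  exists (fun n => g @^-1` F n).
    by rewrite -preimage_bigcup -TF preimage_setT.
  move=> n; have [mFn Fnoo] := Foo n; split; first exact: measurable_preimage.
  rewrite nuE; suff -> : f @^-1` (g @^-1` F n) = F n by [].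
  by apply/seteqP; split=> x /=; rewrite fK.
by exists (sigma_finite_pack h).
Qed.

Lemma fubini_section (m1 : {sigma_finite_measure set T1 -> \bar R})
    (m2 : {sigma_finite_measure set T2 -> \bar R}) (E : set (T1 * T2)) :
  measurable E ->
  \int[m1]_x m2 (xsection E x) = \int[m2]_y m1 (ysection E y).
Proof.
move=> mE; have := indic_fubini_tonelli m1 m2 mE.
by rewrite indic_fubini_tonelli_FE// indic_fubini_tonelli_GE.
Qed.

End measure_complements.

Section lebesgue_rV_measure.
Context (R : realType).
Local Notation leb := (@lebesgue_measure R).

Definition cons_rV k (a : R * 'rV[R]_k) : 'rV[R]_k.+1 := row_mx (a.1%:M : 'rV_1) a.2.

Definition head_tail_rV k (x : 'rV[R]_k.+1) : R * 'rV[R]_k :=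
  (x 0 0, rsubmx (x : 'rV_(1 + k))).

Lemma cons_rV0 k (a : R * 'rV[R]_k) i : cons_rV a i ord0 = a.1.
Proof.
have e : (a.1%:M : 'M[R]_1) ord0 ord0 = a.1 by rewrite mxE.
by rewrite -[RHS]e -[RHS](row_mxEl _ a.2) ord1; congr (fun_of_matrix _ _ _); exact: val_inj.
Qed.

Lemma cons_rVS k (a : R * 'rV[R]_k) i l : cons_rV a i (lift ord0 l) = a.2 i l.
Proof.
by rewrite -[RHS](row_mxEr (a.1%:M : 'rV_1)) ord1; congr (fun_of_matrix _ _ _); exact: val_inj.
Qed.

Lemma tail_rVE k (x : 'rV[R]_k.+1) l : (head_tail_rV x).2 0 l = x 0 (lift ord0 l).
Proof. by rewrite /head_tail_rV /= mxE; congr (fun_of_matrix _ _ _); exact: val_inj. Qed.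

Lemma cons_rVK k : cancel (@cons_rV k) (@head_tail_rV k).
Proof.
move=> [a x]; apply: injective_projections; first exact: cons_rV0.
by apply/rowP => l; rewrite tail_rVE cons_rVS.
Qed.

Lemma measurable_cons_rV k :
  measurable_fun [set: measurableTypeR R * 'rV[R]_k] (@cons_rV k).
Proof.
apply: measurable_fun_mx => i j; case: (unliftP ord0 j) => [l|] ->.
  under eq_fun do rewrite cons_rVS.
  by apply: (measurableT_comp (measurable_coord i l)); exact: measurable_snd.
under eq_fun do rewrite cons_rV0.
exact: measurable_fst.
Qed.

Lemma measurable_head_tail_rV k : measurable_fun setT
  (@head_tail_rV k : 'rV[R]_k.+1 -> measurableTypeR R * 'rV[R]_k).
Proof.
apply: measurable_fun_pair; first exact: measurable_coord.
apply: measurable_fun_mx => i j; under eq_fun do rewrite mxE.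
exact: measurable_coord.
Qed.

Local Open Scope ereal_scope.

(** [lebesgue_rV] is defined as a bare set function; this equips it with the structure of a
    sigma-finite measure. *)
Lemma lebesgue_rV_measure_ex k :
  {mu : {sigma_finite_measure set 'rV[R]_k -> \bar R} |
    forall A, mu A = lebesgue_rV A}.
Proof.
elim: k => [|k [mu muE]]; first by exists (dirac (0 : 'rV[R]_0)%R).
have [lmu lmuE] := product_sigma_finite_ex leb mu.
have [nu nuE] := pushforward_sigma_finite_ex lmu
  (@measurable_cons_rV k) (@measurable_head_tail_rV k) (@cons_rVK k).
exists nu => A; rewrite nuE lmuE /=.
by rewrite (_ : mu = lebesgue_rV (k := k) :> (set _ -> _))//; apply/funext.
Qed.

End lebesgue_rV_measure.
Arguments head_tail_rV {R k} x : simpl never.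

Section frobenius.
Context (R : realType).
Implicit Types n m : nat.

Lemma mxdotE n m (x y : 'M[R]_(n, m)) :
  mxdot x y = \sum_i \sum_j x i j * y i j.
Proof.
rewrite /mxdot /mxtrace exchange_big/=; apply: eq_bigr => j _.
by rewrite mxE; apply: eq_bigr => i _; rewrite mxE.
Qed.

Lemma mxdotC n m (x y : 'M[R]_(n, m)) : mxdot x y = mxdot y x.
Proof.
by rewrite !mxdotE; do 2!apply: eq_bigr => ? _; rewrite mulrC.
Qed.

Lemma mxdotDl n m (x y z : 'M[R]_(n, m)) :
  mxdot (x + y) z = mxdot x z + mxdot y z.
Proof. by rewrite /mxdot linearD mulmxDl linearD. Qed.

Lemma mxdotZl n m a (x z : 'M[R]_(n, m)) : mxdot (a *: x) z = a * mxdot x z.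
Proof. by rewrite /mxdot linearZ -scalemxAl linearZ. Qed.

Lemma mxdotNl n m (x z : 'M[R]_(n, m)) : mxdot (- x) z = - mxdot x z.
Proof. by rewrite -scaleN1r mxdotZl mulN1r. Qed.

Lemma mxdotDr n m (x y z : 'M[R]_(n, m)) :
  mxdot z (x + y) = mxdot z x + mxdot z y.
Proof. by rewrite mxdotC mxdotDl !(mxdotC z). Qed.

Lemma mxdotZr n m a (x z : 'M[R]_(n, m)) : mxdot z (a *: x) = a * mxdot z x.
Proof. by rewrite mxdotC mxdotZl mxdotC. Qed.

Lemma mxdotNr n m (x z : 'M[R]_(n, m)) : mxdot z (- x) = - mxdot z x.
Proof. by rewrite mxdotC mxdotNl mxdotC. Qed.

Lemma mxdot0l n m (z : 'M[R]_(n, m)) : mxdot 0 z = 0.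
Proof. by rewrite -(scale0r 0) mxdotZl mul0r. Qed.

Lemma mxdotxx_ge0 n m (x : 'M[R]_(n, m)) : 0 <= mxdot x x.
Proof. by rewrite mxdotE; do 2!apply: sumr_ge0 => ? _; rewrite -expr2 sqr_ge0. Qed.

Lemma mxnorm2_sqr n m (x : 'M[R]_(n, m)) : mxnorm2 x ^+ 2 = mxdot x x.
Proof. by rewrite sqr_sqrtr// mxdotxx_ge0. Qed.

Lemma mxnorm2_ge0 n m (x : 'M[R]_(n, m)) : 0 <= mxnorm2 x.
Proof. exact: sqrtr_ge0. Qed.

Lemma coord_le_mxnorm2 n m (x : 'M[R]_(n, m)) i j : `|x i j| <= mxnorm2 x.
Proof.
rewrite -sqrtr_sqr ler_wsqrtr// mxdotE (bigD1 i)//= (bigD1 j)//= -addrA -expr2.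
rewrite lerDl addr_ge0//; first by apply: sumr_ge0 => ? _; rewrite -expr2 sqr_ge0.
by do 2!apply: sumr_ge0 => ? _; rewrite -expr2 sqr_ge0.
Qed.

Lemma mxnorm2_eq0 n m (x : 'M[R]_(n, m)) : (mxnorm2 x == 0) = (x == 0).
Proof.
apply/eqP/eqP => [x0|->]; last by rewrite /mxnorm2 mxdot0l sqrtr0.
apply/matrixP => i j; rewrite mxE; apply/eqP; rewrite -normr_le0 -x0.
exact: coord_le_mxnorm2.
Qed.

Lemma mxnorm2_gt0 n m (x : 'M[R]_(n, m)) : (0 < mxnorm2 x) = (x != 0).
Proof. by rewrite lt0r mxnorm2_eq0 mxnorm2_ge0 andbT. Qed.

Lemma mxnorm20 n m : mxnorm2 (0 : 'M[R]_(n, m)) = 0.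
Proof. by apply/eqP; rewrite mxnorm2_eq0. Qed.

Lemma mxnorm2Z n m a (x : 'M[R]_(n, m)) : mxnorm2 (a *: x) = `|a| * mxnorm2 x.
Proof.
by rewrite /mxnorm2 mxdotZl mxdotZr mulrA -expr2 sqrtrM ?sqr_ge0// sqrtr_sqr.
Qed.

Lemma mxnorm2N n m (x : 'M[R]_(n, m)) : mxnorm2 (- x) = mxnorm2 x.
Proof. by rewrite -scaleN1r mxnorm2Z normrN1 mul1r. Qed.

(** Cauchy-Schwarz: with a and b the norms of x and y, expand the squared norm of b x - a y and
    cancel a b > 0. *)
Lemma mxdot_le n m (x y : 'M[R]_(n, m)) : mxdot x y <= mxnorm2 x * mxnorm2 y.
Proof.
have [->|x0] := eqVneq x 0; first by rewrite mxdot0l mxnorm20 mul0r.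
have [->|y0] := eqVneq y 0; first by rewrite mxdotC mxdot0l mxnorm20 mulr0.
have a0 : 0 < mxnorm2 x by rewrite mxnorm2_gt0.
have b0 : 0 < mxnorm2 y by rewrite mxnorm2_gt0.
have := mxdotxx_ge0 (mxnorm2 y *: x - mxnorm2 x *: y).
rewrite !(mxdotDl, mxdotDr, mxdotNl, mxdotNr, mxdotZl, mxdotZr) -!mxnorm2_sqr.
rewrite (mxdotC y x).
set a := mxnorm2 x in a0 *; set b := mxnorm2 y in b0 *; set d := mxdot _ _.
move=> h; have ab0 : 0 < a * b by rewrite mulr_gt0.
rewrite -(ler_pM2l ab0); nra.
Qed.

Lemma mxnorm2D n m (x y : 'M[R]_(n, m)) : mxnorm2 (x + y) <= mxnorm2 x + mxnorm2 y.
Proof.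
rewrite -(@ler_pXn2r _ 2)// ?nnegrE ?addr_ge0 ?mxnorm2_ge0//.
rewrite mxnorm2_sqr !(mxdotDl, mxdotDr) (mxdotC y x) -!mxnorm2_sqr.
have := mxdot_le x y; nra.
Qed.

Lemma mxnorm2_vec n m (x : 'rV[R]_(n * m)) : mxnorm2 (vec_mx x) = mxnorm2 x.
Proof.
congr Num.sqrt; rewrite !mxdotE big_ord1 pair_bigA/=.
rewrite (reindex _ (curry_mxvec_bij n m))/=.
by apply: eq_bigr => -[i j] _ /=; rewrite mxE.
Qed.

Lemma mxnorm2_mxvec n m (x : 'M[R]_(n, m)) : mxnorm2 (mxvec x) = mxnorm2 x.
Proof. by rewrite -mxnorm2_vec mxvecK. Qed.

Lemma mxnorm2_le_sum n m (x : 'M[R]_(n, m)) :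
  mxnorm2 x <= \sum_i \sum_j `|x i j|.
Proof.
rewrite [X in mxnorm2 X]matrix_sum_delta.
have tri (I : finType) (F : I -> 'M[R]_(n, m)) :
  mxnorm2 (\sum_i F i) <= \sum_i mxnorm2 (F i).
  elim/big_ind2 : _ => [|a b c d h1 h2|//]; first by rewrite mxnorm20.
  by rewrite (le_trans (mxnorm2D _ _))// lerD.
apply: le_trans (tri _ _) _; apply: ler_sum => i _.
apply: le_trans (tri _ _) _; apply: ler_sum => j _.
rewrite mxnorm2Z ler_piMr//; rewrite -[leRHS]sqrtr1 ler_wsqrtr// mxdotE.
rewrite (bigD1 i)//= (bigD1 j)//= !mxE !eqxx mulr1 !big1 ?addr0//.
  by move=> i' /negPf ii'; apply: big1 => j' _; rewrite !mxE ii' mul0r.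
by move=> j' /negPf jj'; rewrite !mxE jj' andbF mul0r.
Qed.

Lemma continuous_mxdotr n m (y : 'M[R]_(n, m)) : continuous (fun x => mxdot x y).
Proof.
under eq_fun do rewrite mxdotE.
apply: continuous_big => [|i _]; first exact: add_continuous.
apply: continuous_big => [|j _]; first exact: add_continuous.
by move=> x; apply: continuousM; [exact: coord_continuous|exact: cst_continuous].
Qed.

Lemma continuous_mxnorm2 n m : continuous (@mxnorm2 R n m).
Proof.
have cdot : continuous (fun x : 'M[R]_(n, m) => mxdot x x).
  under eq_fun do rewrite mxdotE.
  apply: continuous_big => [|i _]; first exact: add_continuous.
  apply: continuous_big => [|j _]; first exact: add_continuous.
  by move=> x; apply: continuousM; exact: coord_continuous.
by move=> x; apply: (continuous_comp (cdot x)); exact: sqrt_continuous.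
Qed.

Lemma measurable_mxnorm2 n m : measurable_fun setT (@mxnorm2 R n m).
Proof. by apply: continuous_measurable_mx; exact: continuous_mxnorm2. Qed.

End frobenius.

Section lebesgue_translation.
Context (R : realType).
Local Open Scope ereal_scope.

Lemma lebesgue_measure_translation (a : R) (A : set R) : measurable A ->
  (@lebesgue_measure R) ((fun x => x + a)%R @^-1` A) = lebesgue_measure A.
Proof.
move=> mA.
have mf : measurable_fun setT ((fun x => x + a)%R : measurableTypeR R -> measurableTypeR R).
  by apply: measurable_funD.
have [nu nuE] := pushforward_measure_ex lebesgue_measure mf.
rewrite -nuE; apply/esym/lebesgue_measure_unique => //= _ [[b c]] _ <-.
rewrite nuE (_ : _ @^-1` _ = `](b - a)%R, (c - a)%R]%classic); last first.
  by apply/seteqP; split=> x /=; rewrite !in_itv/= ltrBlDr lerBrDr.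
rewrite lebesgue_measure_itv [RHS]lebesgue_measure_itv/= !lte_fin ltrD2r; case: ifPn => // _.
by rewrite -!EFinB; congr EFin; ring.
Qed.

End lebesgue_translation.

Section leb_rV.
Context (R : realType).

Definition leb_rV k := sval (lebesgue_rV_measure_ex R k).

Lemma leb_rVE k : @lebesgue_rV R k = leb_rV k.
Proof. by rewrite /leb_rV; case: lebesgue_rV_measure_ex => mu muE; apply/funext => A /=. Qed.

Local Open Scope ereal_scope.
Local Notation leb := (@lebesgue_measure R).

Lemma leb_rVS k A : leb_rV k.+1 A = (leb \x leb_rV k) (@cons_rV R k @^-1` A).
Proof. by rewrite -!leb_rVE. Qed.

Lemma measurable_addmx n m (a : 'M[R]_(n, m)) :
  measurable_fun setT (fun x : 'M[R]_(n, m) => x + a)%R.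
Proof.
apply: measurable_fun_mx => i j; under eq_fun do rewrite mxE.
by apply: measurable_funD => //; exact: measurable_coord.
Qed.

Lemma measurable_scalemx n m (a : R) :
  measurable_fun setT (fun x : 'M[R]_(n, m) => a *: x)%R.
Proof.
apply: measurable_fun_mx => i j; under eq_fun do rewrite mxE.
by apply: measurable_funM => //; exact: measurable_coord.
Qed.

Lemma measurable_mulmxr n m k (P : 'M[R]_(m, k)) :
  measurable_fun setT (fun x : 'M[R]_(n, m) => x *m P)%R.
Proof.
apply: measurable_fun_mx => i j; under eq_fun do rewrite mxE.
by apply: measurable_sum => l; apply: measurable_funM => //; exact: measurable_coord.
Qed.

Lemma measurable_mulmxl n m k (P : 'M[R]_(k, n)) :
  measurable_fun setT (fun x : 'M[R]_(n, m) => P *m x)%R.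
Proof.
apply: measurable_fun_mx => i j; under eq_fun do rewrite mxE.
by apply: measurable_sum => l; apply: measurable_funM => //; exact: measurable_coord.
Qed.

(** By induction on the dimension: a translation acts on the head and the tail separately, and a
    product measure is determined by its values on rectangles. *)
Lemma leb_rV_translation k (a : 'rV[R]_k) A : measurable A ->
  leb_rV k ((fun x => x + a)%R @^-1` A) = leb_rV k A.
Proof.
elim: k => [|k IH] in a A *.
  move=> _; rewrite -!leb_rVE; congr (lebesgue_rV _).
  by apply/seteqP; split=> x /=; rewrite (_ : x + a = x)%R// [LHS]thinmx0 [RHS]thinmx0.
move=> mA; rewrite !leb_rVS.
pose tau (z : measurableTypeR R * 'rV[R]_k) : measurableTypeR R * 'rV[R]_k :=
  ((z.1 + (head_tail_rV a).1)%R, (z.2 + (head_tail_rV a).2)%R).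
have mtau : measurable_fun setT tau.
  apply: measurable_fun_pair; first by apply: measurable_funD.
  by apply: (measurableT_comp (measurable_addmx _)).
have mB : measurable (@cons_rV R k @^-1` A).
  by apply: measurable_preimage => //; exact: measurable_cons_rV.
have tauE z : cons_rV (tau z) = (cons_rV z + a)%R.
  apply/rowP => j; rewrite [RHS]mxE; case: (unliftP ord0 j) => [l|] ->.
    by rewrite !cons_rVS mxE tail_rVE.
  by rewrite !cons_rV0.
transitivity ((leb \x leb_rV k) (tau @^-1` (@cons_rV R k @^-1` A))).
  by congr ((leb \x leb_rV k) _); apply/seteqP; split=> z /=; rewrite tauE.
have [nu nuE] := pushforward_measure_ex (leb \x leb_rV k) mtau.
rewrite -nuE; apply/esym/product_measure_unique => // X Y mX mY.
rewrite nuE; transitivity ((leb \x leb_rV k)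
    (((fun x => x + (head_tail_rV a).1)%R @^-1` X) `*`
     ((fun x => x + (head_tail_rV a).2)%R @^-1` Y))) => //.
have mX' : measurable (((fun x => x + (head_tail_rV a).1)%R : measurableTypeR R ->
    measurableTypeR R) @^-1` X).
  by apply: measurable_preimage => //; apply: measurable_funD.
rewrite product_measure1E//.
  by congr (_ * _); [exact: lebesgue_measure_translation|exact: IH].
exact: measurable_preimage (measurable_addmx _) mY.
Qed.

(** Symmetric bounded sets of explicitly known volume. They bound the volume of balls on both sides
    and fix the constant in the scaling law. *)
Definition cube n m (r : R) : set 'M[R]_(n, m) := [set x | forall i j, `|x i j| <= r]%R.

Lemma measurable_cube n m r : measurable (@cube n m r).
Proof.
rewrite (_ : cube r = \bigcap_(i in [set: 'I_n]) \bigcap_(j in [set: 'I_m])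
    (fun x : 'M[R]_(n, m) => x i j) @^-1` `[(- r)%R, r]%classic).
  apply: fin_bigcap_measurable => // i _; apply: fin_bigcap_measurable => // j _.
  by apply: measurable_preimage; [exact: measurable_coord|exact: measurable_itv].
apply/seteqP; split=> x /= h.
  by move=> i _ j _ /=; rewrite in_itv/= -ler_norml.
by move=> i j; have := h i I j I; rewrite /= in_itv/= -ler_norml.
Qed.

Lemma leb_rV_cube k r : (0 <= r)%R -> leb_rV k (cube r) = ((2 * r) ^+ k)%:E.
Proof.
move=> r0; elim: k => [|k IH].
  rewrite -leb_rVE /= /dirac indicE mem_set//= => i j; by case: j.
rewrite leb_rVS (_ : _ @^-1` _ = `[(- r)%R, r]%classic `*` @cube 1 k r); last first.
  apply/seteqP; split=> z /= h.
    split; first by rewrite /= in_itv/= -ler_norml -(cons_rV0 z ord0).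
    by move=> i j; rewrite -cons_rVS.
  case: h; rewrite in_itv/= -ler_norml => h1 h2 i j.
  by case: (unliftP ord0 j) => [l|] ->; rewrite ?cons_rVS ?cons_rV0.
rewrite product_measure1E//; last exact: measurable_cube.
rewrite IH exprS EFinM; congr (_ * _).
apply: (etrans (@lebesgue_measure_itv R `[(- r)%R, r])); rewrite /= lte_fin.
case: ifPn => [_|]; first by rewrite -EFinD; congr EFin; ring.
rewrite -leNgt => h; have -> : (r = 0)%R by lra.
by rewrite mulr0.
Qed.

End leb_rV.

Lemma mule_EFin_inj (R : realFieldType) (x y : \bar R) (a b : R) : a != 0 ->
  (x * a%:E = y * b%:E -> x = y * (b / a)%:E)%E.
Proof.
move=> a0 /(congr1 (fun z => z * a^-1%:E)%E).
by rewrite -!muleA -!EFinM divff// mule1.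
Qed.

Section leb_rV_unique.
Context (R : realType) (k : nat).
Local Open Scope ereal_scope.
Implicit Types A B : set 'rV[R]_k.

Lemma measurable_addmx2 d (T : measurableType d) n m (f g : T -> 'M[R]_(n, m)) :
  measurable_fun setT f -> measurable_fun setT g ->
  measurable_fun setT (fun t => f t + g t)%R.
Proof.
move=> mf mg; apply: measurable_fun_mx => i j; under eq_fun do rewrite mxE.
by apply: measurable_funD; apply: (measurableT_comp (measurable_coord i j)).
Qed.

Lemma measurable_oppmx n m :
  measurable_fun setT (fun x : 'M[R]_(n, m) => - x)%R.
Proof.
by under eq_fun do rewrite -scaleN1r; exact: measurable_scalemx.
Qed.

(* Integrate 1_A(x + y) 1_B(y) against mu(dx) dy in the two possible orders. *)
Lemma leb_rV_unique (mu : {sigma_finite_measure set 'rV[R]_k -> \bar R}) :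
  (forall a A, measurable A -> mu ((fun x => x + a)%R @^-1` A) = mu A) ->
  forall A B, measurable A -> measurable B -> (forall x, B x -> B (- x)%R) ->
  mu A * leb_rV R k B = leb_rV R k A * mu B.
Proof.
move=> muT A B mA mB BN.
pose E1 : set ('rV[R]_k * 'rV[R]_k) := [set z | A (z.1 + z.2)%R /\ B z.2].
pose E2 : set ('rV[R]_k * 'rV[R]_k) := [set z | A z.2 /\ B (z.2 - z.1)%R].
have mE1 : measurable E1.
  apply: measurableI.
    by apply: (measurable_preimage _ mA); apply: measurable_addmx2.
  exact: (measurable_preimage _ mB).
have mE2 : measurable E2.
  apply: measurableI; first exact: (measurable_preimage _ mA).
  apply: (measurable_preimage _ mB); apply: measurable_addmx2 => //.
  by apply: (measurableT_comp (@measurable_oppmx _ _)).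
transitivity (\int[leb_rV R k]_y mu (ysection E1 y)).
  rewrite (eq_integral (fun y => mu A * (\1_B y)%:E)); last first.
    move=> y _; rewrite indicE; have [yB|yB] := boolP (y \in B).
      rewrite mule1 -[RHS](muT y) //; congr (mu _); apply/seteqP.
      by split=> x /=; rewrite /ysection/= inE /E1 /=; [case|move: yB; rewrite inE].
    rewrite mule0 (_ : ysection _ _ = set0) ?measure0//; apply/seteqP; split => x //=.
    by rewrite /ysection/= inE /E1 /= => -[_]; move: yB; rewrite notin_setE.
  by rewrite ge0_integralZl// ?integral_indic ?setIT//; exact/measurable_EFinP.
rewrite -fubini_section//.
transitivity (\int[mu]_x leb_rV R k (xsection E2 x)).
  apply: eq_integral => x _; rewrite -(leb_rV_translation x); last first.
    exact: measurable_xsection.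
  congr (leb_rV R k _); apply/seteqP; split => y /=;
  by rewrite /xsection/= !inE /E1 /E2 /= addrK addrC.
rewrite fubini_section// (eq_integral (fun y => mu B * (\1_A y)%:E)).
  by rewrite ge0_integralZl// ?integral_indic ?setIT// 1?muleC//; exact/measurable_EFinP.
(* For y in A the section consists of the x with y - x in B, which by the symmetry of B is a
   translate of B. *)
move=> y _; rewrite indicE; have [yA|yA] := boolP (y \in A).
  rewrite mule1 -[RHS](muT (- y)%R) //; congr (mu _); apply/seteqP.
  split=> x /=; rewrite /ysection/= inE /E2 /=.
    by move=> [_ /BN]; rewrite opprB.
  by move/BN; rewrite opprB; move: yA; rewrite inE.
rewrite mule0 (_ : ysection _ _ = set0) ?measure0//; apply/seteqP; split => x //=.
by rewrite /ysection/= inE /E2 /= => -[]; move: yA; rewrite notin_setE.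
Qed.

Lemma mxnorm2_cube n m r : @cube R n m r `<=` [set x | mxnorm2 x <= (n * m)%:R * r]%R.
Proof.
move=> x /= xr; apply: le_trans (mxnorm2_le_sum _) _.
have h : (\sum_i \sum_j `|x i j| <= \sum_(i < n) \sum_(j < m) r)%R.
  by apply: ler_sum => i _; apply: ler_sum => j _.
apply: (le_trans h); rewrite sumr_const card_ord sumr_const card_ord.
by rewrite -mulrnA mulr_natl mulnC.
Qed.

Lemma measurable_mxball n m (r : R) : measurable [set x : 'M[R]_(n, m) | mxnorm2 x <= r]%R.
Proof.
rewrite (_ : mkset _ = @mxnorm2 R n m @^-1` `]-oo, r]%classic); last first.
  by apply/seteqP; split => x /=; rewrite in_itv.
by apply: measurable_preimage; [exact: measurable_mxnorm2|exact: measurable_itv].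
Qed.

Lemma leb_rV_ball_lty (r : R) : leb_rV R k [set x | mxnorm2 x <= r]%R < +oo.
Proof.
have [r0|r0] := leP 0%R r; last first.
  rewrite (_ : mkset _ = set0) ?measure0// -subset0 => x /=; apply/negP; rewrite -ltNge.
  by rewrite (lt_le_trans r0)// mxnorm2_ge0.
apply: (@le_lt_trans _ _ (leb_rV R k (@cube R 1 k r))).
  apply: le_measure; rewrite ?inE; [exact: measurable_mxball|exact: measurable_cube|].
  by move=> x /= xr i j; rewrite (le_trans (coord_le_mxnorm2 _ _ _)).
by rewrite leb_rV_cube// ltry.
Qed.

Lemma leb_rV_ball_gt0 (r : R) : (0 < r)%R -> 0 < leb_rV R k [set x | mxnorm2 x <= r]%R.
Proof.
move=> r0; apply: (@lt_le_trans _ _ (leb_rV R k (@cube R 1 k (r / k.+1%:R)))).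
  by rewrite leb_rV_cube ?lte_fin ?exprn_gt0 ?mulr_gt0// divr_ge0// ltW.
apply: le_measure; rewrite ?inE; [exact: measurable_cube|exact: measurable_mxball|].
apply: (subset_trans (@mxnorm2_cube _ _ _)) => x /= /le_trans; apply.
rewrite mul1n mulrCA ler_piMr ?(ltW r0)// ler_pdivrMr ?ltr0n// mul1r ler_nat.
exact: leqnSn.
Qed.

(** The pushforward under scaling is translation invariant, hence a multiple of Lebesgue measure;
    the cube of half-side 1, whose preimage has half-side 1 / r, gives the factor. *)
Lemma leb_rV_scale (r : R) A : (0 < r)%R -> measurable A ->
  leb_rV R k ((fun x => r *: x)%R @^-1` A) = (r ^- k)%:E * leb_rV R k A.
Proof.
move=> r0 mA; have rN0 : r != 0%R by rewrite gt_eqF.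
have [mu muE] := pushforward_sigma_finite_ex (leb_rV R k)
  (@measurable_scalemx R 1 k r) (@measurable_scalemx R 1 k r^-1)
  (scalerK rN0).
have muT a (B : set 'rV[R]_k) : measurable B -> mu ((fun x => x + a)%R @^-1` B) = mu B.
  move=> mB; rewrite !muE.
  rewrite -(leb_rV_translation (r^-1 *: a)%R (A := (fun x => r *: x)%R @^-1` B)); last first.
    exact: measurable_preimage (measurable_scalemx _) mB.
  congr (leb_rV R k _); apply/seteqP; split => x /=;
  by rewrite scalerDr scalerA mulfV// scale1r.
have sym x : @cube R 1 k 1 x -> cube 1 (- x)%R.
  by move=> h i j; rewrite mxE normrN.
have := leb_rV_unique muT mA (measurable_cube _) sym.
rewrite leb_rV_cube// (muE (cube 1)).
rewrite (_ : _ @^-1` cube 1 = cube r^-1); last first.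
  apply/seteqP; split => x /= h i j; have := h i j; rewrite mxE normrM gtr0_norm//.
    by rewrite -ler_pdivlMl// mulr1.
  by rewrite -ler_pdivlMl// mulr1.
rewrite leb_rV_cube ?invr_ge0 ?(ltW r0)// muE => /mule_EFin_inj ->.
  by rewrite muleC mulr1 exprMn exprVn mulrAC divff ?mul1r// expf_neq0.
by rewrite expf_neq0// mulr1.
Qed.

(** Additivity makes the pushforward translation invariant, and the unit ball, which [g] preserves
    and which has positive finite volume, shows that the factor is 1. No determinant is involved. *)
Lemma leb_rV_isometry (g h : 'rV[R]_k -> 'rV[R]_k) A :
  measurable_fun setT g -> measurable_fun setT h ->
  cancel g h -> cancel h g -> {morph g : x y / x + y}%R ->
  (forall x, mxnorm2 (g x) = mxnorm2 x) -> measurable A ->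
  leb_rV R k (g @^-1` A) = leb_rV R k A.
Proof.
move=> mg mh gK hK gD gN mA.
have [mu muE] := pushforward_sigma_finite_ex (leb_rV R k) mg mh gK.
pose B := [set x : 'rV[R]_k | mxnorm2 x <= 1]%R.
have muT a (C : set 'rV[R]_k) : measurable C -> mu ((fun x => x + a)%R @^-1` C) = mu C.
  move=> mC; rewrite !muE -[RHS](leb_rV_translation (h a)); last first.
    exact: (measurable_preimage mg mC).
  by congr (leb_rV R k _); apply/seteqP; split => x /=; rewrite gD hK.
have sym x : B x -> B (- x)%R by rewrite /B /= mxnorm2N.
have := leb_rV_unique muT mA (measurable_mxball _) sym.
rewrite !muE (_ : g @^-1` B = B); last first.
  by apply/seteqP; split => x; rewrite /B/= gN.
have /fineK <- : leb_rV R k B \is a fin_num.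
  by rewrite ge0_fin_numE// leb_rV_ball_lty.
have B0 : fine (leb_rV R k B) != 0%R.
  by rewrite gt_eqF// fine_gt0// leb_rV_ball_lty leb_rV_ball_gt0.
by move=> /(mule_EFin_inj B0) ->; rewrite divff// mule1.
Qed.

End leb_rV_unique.

(** * Steiner symmetrization and the isodiametric inequality *)

Section steiner.
Context (R : realType).
Local Notation leb := (@lebesgue_measure R).

Lemma head_tail_rVB k (x y : 'rV[R]_k.+1) :
  (head_tail_rV (x - y)).2 = (head_tail_rV x).2 - (head_tail_rV y).2.
Proof.
apply/rowP => l; rewrite tail_rVE [LHS]mxE [in LHS]mxE -!tail_rVE.
by rewrite [RHS]mxE [X in _ = _ + X]mxE.
Qed.

Definition diam_le n m (D : R) (A : set 'M[R]_(n, m)) :=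
  forall x y, A x -> A y -> mxnorm2 (x - y) <= D.

Lemma mxnorm2_rVS k (x : 'rV[R]_k.+1) :
  mxnorm2 x ^+ 2 = x 0 0 ^+ 2 + mxnorm2 (head_tail_rV x).2 ^+ 2.
Proof.
rewrite !mxnorm2_sqr !mxdotE !big_ord1 big_ord_recl expr2; congr (_ + _).
by apply: eq_bigr => l _; rewrite tail_rVE.
Qed.

Section symmetrization.
Context (k : nat).
Implicit Types A : set 'rV[R]_k.+1.

Definition slice A (y : 'rV[R]_k) : set R := [set s | A (cons_rV (s, y))].

Lemma sliceE A y : slice A y = ysection (@cons_rV R k @^-1` A) y.
Proof. by apply/seteqP; split=> s; rewrite /ysection/= inE. Qed.

Lemma measurable_slice A y : measurable A -> measurable (slice A y).
Proof.
move=> mA; rewrite sliceE; apply: (@measurable_ysection _ _ (measurableTypeR R)).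
by apply: (measurable_preimage _ mA); exact: measurable_cons_rV.
Qed.

Local Open Scope ereal_scope.

Lemma measurable_slice_length A : measurable A ->
  measurable_fun setT (fun y => leb (slice A y)).
Proof.
move=> mA; under eq_fun do rewrite sliceE.
apply: (@measurable_fun_ysection _ _ _ _ _ leb).
by apply: (measurable_preimage _ mA); exact: measurable_cons_rV.
Qed.

Lemma leb_rV_slice A : measurable A ->
  leb_rV R k.+1 A = \int[leb_rV R k]_y leb (slice A y).
Proof.
move=> mA; rewrite leb_rVS [LHS](fubini_section leb (leb_rV R k)).
  by apply: eq_integral => y _; rewrite sliceE.
by apply: (measurable_preimage _ mA); exact: measurable_cons_rV.
Qed.

(** Every line parallel to the first axis is cut in the centred open interval that has the length of
    its slice. The inequality is strict so that lines meeting [A] in a null set drop out, which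
    guarantees nonempty slices in [diam_le_steiner]. *)
Definition steiner A : set 'rV[R]_k.+1 :=
  [set x : 'rV[R]_k.+1 | (2 * `|x ord0 ord0|)%R%:E < leb (slice A (head_tail_rV x).2)].

Lemma slice_steiner A y :
  slice (steiner A) y = [set s : R | (2 * `|s|)%R%:E < leb (slice A y)].
Proof.
by apply/seteqP; split=> s; rewrite /slice /steiner /mkset cons_rV0 cons_rVK.
Qed.

Lemma measurable_steiner A : measurable A -> measurable (steiner A).
Proof.
move=> mA; rewrite -[X in measurable X]setTI; apply: measurable_lte => //.
  apply/measurable_EFinP; apply: measurable_funM => //.
  by apply: (measurableT_comp (@normr_measurable R setT)); exact: measurable_coord.
apply: (measurableT_comp (measurable_slice_length mA)).
apply: (measurableT_comp measurable_snd); exact: measurable_head_tail_rV.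
Qed.

Lemma leb_rV_steiner A : measurable A ->
  leb_rV R k.+1 (steiner A) = leb_rV R k.+1 A.
Proof.
move=> mA; rewrite !leb_rV_slice//; last exact: measurable_steiner.
apply: eq_integral => y _; rewrite slice_steiner.
have : 0 <= leb (slice A y) by [].
case: (leb (slice A y)) => [L|_|//].
  rewrite lee_fin => L0.
  rewrite (_ : mkset _ = `](- (L / 2))%R, (L / 2)%R[%classic); last first.
    apply/seteqP; split=> s /=; rewrite in_itv/= lte_fin -ltr_norml.
      by move=> h; rewrite ltr_pdivlMr// mulrC.
    by rewrite ltr_pdivlMr// mulrC.
  rewrite lebesgue_measure_itv/= lte_fin; case: ifPn => [_|].
    by rewrite -EFinB; congr EFin; lra.
  by rewrite -leNgt => h; congr EFin; lra.
rewrite (_ : mkset _ = `]-oo, +oo[%classic); first by rewrite lebesgue_measure_itv.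
by apply/seteqP; split=> s //= _; rewrite ltry.
Qed.

(** B lies in [inf B, sup B], and therefore A lies in [sup B - c, inf B + c]; the two lengths add up
    to 2 c. *)
Lemma lebesgue_measure_le_span (A B : set R) (c : R) : measurable A -> measurable B ->
  A !=set0 -> B !=set0 -> (forall a b, A a -> B b -> `|a - b| <= c)%R ->
  leb A + leb B <= (2 * c)%:E.
Proof.
move=> mA mB [a0 Aa0] [b0 Bb0] AB.
have supB : has_sup B.
  split; first by exists b0.
  by exists (a0 + c)%R => b /(AB _ _ Aa0); rewrite ler_norml => /andP[? ?]; lra.
have infB : has_inf B.
  split; first by exists b0.
  by exists (a0 - c)%R => b /(AB _ _ Aa0); rewrite ler_norml => /andP[? ?]; lra.
have [s1 s2] : (inf B <= b0)%R /\ (b0 <= sup B)%R.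
  by split; [apply: ge_inf => //; case: infB|apply: ub_le_sup => //; case: supB].
have lB : leb B <= (sup B - inf B)%:E.
  apply: (@le_trans _ _ (leb `[inf B, sup B]%classic)).
    apply: le_measure; rewrite ?inE; [exact: mB|exact: measurable_itv|].
    move=> b Bb /=; rewrite in_itv/= ge_inf//; last by case: infB.
    by apply: ub_le_sup => //; case: supB.
  rewrite lebesgue_measure_itv/= lte_fin; case: ifPn => //.
  by move=> _; rewrite lee_fin; lra.
have hA a : A a -> (sup B - c <= a <= inf B + c)%R.
  move=> Aa; apply/andP; split.
    rewrite lerBlDr; apply: ge_sup; first by exists b0.
    by move=> b /(AB _ _ Aa); rewrite ler_norml => /andP[? ?]; lra.
  rewrite -lerBlDr; apply: lb_le_inf; first by exists b0.
  by move=> b /(AB _ _ Aa); rewrite ler_norml => /andP[? ?]; lra.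
have lA : leb A <= (inf B + c - (sup B - c))%:E.
  apply: (@le_trans _ _ (leb `[(sup B - c)%R, (inf B + c)%R]%classic)).
    apply: le_measure; rewrite ?inE; [exact: mA|exact: measurable_itv|].
    by move=> a /hA /=; rewrite in_itv.
  rewrite lebesgue_measure_itv/= lte_fin; case: ifPn => //.
  by move=> _; rewrite lee_fin; have /andP[? ?] := hA _ Aa0; lra.
by apply: (le_trans (leeD lA lB)); rewrite -EFinD lee_fin; lra.
Qed.

(** For fixed tails x' and y', first coordinates taken from the two slices differ by at most c =
    sqrt (D^2 - |x' - y'|^2). Hence half the lengths of the slices add up to at most c, and these
    halves bound the first coordinates in the symmetrized set. *)
Lemma diam_le_steiner D A : measurable A -> diam_le D A -> diam_le D (steiner A).
Proof.
move=> mA dA x y.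
pose x' := (head_tail_rV x).2; pose y' := (head_tail_rV y).2.
rewrite /steiner /mkset -/x' -/y' => hx hy.
have ne z (r : R) : (2 * `|r|)%R%:E < leb (slice A z) -> slice A z !=set0.
  move=> h; apply/set0P; apply/eqP => s0; move: h.
  by rewrite s0 measure0 lte_fin ltNge mulr_ge0.
have sub00 (u v : 'rV[R]_k.+1) : ((u - v) ord0 ord0 = u ord0 ord0 - v ord0 ord0)%R.
  by rewrite !mxE.
have [a0 Aa0] := ne _ _ hx; have [b0 Ab0] := ne _ _ hy.
have D0 : (0 <= D)%R := le_trans (mxnorm2_ge0 _) (dA _ _ Aa0 Ab0).
have ab a b : slice A x' a -> slice A y' b ->
    ((a - b) ^+ 2 + mxnorm2 (x' - y') ^+ 2 <= D ^+ 2)%R.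
  move=> Aa Ab; have := dA _ _ Aa Ab.
  rewrite -(@ler_pXn2r _ 2)// ?nnegrE ?mxnorm2_ge0// mxnorm2_rVS.
  by rewrite head_tail_rVB !cons_rVK sub00 !cons_rV0.
set c2 := (D ^+ 2 - mxnorm2 (x' - y') ^+ 2)%R.
have c20 : (0 <= c2)%R by have := ab _ _ Aa0 Ab0; have := sqr_ge0 (a0 - b0); rewrite /c2; lra.
have /= := @lebesgue_measure_le_span (slice A x') (slice A y') (Num.sqrt c2)
  (measurable_slice _ mA) (measurable_slice _ mA) (ne _ _ hx) (ne _ _ hy) _.
have hab a b : slice A x' a -> slice A y' b -> (`|a - b| <= Num.sqrt c2)%R.
  move=> Aa Ab; rewrite -sqrtr_sqr ler_wsqrtr//.
  by have := ab _ _ Aa Ab; rewrite /c2; lra.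
move=> /(_ hab) hspan.
have st : (2 * `|x ord0 ord0| + 2 * `|y ord0 ord0| <= 2 * Num.sqrt c2)%R.
  by rewrite -lee_fin; apply: le_trans hspan; rewrite EFinD leeD// ltW.
rewrite -(@ler_pXn2r _ 2)// ?nnegrE ?mxnorm2_ge0// mxnorm2_rVS head_tail_rVB.
rewrite -lerBrDr -/c2 -[leRHS](sqr_sqrtr c20) -[leLHS]real_normK ?num_real//.
rewrite ler_pXn2r ?nnegrE ?sqrtr_ge0// sub00.
by apply: (le_trans (ler_normB _ _)); lra.
Qed.

End symmetrization.
End steiner.

Section isodiametric.
Context (R : realType).
Local Open Scope ereal_scope.

(** Encodes at once the reflections in all coordinate hyperplanes indexed by [J]. Once [J] is
    everything this includes x |-> - x, the only symmetry needed in the end. *)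
Definition sign_invariant k (J : pred 'I_k) (A : set 'rV[R]_k) :=
  forall x y : 'rV[R]_k, (forall i, `|y ord0 i| = `|x ord0 i|)%R ->
    (forall i, ~~ J i -> y ord0 i = x ord0 i) -> A x -> A y.

(** Symmetries obtained earlier survive: a sign change in the tail does not alter the slice, and the
    first coordinate enters only through its absolute value. *)
Lemma sign_invariant_steiner k (J : pred 'I_k.+1) (A : set 'rV[R]_k.+1) :
  sign_invariant J A ->
  sign_invariant [pred i | (i == ord0) || J i] (steiner A).
Proof.
move=> JA x y xy xyJ; rewrite /steiner /mkset xy.
suff -> : slice A (head_tail_rV x).2 = slice A (head_tail_rV y).2 by [].
by apply/seteqP; split => s; apply: JA => i;
  case: (unliftP ord0 i) => [l|] -> //; rewrite ?cons_rV0// !cons_rVS !tail_rVE// => Jl;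
  rewrite xyJ.
Qed.

Lemma mxnorm2_col_perm k s (x : 'rV[R]_k) : mxnorm2 (col_perm s x) = mxnorm2 x.
Proof.
congr Num.sqrt; rewrite !mxdotE !big_ord1 [RHS](reindex_inj (@perm_inj _ s)).
by apply: eq_bigr => i _; rewrite !mxE.
Qed.

Lemma measurable_col_perm k s : measurable_fun setT (col_perm s : 'rV[R]_k -> _).
Proof.
apply: measurable_fun_mx => i j; under eq_fun do rewrite mxE.
exact: measurable_coord.
Qed.

Lemma col_permB k s (x y : 'rV[R]_k) : (col_perm s (x - y) = col_perm s x - col_perm s y)%R.
Proof. by apply/rowP => i; rewrite !mxE. Qed.

Lemma leb_rV_col_perm k (s : 'S_k) (A : set 'rV[R]_k) : measurable A ->
  leb_rV R k (col_perm s @^-1` A) = leb_rV R k A.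
Proof.
move=> mA; apply: (@leb_rV_isometry _ _ _ (col_perm s^-1)) => //.
- exact: measurable_col_perm.
- exact: measurable_col_perm.
- by move=> x; apply/rowP => i; rewrite !mxE permKV.
- by move=> x; apply/rowP => i; rewrite !mxE permK.
- by move=> x y; apply/rowP => i; rewrite !mxE.
- by move=> x; exact: mxnorm2_col_perm.
Qed.

Lemma diam_le_col_perm k D s (A : set 'rV[R]_k) :
  diam_le D A -> diam_le D (col_perm s @^-1` A).
Proof.
move=> DA x y Ax Ay; rewrite -(mxnorm2_col_perm s) col_permB; exact: DA.
Qed.

(** [steiner] acts along coordinate 0, so it is conjugated by the transposition of 0 and [j]. *)
Lemma symmetrize_coord k (j : 'I_k.+1) (J : pred 'I_k.+1) D (A : set 'rV[R]_k.+1) :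
  measurable A -> diam_le D A -> sign_invariant J A ->
  exists B, [/\ measurable B, leb_rV R k.+1 B = leb_rV R k.+1 A, diam_le D B &
    sign_invariant [pred i | (i == j) || J i] B].
Proof.
move=> mA DA JA; pose s := tperm ord0 j; pose g := col_perm s : 'rV[R]_k.+1 -> _.
have mg B : measurable B -> measurable (g @^-1` B).
  by apply: measurable_preimage; exact: measurable_col_perm.
have JA1 : sign_invariant [pred i | J (s i)] (g @^-1` A).
  move=> x y xy xyJ; apply: JA => i; rewrite !mxE// => Ji.
  by apply: xyJ; rewrite /= tpermK.
exists (g @^-1` (steiner (g @^-1` A))); split.
- exact: (mg _ (measurable_steiner (mg _ mA))).
- rewrite leb_rV_col_perm; last exact: (measurable_steiner (mg _ mA)).
  by rewrite leb_rV_steiner ?leb_rV_col_perm//; exact: mg.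
- apply: diam_le_col_perm; apply: diam_le_steiner; first exact: mg.
  exact: diam_le_col_perm.
- move=> x y xy xyJ; apply: (sign_invariant_steiner JA1) => i; rewrite !mxE// => Ji.
  apply: xyJ; apply: contra Ji => /= /orP[/eqP sij|->]; last by rewrite orbT.
  by rewrite -(tpermK ord0 j i) sij tpermR eqxx.
Qed.

(** Symmetrizing along every coordinate in turn gives a set that contains - x with x; then 2 |x| is
    at most D, so the set lies in the ball of radius D / 2. *)
Lemma isodiametric k (D : R) (A : set 'rV[R]_k) : (0 <= D)%R -> measurable A -> diam_le D A ->
  leb_rV R k A <= leb_rV R k [set x | mxnorm2 x <= D / 2]%R.
Proof.
case: k => [|k] in A * => D0 mA DA.
  apply: le_measure; rewrite ?inE//; first exact: measurable_mxball.
  by move=> x _ /=; rewrite (thinmx0 x) mxnorm20 divr_ge0.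
have [B [mB <- DB BJ]] : exists B, [/\ measurable B, leb_rV R k.+1 B = leb_rV R k.+1 A,
    diam_le D B & sign_invariant (mem (enum 'I_k.+1)) B].
  elim: (enum _) => [|j l [B [mB BA DB BJ]]].
    exists A; split => // x y _ xy; suff -> : x = y by [].
    by apply/rowP => i; rewrite xy.
  have [C [mC CB DC CJ]] := symmetrize_coord j mB DB BJ.
  by exists C; split => //; rewrite CB.
apply: le_measure; rewrite ?inE//; first exact: measurable_mxball.
move=> x Bx /=.
have BNx : B (- x)%R.
  by apply: BJ Bx => i; rewrite ?mxE ?normrN//= mem_enum.
have := DB _ _ Bx BNx; rewrite opprK -mulr2n -scaler_nat mxnorm2Z normr_nat.
by rewrite ler_pdivlMr// mulrC.
Qed.

End isodiametric.

Section reflection.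
Context (R : realType) (n m : nat).
Implicit Types x y u v w : 'M[R]_(n, m).

(** For w = 0 the quotient is 0 by the convention on inverses and the map is the identity, so no
    condition on w is carried along. *)
Definition reflection w x := x - (2 * mxdot x w / mxdot w w) *: w.

Lemma reflectionD w : {morph reflection w : x y / x + y}.
Proof.
move=> x y; rewrite /reflection mxdotDl mulrDr mulrDl scalerDl opprD.
by rewrite addrACA.
Qed.

Lemma mxdot_eq0 w : (mxdot w w == 0) = (w == 0).
Proof. by rewrite -mxnorm2_sqr sqrf_eq0 mxnorm2_eq0. Qed.

Lemma mxdot_reflection w x : mxdot (reflection w x) w = - mxdot x w.
Proof.
rewrite /reflection mxdotDl mxdotNl mxdotZl.
have [->|w0] := eqVneq w 0; first by rewrite !(mxdotC x) !mxdot0l mulr0 subrr oppr0.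
by rewrite divfK ?mxdot_eq0//; ring.
Qed.

Lemma reflectionK w : involutive (reflection w).
Proof.
move=> x; rewrite {1}/reflection mxdot_reflection /reflection.
by rewrite mulrN mulNr scaleNr opprK subrK.
Qed.

Lemma mxnorm2_reflection w x : mxnorm2 (reflection w x) = mxnorm2 x.
Proof.
congr Num.sqrt; rewrite {2}/reflection mxdotDr mxdotNr mxdotZr mxdot_reflection.
rewrite /reflection mxdotDl mxdotNl mxdotZl (mxdotC w x).
ring.
Qed.

(** Reflections are transitive on each sphere. This moves a point of a small set to the first basis
    vector, and one unit vector to another in the rotation average. *)
Lemma reflection_swap u v : mxnorm2 u = mxnorm2 v -> reflection (u - v) u = v.
Proof.
move=> uv; have [->|w0] := eqVneq u v.
  by rewrite subrr /reflection scaler0 subr0.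
have e : 2 * mxdot u (u - v) = mxdot (u - v) (u - v).
  rewrite !(mxdotDl, mxdotDr, mxdotNl, mxdotNr) (mxdotC v u) -!mxnorm2_sqr uv; ring.
rewrite /reflection e divff ?scale1r; last by rewrite mxdot_eq0 subr_eq0.
by rewrite opprB addrC subrK.
Qed.

Lemma measurable_mxdotr w : measurable_fun setT (fun x => mxdot x w).
Proof. by apply: continuous_measurable_mx; exact: continuous_mxdotr. Qed.

Lemma measurable_reflection w : measurable_fun setT (reflection w).
Proof.
apply: measurable_fun_mx => i j.
rewrite [X in measurable_fun _ X](_ : _ =
  fun x => x i j - (2 / mxdot w w * w i j) * mxdot x w); last first.
  by apply/funext => x; rewrite !mxE; congr (_ - _); ring.
apply: measurable_funB; first exact: measurable_coord.
by apply: measurable_funM => //; exact: measurable_mxdotr.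
Qed.

End reflection.

Section leb_mx.
Context (R : realType).

Lemma measurable_vec_mx n m : measurable_fun setT (@vec_mx R n m).
Proof.
by apply: measurable_fun_mx => i j; under eq_fun do rewrite mxE; exact: measurable_coord.
Qed.

Lemma measurable_mxvec n m : measurable_fun setT (@mxvec R n m).
Proof.
apply: measurable_fun_mx => i j; rewrite ord1; case/mxvec_indexP: j => i' j'.
by under eq_fun do rewrite mxvecE; exact: measurable_coord.
Qed.

Local Open Scope ereal_scope.

Definition leb_mx n m := sval (pushforward_sigma_finite_ex (leb_rV R (n * m))
  (@measurable_vec_mx n m) (@measurable_mxvec n m) (@vec_mxK R n m)).

Lemma leb_mx_rV n m A : leb_mx n m A = leb_rV R (n * m) (vec_mx @^-1` A).
Proof. by rewrite /leb_mx; case: pushforward_sigma_finite_ex. Qed.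

Lemma lebesgue_mxE n m : @lebesgue_mx R n m = leb_mx n m.
Proof. by apply/funext => A; rewrite leb_mx_rV -leb_rVE. Qed.

Lemma measurable_vec_mx_preimage n m (A : set 'M[R]_(n, m)) :
  measurable A -> measurable (vec_mx @^-1` A).
Proof. exact: (measurable_preimage (@measurable_vec_mx n m)). Qed.

Lemma leb_mx_translation n m (a : 'M[R]_(n, m)) A : measurable A ->
  leb_mx n m ((fun x => x + a)%R @^-1` A) = leb_mx n m A.
Proof.
move=> mA; rewrite !leb_mx_rV -[RHS](leb_rV_translation (mxvec a)); last first.
  exact: measurable_vec_mx_preimage.
by congr (leb_rV _ _ _); apply/seteqP; split => x; rewrite /preimage /mkset linearD/= mxvecK.
Qed.

Lemma leb_mx_scale n m (r : R) (A : set 'M[R]_(n, m)) : (0 < r)%R -> measurable A ->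
  leb_mx n m ((fun x => r *: x)%R @^-1` A) = (r ^- (n * m))%:E * leb_mx n m A.
Proof.
move=> r0 mA; rewrite !leb_mx_rV -leb_rV_scale//; last exact: measurable_vec_mx_preimage.
by congr (leb_rV _ _ _); apply/seteqP; split => x; rewrite /preimage /mkset linearZ.
Qed.

Lemma leb_mx_isometry n m (g h : 'M[R]_(n, m) -> 'M[R]_(n, m)) (A : set 'M[R]_(n, m)) :
  measurable_fun setT g -> measurable_fun setT h ->
  cancel g h -> cancel h g -> {morph g : x y / x + y}%R ->
  (forall x, mxnorm2 (g x) = mxnorm2 x) -> measurable A ->
  leb_mx n m (g @^-1` A) = leb_mx n m A.
Proof.
move=> mg mh gK hK gD gN mA; rewrite !leb_mx_rV.
have mconj f : measurable_fun setT f ->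
    measurable_fun setT (@mxvec R n m \o f \o @vec_mx R n m).
  move=> mf; apply: (measurableT_comp (@measurable_mxvec _ _)).
  by apply: (measurableT_comp mf); exact: measurable_vec_mx.
rewrite -[RHS](@leb_rV_isometry _ _ (mxvec \o g \o vec_mx) (mxvec \o h \o vec_mx)).
- by congr (leb_rV _ _ _); apply/seteqP; split => x; rewrite /preimage /mkset /= mxvecK.
- exact: mconj.
- exact: mconj.
- by move=> x /=; rewrite mxvecK gK vec_mxK.
- by move=> x /=; rewrite mxvecK hK vec_mxK.
- by move=> x y /=; rewrite linearD/= gD linearD.
- by move=> x /=; rewrite mxnorm2_mxvec gN mxnorm2_vec.
- exact: measurable_vec_mx_preimage.
Qed.

Lemma vec_mx_ball n m (r : R) :
  @vec_mx R n m @^-1` [set x | mxnorm2 x <= r]%R = [set x | mxnorm2 x <= r]%R.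
Proof. by apply/seteqP; split => x /=; rewrite mxnorm2_vec. Qed.

Lemma leb_mx_ball_lty n m (r : R) : leb_mx n m [set x | mxnorm2 x <= r]%R < +oo.
Proof. by rewrite leb_mx_rV vec_mx_ball leb_rV_ball_lty. Qed.

Lemma leb_mx_ball_gt0 n m (r : R) : (0 < r)%R -> 0 < leb_mx n m [set x | mxnorm2 x <= r]%R.
Proof. by move=> r0; rewrite leb_mx_rV vec_mx_ball leb_rV_ball_gt0. Qed.

Lemma measurable_set1_mx n m (x : 'M[R]_(n, m)) : measurable [set x].
Proof.
by apply: closed_measurable_mx; exact/accessible_closed_set1/hausdorff_accessible/norm_hausdorff.
Qed.

(** Scaling by 2 fixes {0} and multiplies its finite measure by 2^-(n m) < 1. *)
Lemma leb_mx_set0 n m : (0 < n * m)%N -> leb_mx n m [set 0%R] = 0.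
Proof.
move=> nm0; have m0 := @measurable_set1_mx n m 0%R.
have := @leb_mx_scale n m 2%R _ (ltr0Sn _ _) m0.
rewrite (_ : _ @^-1` _ = [set 0%R]); last first.
  apply/seteqP; split => x /=; last by move=> ->; rewrite scaler0.
  by move=> /eqP; rewrite scaler_eq0 pnatr_eq0/= => /eqP.
have : leb_mx n m [set 0%R] \is a fin_num.
  rewrite ge0_fin_numE//; apply: le_lt_trans (leb_mx_ball_lty n m 0%R).
  apply: le_measure; rewrite ?inE//; first exact: measurable_mxball.
  by move=> x /= ->; rewrite mxnorm20.
move=> /fineK <-; set a := fine _; rewrite -EFinM => -[].
have : (2 ^- (n * m) < 1 :> R)%R.
  by rewrite invf_lt1 ?exprn_gt0// exprn_egt1// ?ltr1n// -lt0n.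
by move=> h /eqP; rewrite eq_sym -subr_eq0 -{2}(mul1r a) -mulrBl mulf_eq0 subr_eq0 lt_eqF//= => /eqP ->.
Qed.

Lemma leb_mx_open_gt0 n m (U : set 'M[R]_(n, m)) : open U -> U !=set0 ->
  0 < leb_mx n m U.
Proof.
move=> oU [x Ux]; have : nbhs x U by exact: open_nbhs_nbhs.
rewrite -nbhs_ballE => -[e /= e0 eU].
have e20 : (0 < e / 2)%R by rewrite divr_gt0.
apply: (lt_le_trans (leb_mx_ball_gt0 n m e20)).
rewrite -(leb_mx_translation (- x)); last exact: measurable_mxball.
apply: le_measure; rewrite ?inE.
- exact: (measurable_preimage (measurable_addmx _) (measurable_mxball _)).
- exact: open_measurable_mx.
- move=> y /= yx; apply: eU; split => // i j; rewrite -ball_normE/=.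
  have := coord_le_mxnorm2 (y - x)%R i j; rewrite !mxE distrC => h.
  by apply: (le_lt_trans h); apply: (le_lt_trans yx); rewrite ltr_pdivrMr// ltr_pMr// ltr1n.
Qed.

End leb_mx.

(** * Cone measure and Hausdorff measure of the sphere *)

Section limits.
Context (R : realType).

Lemma ge_of_right_limit (f : R -> R) (a : R) : {for 0, continuous f} ->
  (forall e, 0 < e < 1 -> a <= f e) -> a <= f 0.
Proof.
move=> cf af; have cf0 : f x @[x --> 0^'+] --> f 0 by exact: cvg_at_right_filter.
rewrite -(cvg_lim _ cf0)//; apply: limr_ge; first by apply/cvg_ex; exists (f 0).
near=> e; apply: af; apply/andP; split; near: e; first exact: nbhs_right_gt.
exact: nbhs_right_lt.
Unshelve. all: by end_near. Qed.

Lemma bernoulli_ge (e : R) k : 0 <= e -> 1 + k%:R * e <= (1 + e) ^+ k.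
Proof.
move=> e0; elim: k => [|k IH]; first by rewrite mul0r addr0 expr0.
rewrite exprS -natr1.
have k0 : 0 <= k%:R * e * e by rewrite !mulr_ge0.
apply: le_trans (ler_wpM2l _ IH); last by rewrite addr_ge0.
by rewrite -subr_ge0 (_ : _ - _ = k%:R * e * e)//; ring.
Qed.

End limits.

Section cone.
Context (R : realType).

Definition dir n m (x : 'M[R]_(n, m)) : 'M[R]_(n, m) := (mxnorm2 x)^-1 *: x.

(** As [dir 0 = 0], the origin belongs to [cone A] only if it belongs to [A], hence never for [A] on
    the sphere. Being the ball intersected with a preimage under [dir], the cone commutes with
    unions and intersections. *)
Definition cone n m (A : set 'M[R]_(n, m)) : set 'M[R]_(n, m) :=
  [set x | mxnorm2 x <= 1 /\ A (dir x)].

Lemma mxnorm2_dir n m (x : 'M[R]_(n, m)) : x != 0 -> mxnorm2 (dir x) = 1.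
Proof.
by move=> x0; rewrite mxnorm2Z ger0_norm ?invr_ge0 ?mxnorm2_ge0// mulVf// mxnorm2_eq0.
Qed.

Lemma dirZ n m r (x : 'M[R]_(n, m)) : 0 < r -> dir (r *: x) = dir x.
Proof.
move=> r0; rewrite /dir mxnorm2Z gtr0_norm// scalerA invfM mulrAC mulVf ?mul1r//.
by rewrite gt_eqF.
Qed.

Lemma mxnorm2_dirK n m (x : 'M[R]_(n, m)) : mxnorm2 x *: dir x = x.
Proof.
have [->|x0] := eqVneq x 0; first by rewrite mxnorm20 scale0r.
by rewrite /dir scalerA divff ?scale1r// mxnorm2_eq0.
Qed.

Lemma dir0 n m : dir (0 : 'M[R]_(n, m)) = 0.
Proof. by rewrite /dir scaler0. Qed.

Lemma mxsphere_dir n m (x : 'M[R]_(n, m)) : mxsphere (dir x) <-> x != 0.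
Proof.
split=> [|/mxnorm2_dir//]; rewrite /mxsphere/=; apply: contra_eq_neq => ->.
by rewrite dir0 mxnorm20 eq_sym oner_eq0.
Qed.

Lemma measurable_dir n m : measurable_fun setT (@dir n m).
Proof.
apply: measurable_fun_mx => i j.
rewrite [X in measurable_fun _ X](_ : _ = fun x => powR (mxnorm2 x) (-1) * x i j); last first.
  by apply/funext => x; rewrite mxE powR_inv1// mxnorm2_ge0.
apply: measurable_funM; last exact: measurable_coord.
apply: (measurableT_comp (@measurable_powR R (-1))); exact: measurable_mxnorm2.
Qed.

Lemma measurable_cone n m (A : set 'M[R]_(n, m)) : measurable A -> measurable (cone A).
Proof.
move=> mA; apply: measurableI; first exact: measurable_mxball.
exact: (measurable_preimage (@measurable_dir _ _) mA).
Qed.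

Lemma cone_dir (n m : nat) (A : set 'M[R]_(n, m)) r x : 0 < r ->
  cone A (r^-1 *: x) <-> mxnorm2 x <= r /\ A (dir x).
Proof.
move=> r0; have r'0 : 0 < r^-1 by rewrite invr_gt0.
by rewrite /cone /mkset dirZ// mxnorm2Z gtr0_norm// mulrC ler_pdivrMr// mul1r.
Qed.

Local Open Scope ereal_scope.

Definition shell n m (F : set 'M[R]_(n, m)) (e : R) : set 'M[R]_(n, m) :=
  [set x | (1 < mxnorm2 x <= 1 + e)%R /\ F (dir x)].

Lemma measurable_shell n m (F : set 'M[R]_(n, m)) e : measurable F -> measurable (shell F e).
Proof.
move=> mF.
rewrite (_ : shell F e = ([set x | mxnorm2 x <= 1 + e]%R `\` [set x | mxnorm2 x <= 1]%R) `&`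
    (@dir n m @^-1` F)).
  apply: measurableI; last exact: (measurable_preimage (@measurable_dir n m) mF).
  by apply: measurableD; exact: measurable_mxball.
apply/seteqP; split => x /=.
  by move=> [/andP[x1 x2] Fx]; do 2!split => //; apply/negP; rewrite -ltNge.
by move=> [[x2 /negP]]; rewrite -ltNge => x1 Fx; split => //; apply/andP.
Qed.

Lemma leb_rV_ball k (r : R) : (0 < r)%R -> leb_rV R k [set x | mxnorm2 x <= r]%R =
  (r ^+ k)%:E * leb_rV R k [set x | mxnorm2 x <= 1]%R.
Proof.
move=> r0; rewrite -[r in (r ^+ k)%R]invrK exprVn -leb_rV_scale ?invr_gt0//; last exact: measurable_mxball.
congr (leb_rV R k _); apply/seteqP; split => x /=;
by rewrite mxnorm2Z gtr0_norm ?invr_gt0// mulrC ler_pdivrMr// mul1r.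
Qed.

(** The dilate of the cone by 1 + e is covered by the cone and the shell, so the shell has volume at
    least (1 + e)^k - 1 times that of the cone; Bernoulli's inequality bounds this factor below by k
    e. *)
Lemma shell_ge k (F : set 'rV[R]_k) (e : R) : measurable F -> (0 < e)%R ->
  (k%:R * e)%:E * leb_rV R k (cone F) <= leb_rV R k (shell F e).
Proof.
move=> mF e0; set T := shell F e.
have e1 : (0 < 1 + e)%R by rewrite addr_gt0.
have mC := measurable_cone mF.
have mT := measurable_shell e mF.
have vC : leb_rV R k (cone F) < +oo.
  apply: le_lt_trans (leb_rV_ball_lty k 1); apply: le_measure; rewrite ?inE//.
    exact: measurable_mxball.
  by move=> x [].
have big : leb_rV R k ((fun x => (1 + e)^-1 *: x)%R @^-1` cone F) =
    ((1 + e) ^+ k)%:E * leb_rV R k (cone F).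
  by rewrite leb_rV_scale ?invr_gt0// exprVn invrK.
have := @le_measure _ _ _ (leb_rV R k) _ (T `|` cone F) _ _
  (_ : (fun x => (1 + e)^-1 *: x)%R @^-1` cone F `<=` T `|` cone F).
rewrite !inE => /(_ (measurable_preimage (measurable_scalemx _) mC)).
move=> /(_ (measurableU _ _ mT mC)) h.
have {}h : leb_rV R k ((fun x => (1 + e)^-1 *: x)%R @^-1` cone F) <=
    leb_rV R k (T `|` cone F).
  apply: h => x /cone_dir => /(_ e1) [xe Fx].
  by have [x1|x1] := leP (mxnorm2 x) 1%R; [right|left; split => //; rewrite x1 xe].
have {}h : ((1 + e) ^+ k)%:E * leb_rV R k (cone F) <= leb_rV R k T + leb_rV R k (cone F).
  by rewrite -big; apply: (le_trans h); exact: measureU2.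
have /fineK vE : leb_rV R k (cone F) \is a fin_num by rewrite ge0_fin_numE.
have v0 : (0 <= fine (leb_rV R k (cone F)))%R by exact: fine_ge0.
have T0 : 0 <= leb_rV R k T by [].
move: h T0; rewrite -vE; move: (fine _) v0 => v v0.
case: (leb_rV R k T) => [t|_ _|//]; last by rewrite leey.
rewrite -!EFinM -EFinD !lee_fin => h t0.
by have := ler_wpM2r v0 (bernoulli_ge k (ltW e0)); lra.
Qed.

Lemma lebesgue_measure_le_diam (A : set R) (c : R) : measurable A -> (0 <= c)%R ->
  (forall a b, A a -> A b -> `|a - b| <= c)%R -> @lebesgue_measure R A <= c%:E.
Proof.
move=> mA c0 Ac; have [->|/set0P A0] := eqVneq A set0; first by rewrite measure0 lee_fin.
have := lebesgue_measure_le_span mA mA A0 A0 Ac.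
case: (lebesgue_measure A) => [a| |]; last by move=> _; rewrite leNye.
  by rewrite -EFinD !lee_fin => ?; lra.
by rewrite addye.
Qed.

(* The projection of the shell along the first coordinate has diameter at most
   (1 + e) D + e, and its fibres have length at most about e / c; let e tend to 0. *)
Lemma cone_volume_le k (F : set 'rV[R]_k.+1) (c D : R) : measurable F ->
  F `<=` @mxsphere R 1 k.+1 -> (0 < c)%R -> (forall u, F u -> c <= u ord0 ord0)%R ->
  (0 <= D)%R -> diam_le D F ->
  k.+1%:R%:E * leb_rV R k.+1 (cone F) <=
  (c^-1 * (D / 2) ^+ k)%:E * leb_rV R k [set x | mxnorm2 x <= 1]%R.
Proof.
move=> mF FS c0 Fc D0 DF.
have : leb_rV R k.+1 (cone F) \is a fin_num.
  rewrite ge0_fin_numE//.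
  apply: le_lt_trans (leb_rV_ball_lty k.+1 1); apply: le_measure; rewrite ?inE//.
  - exact: measurable_cone.
  - exact: measurable_mxball.
  by move=> x [].
have : leb_rV R k [set x | mxnorm2 x <= 1]%R \is a fin_num.
  by rewrite ge0_fin_numE// leb_rV_ball_lty.
move=> /fineK bE /fineK vE; rewrite -bE -vE.
set b := fine _ in bE *; set v := fine _ in vE *.
rewrite -!EFinM lee_fin.
(* This is the bound for the shell divided by e, with (1 + e / 2) / c the quotient of the fibre
   length [L] below by e; its value at e = 0 is the claim. *)
pose f e := ((1 + e / 2) * c^-1 * (((1 + e) * D + e) / 2) ^+ k * b)%R.
suff h e : (0 < e -> k.+1%:R * v <= f e)%R.
  have -> : (c^-1 * (D / 2) ^+ k * b = f 0)%R by rewrite /f mul0r !addr0 !mul1r.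
  apply: ge_of_right_limit => [|e /andP[e0 _]]; last exact: h.
  have cid (a : R) : {for 0%R, continuous (fun e : R => e * a)%R}.
    by apply: continuousM; [exact: cvg_id|exact: cvg_cst].
  have cst (a : R) : {for 0%R, continuous (fun _ : R => a)} by exact: cvg_cst.
  apply: continuousM; last exact: cst.
  apply: continuousM.
    apply: continuousM; last exact: cst.
    by apply: continuousD; [exact: cst|exact: cid].
  have cD : {for 0%R, continuous (fun e : R => ((1 + e) * D + e) / 2)%R}.
    apply: continuousM; last exact: cst.
    apply: continuousD; last exact: cvg_id.
    apply: continuousM; last exact: cst.
    by apply: continuousD; [exact: cst|exact: cvg_id].
  exact: (continuous_comp cD (@exprn_continuous R k _)).
move=> e0.
set T := shell F e; have := shell_ge mF e0; rewrite -/T.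
have mT : measurable T := measurable_shell e mF.
(* On a fibre, a^2 varies by at most (1 + e)^2 - 1 = e (2 + e), while a sum of two first coordinates
   is at least 2 c. *)
pose L := (e * (2 + e) / (2 * c))%R.
pose D' := ((1 + e) * D + e)%R.
(* Stands for the projection of the shell, which need not be Borel. [Y] is measurable because slice
   lengths are, and the fibres that it leaves out are null. *)
pose Y := [set y | 0 < @lebesgue_measure R (slice T y)].
have L0 : (0 <= L)%R by rewrite divr_ge0 ?mulr_ge0 ?addr_ge0 ?ltW.
have D'0 : (0 < D')%R by rewrite ltr_wpDl// mulr_ge0// addr_ge0// ltW.
have Ta a y : slice T y a -> [/\ (c <= a)%R, (1 < a ^+ 2 + mxnorm2 y ^+ 2)%R &
    (a ^+ 2 + mxnorm2 y ^+ 2 <= (1 + e) ^+ 2)%R].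
  move=> [/andP[x1 x2] /Fc].
  set x := cons_rV (a, y) in x1 x2 *.
  have x0 : (0 < mxnorm2 x)%R by apply: lt_trans x1.
  have -> : (a ^+ 2 + mxnorm2 y ^+ 2 = mxnorm2 x ^+ 2)%R.
    by rewrite mxnorm2_rVS /x cons_rV0 cons_rVK.
  rewrite /dir mxE cons_rV0 /= mulrC ler_pdivlMr// => cxa; split.
  - by apply: le_trans cxa; rewrite ler_peMr// ltW.
  - by rewrite exprn_egt1.
  - by rewrite ler_pXn2r// nnegrE ltW// addr_gt0.
have TL y : @lebesgue_measure R (slice T y) <= L%:E * (\1_Y y)%:E.
  rewrite indicE; have [yY|yY] := boolP (y \in Y); last first.
    by rewrite mule0 leNgt; move: yY; rewrite notin_setE => /negP.
  rewrite mule1; apply: lebesgue_measure_le_diam => //; first exact: measurable_slice.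
  move=> a b' /Ta[ca a1 a2] /Ta[cb b1 b2].
  rewrite /L ler_pdivlMr ?mulr_gt0//.
  apply: (@le_trans _ _ (`|a - b'| * (a + b')))%R; first by rewrite ler_wpM2l//; lra.
  have ab0 : (0 <= a + b')%R by lra.
  rewrite -[X in (_ * X)%R](ger0_norm ab0) -normrM -subr_sqr ler_norml.
  by apply/andP; split; nra.
have mY : measurable Y.
  rewrite -[Y]setTI; apply: measurable_lte => //; exact: measurable_slice_length.
have DY : diam_le D' Y.
  have ne y : Y y -> exists a, slice T y a.
    move=> Yy; apply/set0P; apply/eqP => s0; move: Yy.
    by rewrite /Y /mkset s0 measure0 ltxx.
  move=> y y' /ne[a Ta'] /ne[a' Ta''].
  pose x := cons_rV (a, y); pose x' := cons_rV (a', y').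
  have [/andP[x1 x2] Fx] : T x by [].
  have [/andP[x'1 x'2] Fx'] : T x' by [].
  apply: (@le_trans _ _ (mxnorm2 (x - x'))%R).
    rewrite -(@ler_pXn2r _ 2)// ?nnegrE ?mxnorm2_ge0// [leRHS]mxnorm2_rVS.
    by rewrite head_tail_rVB !cons_rVK/= lerDr sqr_ge0.
  (* A change of direction at radius at most 1 + e, costing (1 + e) D, plus a change of radius,
     costing at most e: together D'. *)
  have -> : (x - x' = mxnorm2 x *: (dir x - dir x') + (mxnorm2 x - mxnorm2 x') *: dir x')%R.
    by rewrite scalerBr scalerBl !mxnorm2_dirK addrA subrK.
  apply: (le_trans (mxnorm2D _ _)); rewrite /D' mxnorm2Z [X in (_ + X <= _)%R]mxnorm2Z (FS _ Fx') mulr1.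
  apply: lerD.
    by rewrite ger0_norm ?mxnorm2_ge0// ler_pM ?mxnorm2_ge0//; exact: DF.
  by rewrite ler_norml; lra.
have : leb_rV R k.+1 T <= (L * (D' / 2) ^+ k * b)%:E.
  rewrite leb_rV_slice//.
  apply: (@le_trans _ _ (\int[leb_rV R k]_y (L%:E * (\1_Y y)%:E))).
    apply: ge0_le_integral => //.
    - exact: measurable_slice_length.
    - by apply: emeasurable_funM => //; exact/measurable_EFinP.
  rewrite ge0_integralZl ?integral_indic ?setIT//; last exact/measurable_EFinP.
  rewrite -mulrA [X in _ <= X]EFinM; apply: lee_pmul => //.
  apply: (le_trans (isodiametric (ltW D'0) mY DY)).
  by rewrite leb_rV_ball ?divr_gt0// -bE EFinM.
move=> /[swap] /le_trans /[apply].
rewrite -vE -EFinM lee_fin => h; rewrite -(ler_pM2l e0).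
apply: le_trans (le_trans h _); first by rewrite mulrCA mulrA.
rewrite /f -/D' /L le_eqVlt; apply/orP; left; apply/eqP.
by field; rewrite gt_eqF.
Qed.

End cone.

Section hausdorff_ge.
Context (R : realType).

Lemma reflectionZ n m (w x : 'M[R]_(n, m)) a : reflection w (a *: x) = a *: reflection w x.
Proof.
rewrite /reflection mxdotZl scalerBr scalerA; congr (_ - _ *: _); ring.
Qed.

Lemma dir_reflection n m (w x : 'M[R]_(n, m)) : dir (reflection w x) = reflection w (dir x).
Proof. by rewrite /dir reflectionZ mxnorm2_reflection. Qed.

Lemma reflectionB n m (w : 'M[R]_(n, m)) x y :
  reflection w (x - y) = reflection w x - reflection w y.
Proof. by rewrite reflectionD -scaleN1r reflectionZ scaleN1r. Qed.

Lemma cone_reflection n m (w : 'M[R]_(n, m)) A :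
  cone (reflection w @^-1` A) = reflection w @^-1` cone A.
Proof.
by apply/seteqP; split => x; rewrite /cone /preimage /mkset dir_reflection mxnorm2_reflection.
Qed.

Lemma mxdotB_sphere n m (x y : 'M[R]_(n, m)) : mxnorm2 x = 1 -> mxnorm2 y = 1 ->
  mxnorm2 (x - y) ^+ 2 = 2 - 2 * mxdot x y.
Proof.
move=> x1 y1; rewrite mxnorm2_sqr !(mxdotDl, mxdotDr, mxdotNl, mxdotNr) (mxdotC y x).
rewrite -!mxnorm2_sqr x1 y1; ring.
Qed.

Lemma mxdot_delta n m (x : 'M[R]_(n, m)) i j : mxdot x (delta_mx i j) = x i j.
Proof.
rewrite mxdotE (bigD1 i)//= (bigD1 j)//= mxE !eqxx mulr1 !big1 ?addr0//.
  by move=> i' /negPf ii'; apply: big1 => j' _; rewrite mxE ii' mulr0.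
by move=> j' /negPf jj'; rewrite mxE jj' andbF mulr0.
Qed.

Lemma mxnorm2_delta n m i j : mxnorm2 (delta_mx i j : 'M[R]_(n, m)) = 1.
Proof. by rewrite /mxnorm2 mxdot_delta mxE !eqxx sqrtr1. Qed.

Local Open Scope ereal_scope.

Lemma leb_rV_reflection k (w : 'rV[R]_k) A : measurable A ->
  leb_rV R k (reflection w @^-1` A) = leb_rV R k A.
Proof.
move=> mA; apply: (@leb_rV_isometry _ _ _ (reflection w)) => //.
- exact: measurable_reflection.
- exact: measurable_reflection.
- exact: reflectionK.
- exact: reflectionK.
- exact: reflectionD.
- by move=> x; exact: mxnorm2_reflection.
Qed.

(* A reflection moves a point of [F] to the first basis vector, after which the
   first coordinate is at least 1 - delta^2 / 2 on [F]. *)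
Lemma cone_volume_diam N k (F : set 'rV[R]_N) (delta D : R) : N = k.+1 ->
  measurable F -> F `<=` @mxsphere R 1 N -> (0 <= D)%R -> (D <= delta)%R -> (delta < 1)%R ->
  diam_le D F ->
  N%:R%:E * leb_rV R N (cone F) <=
  ((1 - delta ^+ 2 / 2)^-1 * (D / 2) ^+ k)%:E * leb_rV R k [set x | mxnorm2 x <= 1]%R.
Proof.
move=> Nk mF FS D0 Dd d1 DF; subst N.
have c0 : (0 < 1 - delta ^+ 2 / 2)%R by nra.
have [->|/set0P[u0 Fu0]] := eqVneq F set0.
  rewrite (_ : cone set0 = set0) ?measure0 ?mule0; last by rewrite -subset0 => x [].
  by rewrite mule_ge0// lee_fin mulr_ge0 ?invr_ge0 ?exprn_ge0 ?divr_ge0// ltW.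
pose e1 : 'rV[R]_k.+1 := delta_mx ord0 ord0.
pose g := reflection (u0 - e1)%R.
have gu0 : g u0 = e1.
  by apply: reflection_swap; rewrite mxnorm2_delta; exact: FS.
have ge1 : g e1 = u0 by rewrite -gu0 /g reflectionK.
have mg := measurable_preimage (measurable_reflection (u0 - e1)%R) mF.
rewrite -(leb_rV_reflection (u0 - e1)); last exact: measurable_cone.
rewrite -cone_reflection; apply: cone_volume_le => //.
- by move=> u /FS; rewrite /mxsphere /mkset mxnorm2_reflection.
- move=> u Fu; have uS : (mxnorm2 u = 1)%R by have := FS _ Fu; rewrite /mxsphere /mkset mxnorm2_reflection.
  have : (mxnorm2 (u - e1) <= delta)%R.
    rewrite -(mxnorm2_reflection (u0 - e1)) reflectionB -/g ge1.
    by apply: le_trans Dd; exact: DF.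
  rewrite -(@ler_pXn2r _ 2)// ?nnegrE ?mxnorm2_ge0 ?(le_trans D0)//.
  by rewrite mxdotB_sphere ?mxnorm2_delta// mxdot_delta; lra.
- by move=> x y Fx Fy; rewrite -(mxnorm2_reflection (u0 - e1)) reflectionB; exact: DF.
Qed.

Lemma omegaE k : omega R k = leb_rV R k [set x | mxnorm2 x <= 1]%R.
Proof.
rewrite /omega lebesgue_mxE leb_mx_rV vec_mx_ball.
by rewrite muln1.
Qed.

Lemma omega_ge0 k : 0 <= omega R k.
Proof. by rewrite omegaE. Qed.

Lemma diameter_ge0 n m (F : set 'M[R]_(n, m)) : F !=set0 -> 0 <= diameter F.
Proof.
move=> [x Fx]; apply: ereal_sup_ubound; exists x => //; exists x => //.
by rewrite subrr mxnorm20.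
Qed.

Lemma hausdorff_weight_ge0 n m k (F : set 'M[R]_(n, m)) : 0 <= hausdorff_weight k F.
Proof.
rewrite /hausdorff_weight; case: ifPn => // /set0P F0.
by rewrite mule_ge0 ?expe_ge0 ?diameter_ge0// mule_ge0 ?omega_ge0// lee_fin.
Qed.

Lemma closure_diam_le n m (D : R) (F : set 'M[R]_(n, m)) : diam_le D F -> diam_le D (closure F).
Proof.
move=> DF.
have cl (y : 'M[R]_(n, m)) : closed [set x | mxnorm2 (x - y) <= D]%R.
  rewrite (_ : mkset _ = (fun x => mxnorm2 (x - y)) @^-1` [set r | r <= D]%R)//.
  apply: closed_comp; last exact: closed_le.
  move=> x _; have cB : {for x, continuous (fun x : 'M[R]_(n, m) => x - y)%R}.
    by apply: continuousB; [exact: cvg_id|exact: cst_continuous].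
  exact: (continuous_comp cB (@continuous_mxnorm2 R n m _)).
have h x y : closure F x -> F y -> (mxnorm2 (x - y) <= D)%R.
  move=> Fx Fy; have := closureS (_ : F `<=` [set x | mxnorm2 (x - y) <= D]%R) Fx.
  by rewrite -(proj1 (closure_id _) (cl y)); apply => z Fz; exact: DF.
move=> x y Fx Fy; rewrite -mxnorm2N opprB.
have := closureS (_ : F `<=` [set z | mxnorm2 (z - x) <= D]%R) Fy.
rewrite -(proj1 (closure_id _) (cl x)); apply => z Fz /=.
by rewrite -mxnorm2N opprB; exact: h.
Qed.

Definition cone_measure n m (A : set 'M[R]_(n, m)) : \bar R :=
  (n * m)%:R%:E * leb_mx R n m (cone A).

(** The covering sets in a Hausdorff content are arbitrary; the closure is Borel and obeys the same
    bound on the diameter. The extra factor tends to 1 with [delta]. *)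
Lemma cone_measure_weight n m k (F : set 'M[R]_(n, m)) (delta : R) : (n * m = k.+1)%N ->
  (0 < delta < 1)%R -> diameter F <= delta%:E ->
  cone_measure (closure F `&` @mxsphere R n m) <=
  (1 - delta ^+ 2 / 2)^-1%:E * hausdorff_weight k F.
Proof.
move=> nmk /andP[d0 d1] Fd; rewrite /hausdorff_weight.
have c0 : (0 <= (1 - delta ^+ 2 / 2)^-1)%R by rewrite invr_ge0; nra.
case: ifPn => [/eqP ->|/set0P F0].
  rewrite closure0 set0I /cone_measure (_ : cone set0 = set0) ?measure0 ?mule0//.
  by rewrite -subset0 => x [].
have /fineK DE : diameter F \is a fin_num.
  by rewrite ge0_fin_numE ?diameter_ge0// (le_lt_trans Fd)// ltry.
set D := fine _ in DE.
have D0 : (0 <= D)%R by rewrite -lee_fin DE diameter_ge0.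
have DF : diam_le D F.
  move=> x y Fx Fy; rewrite -lee_fin DE; apply: ereal_sup_ubound.
  by exists x => //; exists y.
have Dd : (D <= delta)%R by rewrite -lee_fin DE.
pose G := vec_mx @^-1` (closure F `&` @mxsphere R n m).
have mS : measurable (@mxsphere R n m).
  rewrite (_ : mxsphere (m:=m) = @mxnorm2 R n m @^-1` [set 1%R])//.
  by apply: measurable_preimage; [exact: measurable_mxnorm2|exact: measurable_set1].
have mG : measurable G.
  apply: measurable_vec_mx_preimage; apply: measurableI => //.
  by apply: closed_measurable_mx; exact: closed_closure.
have GS : G `<=` @mxsphere R 1 (n * m).
  by move=> x [_]; rewrite /mxsphere /mkset mxnorm2_vec.
have DG : diam_le D G.
  move=> x y [Fx _] [Fy _]; rewrite -mxnorm2_vec linearB; exact: (closure_diam_le DF Fx Fy).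
have := cone_volume_diam nmk mG GS D0 Dd d1 DG.
rewrite /cone_measure leb_mx_rV -DE -EFin_expe omegaE.
rewrite (_ : vec_mx @^-1` _ = cone G); last first.
  apply/seteqP; split => x; rewrite /cone /preimage /mkset mxnorm2_vec => -[x1];
  by rewrite /G /preimage /mkset /dir linearZ mxnorm2_vec.
move=> /le_trans; apply.
have /fineK <- : leb_rV R k [set x | mxnorm2 x <= 1]%R \is a fin_num.
  by rewrite ge0_fin_numE// leb_rV_ball_lty.
rewrite -!EFinM lee_fin expr_div_n le_eqVlt; apply/orP; left; apply/eqP.
by ring.
Qed.

(** Each covering set has weight at least its cone measure up to a factor 1 - delta^2 / 2; sum over
    the cover by subadditivity and let [delta] tend to 0. *)
Lemma hausdorff_ge n m k (A : set 'M[R]_(n, m)) : (n * m = k.+1)%N ->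
  measurable A -> A `<=` @mxsphere R n m -> cone_measure A <= hausdorff k A.
Proof.
move=> nmk mA AS.
have content delta : (0 < delta < 1)%R ->
    (1 - delta ^+ 2 / 2)%:E * cone_measure A <= hausdorff k A.
  move=> d01; have /andP[d0 d1] := d01.
  have c0 : (0 < 1 - delta ^+ 2 / 2)%R by nra.
  apply: (@le_trans _ _ (hausdorff_content k delta A)); last first.
    by apply: ereal_sup_ubound; exists delta.
  apply: le_ereal_inf_tmp => _ [F [AF Fd] <-].
  have mS : measurable (@mxsphere R n m).
    rewrite (_ : mxsphere (m:=m) = @mxnorm2 R n m @^-1` [set 1%R])//.
    by apply: measurable_preimage; [exact: measurable_mxnorm2|exact: measurable_set1].
  pose G i := closure (F i) `&` @mxsphere R n m.
  have mG i : measurable (G i).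
    by apply: measurableI => //; apply: closed_measurable_mx; exact: closed_closure.
  have Asum : cone_measure A <= \sum_(0 <= i <oo) cone_measure (G i).
    rewrite /cone_measure nneseriesZl//; apply: lee_pmul => //.
    apply: measure_sigma_subadditive.
    - by move=> i; exact: measurable_cone.
    - exact: measurable_cone.
    - move=> x [x1 Ax]; have [i _ Fi] := AF _ Ax; exists i => //; split => //.
      by split; [exact: subset_closure|exact: AS].
  have wsum : \sum_(0 <= i <oo) cone_measure (G i) <=
      (1 - delta ^+ 2 / 2)^-1%:E * \sum_(0 <= i <oo) hausdorff_weight k (F i).
    rewrite -nneseriesZl//; last by move=> i _; exact: hausdorff_weight_ge0.
    apply: lee_nneseries => i _; first by rewrite /cone_measure mule_ge0.
    exact: cone_measure_weight.
  apply: (le_trans (lee_wpmul2l _ (le_trans Asum wsum))); first by rewrite lee_fin ltW.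
  by rewrite muleA -EFinM divff ?mul1e// gt_eqF.
have : cone_measure A \is a fin_num.
  rewrite fin_numM// ge0_fin_numE//; apply: le_lt_trans (leb_mx_ball_lty n m 1%R).
  apply: le_measure; rewrite ?inE//; first exact: measurable_cone.
    exact: measurable_mxball.
  by move=> x [].
case: (hausdorff k A) content => [h||] content; last 2 first.
- by rewrite leey.
- move=> /fineK cE; have h : (0 < (1 / 2 : R) < 1)%R by apply/andP; split; lra.
  by have := content _ h; rewrite -cE -EFinM.
move=> /fineK cE; move: content; rewrite -cE; set s := fine _ => content.
rewrite lee_fin.
pose f (delta : R) := (h - (1 - delta ^+ 2 / 2) * s)%R.
suff : (0 <= f 0)%R by rewrite /f expr0n/= mul0r subr0 mul1r subr_ge0.
apply: ge_of_right_limit.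
  apply: continuousB; first exact: cvg_cst.
  apply: continuousM; last exact: cvg_cst.
  apply: continuousB; first exact: cvg_cst.
  by apply: continuousM; [exact: exprn_continuous|exact: cvg_cst].
by move=> e /content; rewrite -EFinM lee_fin /f subr_ge0.
Qed.

End hausdorff_ge.

Section integral_set_function.
Context d (T : measurableType d) (R : realType).
Local Open Scope ereal_scope.

Import HBNNSimple.

(** Even when [nu] is not a measure, its integral is defined by suprema over simple functions, so
    the two integrals can be compared term by term. Level sets of nonzero values lie in [D], because
    [f] is extended by 0 outside [D]. *)
Lemma le_integral_set_function (mu : {measure set T -> \bar R}) (nu : set T -> \bar R)
    (D : set T) (f : T -> \bar R) :
  (forall x, D x -> 0 <= f x) -> nu set0 = 0 ->
  (forall A, measurable A -> A `<=` D -> mu A <= nu A) ->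
  \int[mu]_(x in D) f x <= \int[nu]_(x in D) f x.
Proof.
move=> f0 nu0 munu; rewrite ge0_integralE// [leRHS]/integral.
rewrite funepos_restrict funeneg_restrict.
have /eq_restrictP-> := ge0_funeposE f0.
have /eq_restrictP-> := ge0_funenegE f0.
rewrite erestrict0.
have sintE (h : {nnsfun T >-> R}) :
    sintegral nu h = \sum_(x \in range h) x%:E * nu (h @^-1` [set x]).
  rewrite /sintegral (fsbig_widen (range h) setT)//= => x [_ Nhx] /=.
  by rewrite preimage10// nu0 mule0.
(* The integral is a difference of two suprema. The one for the negative part runs over simple
   functions below 0, hence equal to 0. *)
rewrite [X in _ - X](_ : _ = 0) ?sube0; last first.
  have s0 (h : {nnsfun T >-> R}) : (forall x, (h x)%:E <= cst 0 x) -> sintegral nu h = 0.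
    move=> h0; rewrite sintE fsbig1// => _ [x _ <-].
    have -> : h x = 0%R by apply/eqP; rewrite eq_le fun_ge0 andbT -lee_fin h0.
    by rewrite mul0e.
  apply/eqP; rewrite eq_le; apply/andP; split.
    by apply: ge_ereal_sup => _ [h /= h0 <-]; rewrite s0.
  by apply: ereal_sup_ubound; exists nnsfun0 => //; rewrite s0.
apply: ge_ereal_sup => _ [h /= hf <-].
apply: (@le_trans _ _ (sintegral nu h)); last first.
  by apply: ereal_sup_ubound; exists h.
rewrite sintegralE sintE lee_fsum// => r [t _ <-].
have [ht0|ht0] := eqVneq (h t) 0%R; first by rewrite ht0 !mul0e.
apply: lee_pmul => //; first by rewrite lee_fin.
apply: munu => // x /= hx; have := hf x; rewrite hx patchE.
case: ifPn => [/set_mem//|_]; rewrite lee_fin => ht.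
by move: ht0; rewrite eq_le ht fun_ge0.
Qed.

End integral_set_function.

Section sphere_measure.
Context (R : realType) (n m : nat).
Local Open Scope ereal_scope.

(** A cone is the preimage under [dir] within the unit ball, so the cone measure is N times a
    pushforward of Lebesgue measure restricted to the ball. *)
Lemma sphere_measure_ex : {nu : {sigma_finite_measure set 'M[R]_(n, m) -> \bar R} |
  forall A, nu A = cone_measure A}.
Proof.
have mB := @measurable_mxball R n m 1%R.
have [nu0 nu0E] := pushforward_measure_ex (mrestr (leb_mx R n m) mB) (@measurable_dir R n m).
pose nu1 : {measure set 'M[R]_(n, m) -> \bar R} := mscale (NngNum (ler0n R (n * m))) nu0.
have nu1E A : nu1 A = cone_measure A.
  transitivity ((n * m)%:R%:E * nu0 A) => //.
  rewrite nu0E /mrestr /cone_measure; congr (_ * leb_mx R n m _).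
  by apply/seteqP; split => x [].
have sf : sigma_finite setT nu1.
  exists (fun=> setT) => [|i]; first by rewrite bigcup_const.
  split => //; rewrite nu1E /cone_measure lte_mul_pinfty ?lee_fin//.
  apply: le_lt_trans (leb_mx_ball_lty n m 1%R).
  apply: le_measure; rewrite ?inE//; first exact: measurable_cone.
  by move=> x [].
by exists (sigma_finite_pack sf).
Qed.

Definition sphere_measure := sval sphere_measure_ex.

Lemma sphere_measureE A : sphere_measure A = cone_measure A.
Proof. by rewrite /sphere_measure; case: sphere_measure_ex. Qed.

Lemma measurable_mxsphere : measurable (@mxsphere R n m).
Proof.
rewrite (_ : mxsphere (m:=m) = @mxnorm2 R n m @^-1` [set 1%R])//.
by apply: measurable_preimage; [exact: measurable_mxnorm2|exact: measurable_set1].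
Qed.

End sphere_measure.

Section radial_volume.
Context (R : realType) (n m : nat).
Local Open Scope ereal_scope.

Import HBNNSimple.
Implicit Types x u : 'M[R]_(n, m).

(** The origin is removed because its direction [dir 0 = 0] is not on the sphere. *)
Definition punctured_ball (a : R) : set 'M[R]_(n, m) :=
  [set x | x != 0%R /\ (mxnorm2 x < a)%R].

Lemma measurable_punctured_ball a : measurable (punctured_ball a).
Proof.
rewrite (_ : punctured_ball a = (@mxnorm2 R n m) @^-1` `]0%R, a[%classic).
  by apply: measurable_preimage; [exact: measurable_mxnorm2|exact: measurable_itv].
apply/seteqP; split => x; rewrite /punctured_ball /= in_itv/= mxnorm2_gt0; first by case=> -> ->.
by move=> /andP[].
Qed.

Lemma measurable_dir_preimage (A : set 'M[R]_(n, m)) : measurable A ->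
  measurable (@dir R n m @^-1` A).
Proof. exact: (measurable_preimage (@measurable_dir R n m)). Qed.

Lemma leb_mx_cone_section (A : set 'M[R]_(n, m)) (a : R) : measurable A -> (0 <= a)%R ->
  (n * m)%:R%:E * leb_mx R n m (punctured_ball a `&` @dir R n m @^-1` A) <=
  (a ^+ (n * m))%:E * sphere_measure R n m (A `&` @mxsphere R n m).
Proof.
move=> mA; rewrite le_eqVlt => /orP[/eqP <-|a0].
  rewrite (_ : punctured_ball 0 = set0) ?set0I ?measure0 ?mule0.
    by rewrite mule_ge0// lee_fin exprn_ge0.
  by rewrite -subset0 => x [_]; rewrite ltNge mxnorm2_ge0.
rewrite sphere_measureE /cone_measure muleCA lee_pmul//.
rewrite -[a in leRHS]invrK exprVn -leb_mx_scale ?invr_gt0//; last first.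
  by apply: measurable_cone; apply: measurableI => //; exact: measurable_mxsphere.
apply: le_measure; rewrite ?inE.
- apply: measurableI; [exact: measurable_punctured_ball|exact: measurable_dir_preimage].
- apply: (measurable_preimage (measurable_scalemx _)); apply: measurable_cone.
  by apply: measurableI => //; exact: measurable_mxsphere.
move=> x [[x0 xa] Ax]; apply/(cone_dir _ _ a0); split; first exact: ltW.
by split => //; exact/mxsphere_dir.
Qed.

Lemma fsum_fimfun (r : {nnsfun 'M[R]_(n, m) >-> R}) (g : R -> \bar R) u :
  \sum_(a \in range r) (g a * (\1_(r @^-1` [set a]) u)%:E) = g (r u).
Proof.
rewrite (fsbigD1 (r u))// indicE mem_set// mule1 fsbig1; first exact: adde0.
by move=> a [_ /= /eqP ar]; rewrite indicE memNset ?mule0// => /= ra; rewrite ra eqxx in ar.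
Qed.

(** A simple radial function cuts the region into finitely many truncated cones, and the volume of
    each is a scaled cone measure. *)
Lemma radial_volume_nnsfun (r : {nnsfun 'M[R]_(n, m) >-> R}) :
  (n * m)%:R%:E * leb_mx R n m [set x | punctured_ball (r (dir x)) x] <=
  \int[sphere_measure R n m]_(u in @mxsphere R n m) (r u ^+ (n * m))%:E.
Proof.
set D := mkset _.
have mr a : measurable (r @^-1` [set a]) by [].
pose Da a := punctured_ball a `&` @dir R n m @^-1` (r @^-1` [set a]).
have mDa a : measurable (Da a).
  by apply: measurableI; [exact: measurable_punctured_ball|exact: measurable_dir_preimage].
have finr : finite_set (range r) by [].
have DDa : D = \bigcup_(a in range r) Da a.
  apply/seteqP; split => x.
    by move=> Dx; exists (r (dir x)) => //; exists (dir x).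
  by move=> [_ [u _ <-]] [h1 /= h2]; rewrite /D /mkset h2.
have mD : measurable D by rewrite DDa; exact: fin_bigcup_measurable.
have -> : leb_mx R n m D = \sum_(a \in range r) leb_mx R n m (Da a).
  rewrite -[D]setIT -integral_indic//.
  transitivity (\int[leb_mx R n m]_x \sum_(a \in range r) ((\1_(Da a) : _ -> R) x)%:E).
    apply: eq_integral => x _.
    have eD : (x \in D) = (x \in punctured_ball (r (dir x))).
      by apply/idP/idP; rewrite !inE.
    transitivity ((\1_(punctured_ball (r (dir x))) : _ -> R) x)%:E.
      by rewrite !indicE eD.
    rewrite -(@fsum_fimfun r (fun a => ((\1_(punctured_ball a) : _ -> R) x)%:E)).
    by apply: eq_fsbigr => a _; rewrite /Da indicI -EFinM; congr (_ * _)%:E.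
  rewrite ge0_integral_fsum//.
    by apply: eq_fsbigr => a _; rewrite integral_indic// setIT.
  by move=> a; exact/measurable_EFinP.
have -> : \int[sphere_measure R n m]_(u in @mxsphere R n m) (r u ^+ (n * m))%:E =
    \sum_(a \in range r) (a ^+ (n * m))%:E *
      sphere_measure R n m (r @^-1` [set a] `&` @mxsphere R n m).
  (* The absolute value changes nothing on the range of [r]; it makes the summand nonnegative for
     every [a], as needed to exchange sum and integral. *)
  transitivity (\int[sphere_measure R n m]_(u in @mxsphere R n m)
     \sum_(a \in range r) (`|a| ^+ (n * m))%:E * ((\1_(r @^-1` [set a]) : _ -> R) u)%:E).
    apply: eq_integral => u _.
    by rewrite (@fsum_fimfun r (fun a => (`|a| ^+ (n * m))%:E)) ger0_norm.
  have mS := @measurable_mxsphere R n m.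
  rewrite ge0_integral_fsum//; last first.
    by move=> a; apply: emeasurable_funM => //; exact/measurable_EFinP.
  apply: eq_fsbigr => _ /set_mem[u _ <-].
  rewrite ge0_integralZl ?integral_indic ?ger0_norm//; first exact/measurable_EFinP.
  by rewrite lee_fin exprn_ge0.
rewrite ge0_mule_fsumr//; apply: lee_fsum => // _ [u _ <-].
exact: leb_mx_cone_section.
Qed.

(** One inequality of integration in polar coordinates. The region has radial function 1 / G; since
    |x| lies strictly below it in the direction of x, the regions of simple functions increasing to
    1 / G exhaust the set, and each is handled by [radial_volume_nnsfun]. *)
Lemma radial_volume (G : 'M[R]_(n, m) -> R) : measurable_fun setT G ->
  (forall x, 0 <= G x)%R -> (forall r x, 0 < r -> G (r *: x) = r * G x)%R ->
  (n * m)%:R%:E * leb_mx R n m [set x | x != 0%R /\ (G x < 1)%R] <=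
  \int[sphere_measure R n m]_(u in @mxsphere R n m) poweRV (G u)%:E (n * m)%:R.
Proof.
move=> mG G0 GZ.
(* Infinite where G vanishes, in accordance with the convention 0^(-a) = +oo of [poweRV]. *)
pose rho x := if G x == 0%R then +oo else ((G x)^-1)%:E.
have mGN a : measurable_fun setT (fun x => powR (G x) a).
  exact: (measurableT_comp (@measurable_powR R a) mG).
have mif (y : \bar R) g : measurable_fun setT g ->
    measurable_fun setT (fun x => if G x == 0%R then y else g x).
  move=> mg; apply: measurable_fun_ifT => //.
  by apply: measurable_fun_eqr.
have mrho : measurable_fun setT rho.
  apply: mif; under eq_fun do rewrite -powR_inv1//.
  exact/measurable_EFinP.
have rho0 x : 0 <= rho x.
  by rewrite /rho; case: ifPn => // _; rewrite lee_fin invr_ge0.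
pose r := nnsfun_approx measurableT mrho.
pose D k := [set x | punctured_ball (r k (dir x)) x].
have mD k : measurable (D k).
  rewrite (_ : D k = [set x | mxnorm2 x < r k (dir x)]%R `&` ~` [set 0%R]).
    apply: measurableI.
      rewrite -[X in measurable X]setTI.
      apply: measurable_fun_ltr => //; first exact: measurable_mxnorm2.
      exact: (measurableT_comp _ (@measurable_dir R n m)).
    exact: measurableC (measurable_set1_mx _).
  by apply/seteqP; split => x [x0 x1]; split => //; [exact/eqP|exact/eqP].
have ndD : nondecreasing_seq D.
  move=> i j ij; apply/subsetPset => x [x0 xi]; split => //.
  by apply: (lt_le_trans xi); exact/lefP/nd_nnsfun_approx.
have mU : measurable (\bigcup_k D k) by exact: bigcupT_measurable.
apply: (@le_trans _ _ ((n * m)%:R%:E * leb_mx R n m (\bigcup_k D k))).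
  apply: lee_pmul => //; apply: le_measure; rewrite ?inE//.
    rewrite (_ : mkset _ = ~` [set 0%R] `&` G @^-1` `]-oo, 1%R[%classic).
      apply: measurableI; first exact: measurableC (measurable_set1_mx _).
      by apply: (measurable_preimage mG); exact: measurable_itv.
    apply/seteqP; split => x; rewrite /= in_itv/=; last by case=> /eqP.
    by case=> x0 ->; split => //; exact/eqP.
  move=> x [x0 Gx].
  have nx : (0 < mxnorm2 x)%R by rewrite mxnorm2_gt0.
  have : (mxnorm2 x)%:E < rho (dir x).
    rewrite /rho; case: ifPn => [|Gd0]; first by rewrite ltry.
    have Gd : G (dir x) = ((mxnorm2 x)^-1 * G x)%R by rewrite GZ// invr_gt0.
    have Gx0 : (0 < G x)%R.
      by rewrite lt0r G0 andbT; apply: contra_neq Gd0; rewrite Gd => ->; rewrite mulr0.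
    by rewrite lte_fin Gd invfM invrK ltr_pdivlMr// gtr_pMr.
  have rd := cvg_nnsfun_approx measurableT mrho (fun x _ => rho0 x) (I : setT (dir x)).
  rewrite -/r in rd => xrho; apply: contrapT => xD; move: xrho; apply/negP; rewrite -leNgt.
  rewrite -(cvg_lim _ rd)//; apply: lime_le; first by apply/cvg_ex; eexists; exact: rd.
  apply: nearW => k /=; rewrite lee_fin leNgt; apply/negP => xk; apply: xD.
  by exists k.
have cD := nondecreasing_cvg_mu mD mU ndD.
have cD' : (fun k => (n * m)%:R%:E * leb_mx R n m (D k)) @ \oo -->
    (n * m)%:R%:E * leb_mx R n m (\bigcup_k D k) 
  by apply: cvgeZl => //; exact: cD.
rewrite -(cvg_lim _ cD')//; apply: lime_le; first by apply/cvg_ex; eexists; exact: cD'.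
apply: nearW => k; apply: (le_trans (radial_volume_nnsfun _)).
apply: ge0_le_integral => //.
- exact: measurable_mxsphere.
- by move=> u _; rewrite lee_fin exprn_ge0.
- by apply: measurable_funTS; apply/measurable_EFinP; apply: measurable_funX.
- apply: measurable_funTS; rewrite /poweRV.
  apply: (eq_measurable_fun (fun x => if G x == 0%R then +oo else
      (powR (G x) (- (n * m)%:R))%:E)).
    by move=> x _; rewrite eqe.
  by apply: mif; apply/measurable_EFinP; exact: mGN.
move=> u _; rewrite /poweRV eqe.
have : (r k u)%:E <= rho u by rewrite /r nnsfun_approxE; apply: le_approx => // x _; exact: rho0.
rewrite /rho; case: ifPn => [_ _|Gu]; first by rewrite leey.
rewrite lee_fin => ru; rewrite /= lee_fin powRN powR_mulrn// -exprVn.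
by apply: lerXn2r ru; rewrite nnegrE ?invr_ge0 ?fun_ge0.
Qed.

End radial_volume.

(** * Averaging over rotations *)

Section layer_cake.
Context (R : realType) (n m : nat).
Local Open Scope ereal_scope.
Local Notation leb := (@lebesgue_measure R).
Implicit Types (G : 'M[R]_(n, m) -> R) (p : R).

Definition tent (s : R) : R := Num.max (1 - s)%R 0%R.

(** The integral of (1 - t)^(N / p) over [0, 1), with N = n m. It does not depend on G, and being
    positive and finite it can be cancelled. *)
Definition layer_const p : \bar R :=
  \int[leb]_(t in `[0%R, 1%R[) ((powR (1 - t) p^-1) ^+ (n * m))%:E.

Lemma measurable_layer p : measurable_fun setT
  (fun t : measurableTypeR R => ((powR (1 - t) p^-1) ^+ (n * m))%:E : \bar R).
Proof.
apply/measurable_EFinP; apply: measurable_funX.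
apply: (measurableT_comp (@measurable_powR R p^-1)).
by apply: measurable_funB => //.
Qed.

Lemma layer_const_lty p : (0 < p)%R -> layer_const p < +oo.
Proof.
move=> p0; apply: (@le_lt_trans _ _ (\int[leb]_(t in `[0%R, 1%R[) 1%:E)).
  apply: ge0_le_integral => //.
  - by move=> t _; rewrite lee_fin exprn_ge0// powR_ge0.
  - exact: measurable_funTS (measurable_layer _).
  move=> t /=; rewrite in_itv/= => /andP[t0 t1]; rewrite lee_fin exprn_ile1//.
    exact: powR_ge0.
  apply: (@le_trans _ _ (powR 1 p^-1)); last by rewrite powR1.
  by apply: ge0_ler_powR; rewrite ?nnegrE ?invr_ge0 ?(ltW p0)//; lra.
rewrite integral_cst//= mul1e lebesgue_measure_itv/= lte_fin ltr01.
by rewrite -EFinB ltry.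
Qed.

Lemma layer_const_gt0 p : (0 < p)%R -> 0 < layer_const p.
Proof.
move=> p0; pose k : R := ((powR (1 / 2) p^-1) ^+ (n * m))%R.
have k0 : (0 < k)%R by rewrite exprn_gt0// powR_gt0.
apply: (@lt_le_trans _ _ (\int[leb]_(t in `[0%R, (1/2)%R]) k%:E)).
  rewrite integral_cst//= lebesgue_measure_itv/= lte_fin divr_gt0//.
  by rewrite -EFinB -EFinM lte_fin mulr_gt0// subr0 divr_gt0.
apply: (@le_trans _ _ (\int[leb]_(t in `[0%R, (1/2)%R]) ((powR (1 - t) p^-1) ^+ (n * m))%:E)).
  apply: ge0_le_integral => //.
  - by move=> t _; rewrite lee_fin ltW.
  - exact: measurable_funTS (measurable_layer _).
  move=> t /=; rewrite in_itv/= => /andP[t0 t1]; rewrite lee_fin.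
  apply: lerXn2r; rewrite ?nnegrE ?powR_ge0//.
  by apply: ge0_ler_powR; rewrite ?nnegrE ?invr_ge0 ?(ltW p0)//; lra.
apply: ge0_subset_integral => //.
- exact: measurable_funTS (measurable_layer _).
- by move=> t _; rewrite lee_fin exprn_ge0// powR_ge0.
- by move=> t /=; rewrite !in_itv/= => /andP[-> /= t1]; lra.
Qed.

(** For t in [0, 1), the set where the tent exceeds t is {G < (1 - t)^(1/p)}, a dilate of {G < 1},
    whose volume carries the factor (1 - t)^(N / p). *)
Lemma layer_cake G p : (0 < p)%R -> measurable_fun setT G ->
  (forall x, 0 <= G x)%R -> (forall r x, 0 < r -> G (r *: x) = r * G x)%R ->
  \int[leb_mx R n m]_x (tent (powR (G x) p))%:E =
  layer_const p * leb_mx R n m [set x | G x < 1]%R.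
Proof.
move=> p0 mG G0 GZ.
have mGp : measurable_fun setT (fun x => powR (G x) p).
  exact: (measurableT_comp (@measurable_powR R p) mG).
pose E : set ('M[R]_(n, m) * measurableTypeR R) :=
  [set z | (0 <= z.2)%R /\ (z.2 < 1 - powR (G z.1) p)%R].
have mE : measurable E.
  apply: measurableI.
    rewrite -[X in measurable X]setTI; apply: measurable_fun_ler => //.
  rewrite -[X in measurable X]setTI; apply: measurable_fun_ltr => //.
  apply: measurable_funB => //; exact: (measurableT_comp mGp).
transitivity (\int[leb_mx R n m]_x leb (xsection E x)).
  apply: eq_integral => x _.
  rewrite (_ : xsection E x = `[0%R, (1 - powR (G x) p)%R[%classic).
    rewrite lebesgue_measure_itv/= lte_fin /tent.
    by case: ltP => // _; rewrite -EFinB subr0.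
  by apply/seteqP; split => t; rewrite /xsection /= inE /E /= in_itv/= => h; apply/andP.
rewrite fubini_section// /layer_const.
have V0 : 0 <= leb_mx R n m [set x | G x < 1]%R by [].
rewrite -ge0_integralZr//; last 2 first.
- exact: measurable_funTS (measurable_layer _).
- by move=> t _; rewrite lee_fin exprn_ge0// powR_ge0.
rewrite [RHS]integral_mkcond; apply: eq_integral => t _; rewrite patchE.
have mG1 : measurable [set x | G x < 1]%R.
  by rewrite -[X in measurable X]setTI; apply: measurable_fun_ltr.
case: ifPn; rewrite ?inE ?notin_setE /= in_itv/= => ht; last first.
  rewrite (_ : ysection E t = set0) ?measure0//; rewrite -subset0 => x.
  rewrite /ysection/= inE /E /= => -[t0 t1]; apply: ht; rewrite t0/=.
  by apply: (lt_le_trans t1); rewrite gerBl powR_ge0.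
have /andP[t0 t1] := ht.
pose s := powR (1 - t) p^-1.
have s0 : (0 < s)%R by rewrite /s powR_gt0// subr_gt0.
have sE : (powR s p = 1 - t)%R.
  by rewrite /s -powRrM mulVf ?gt_eqF// powRr1// subr_ge0 ltW.
have -> : ysection E t = (fun x => s^-1 *: x)%R @^-1` [set x | G x < 1]%R.
  apply/seteqP; split => x; rewrite /ysection/= inE /E /= GZ ?invr_gt0// mulrC ltr_pdivrMr// mul1r.
    move=> [_]; rewrite ltrBrDr addrC -ltrBrDr -sE => h; rewrite ltNge; apply/negP => sG.
    move: h; rewrite ltNge => /negP; apply; apply: ge0_ler_powR => //; rewrite ?nnegrE//; exact: ltW.
  move=> Gs; split => //; rewrite ltrBrDr addrC -ltrBrDr -sE.
  by apply: gt0_ltr_powR => //; rewrite nnegrE// ltW.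
by rewrite leb_mx_scale ?invr_gt0// exprVn invrK.
Qed.

End layer_cake.

Section orthogonal.
Context (R : realType).

Definition orthogonal_mx n (U : 'M[R]_n) := U *m U^T == 1%:M.

Lemma orthogonal_mxT n (U : 'M[R]_n) : orthogonal_mx U -> orthogonal_mx U^T.
Proof. by rewrite /orthogonal_mx trmxK => /eqP/mulmx1C ->. Qed.

Lemma mulmx_trK n m (U : 'M[R]_n) : orthogonal_mx U ->
  cancel (mulmx U^T : 'M[R]_(n, m) -> _) (mulmx U).
Proof. by move=> /eqP UU x; rewrite mulmxA UU mul1mx. Qed.

Lemma mulmx_orthK n m (U : 'M[R]_n) : orthogonal_mx U ->
  cancel (mulmx U : 'M[R]_(n, m) -> _) (mulmx U^T).
Proof. by move=> /eqP/mulmx1C UU x; rewrite mulmxA UU mul1mx. Qed.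

Lemma mxnorm2_mulmx n m (U : 'M[R]_n) (x : 'M[R]_(n, m)) : orthogonal_mx U ->
  mxnorm2 (U *m x) = mxnorm2 x.
Proof.
by move=> oU; rewrite /mxnorm2 /mxdot trmx_mul -mulmxA mulmx_orthK.
Qed.

Lemma mxnorm2_tr n m (x : 'M[R]_(n, m)) : mxnorm2 x^T = mxnorm2 x.
Proof. by rewrite /mxnorm2 /mxdot trmxK mxtrace_mulC. Qed.

Lemma leb_mx_mulmx n m (U : 'M[R]_n) (A : set 'M[R]_(n, m)) : orthogonal_mx U ->
  measurable A -> leb_mx R n m (mulmx U @^-1` A) = leb_mx R n m A.
Proof.
move=> oU mA; apply: (@leb_mx_isometry _ _ _ _ (mulmx U^T)) => //.
- exact: measurable_mulmxl.
- exact: measurable_mulmxl.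
- exact: mulmx_orthK.
- exact: mulmx_trK.
- by move=> x y; rewrite mulmxDr.
- by move=> x; exact: mxnorm2_mulmx.
Qed.

Lemma leb_mx_mulmxr n m (U : 'M[R]_m) (A : set 'M[R]_(n, m)) : orthogonal_mx U ->
  measurable A -> leb_mx R n m (mulmxr U @^-1` A) = leb_mx R n m A.
Proof.
move=> oU mA; apply: (@leb_mx_isometry _ _ _ _ (mulmxr U^T)) => //.
- exact: measurable_mulmxr.
- exact: measurable_mulmxr.
- by move=> x /=; rewrite -mulmxA (eqP oU) mulmx1.
- by move=> x /=; rewrite -mulmxA (mulmx1C (eqP oU)) mulmx1.
- by move=> x y; rewrite /= mulmxDl.
- move=> x /=; rewrite -mxnorm2_tr trmx_mul mxnorm2_mulmx ?mxnorm2_tr//.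
  exact: orthogonal_mxT.
Qed.

Local Open Scope ereal_scope.

Lemma integral_leb_mx_mulmx n m (U : 'M[R]_n) (F : 'M[R]_(n, m) -> \bar R) :
  orthogonal_mx U -> measurable_fun setT F -> (forall x, 0 <= F x) ->
  \int[leb_mx R n m]_x F (U *m x) = \int[leb_mx R n m]_x F x.
Proof.
move=> oU mF F0.
have := @ge0_integral_pushforward _ _ _ _ _ _ (@measurable_mulmxl R n m n U)
  (leb_mx R n m) setT F measurableT mF (fun x _ => F0 x).
rewrite preimage_setT => <-; apply: eq_measure_integral => [|? A mA _].
  exact: measurable_mulmxl.
exact: leb_mx_mulmx.
Qed.

Lemma cone_mulmx n m (U : 'M[R]_n) (A : set 'M[R]_(n, m)) : orthogonal_mx U ->
  cone (mulmx U @^-1` A) = mulmx U @^-1` cone A.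
Proof.
move=> oU; apply/seteqP; split => x;
by rewrite /cone /preimage /mkset mxnorm2_mulmx// /dir -scalemxAr mxnorm2_mulmx.
Qed.

Lemma integral_sphere_mulmx n m (U : 'M[R]_n) (F : 'M[R]_(n, m) -> \bar R) :
  orthogonal_mx U -> measurable_fun setT F -> (forall x, 0 <= F x) ->
  \int[sphere_measure R n m]_(x in @mxsphere R n m) F (U *m x) =
  \int[sphere_measure R n m]_(x in @mxsphere R n m) F x.
Proof.
move=> oU mF F0; have mS := @measurable_mxsphere R n m.
have := @ge0_integral_pushforward _ _ _ _ _ _ (@measurable_mulmxl R n m n U)
  (sphere_measure R n m) _ F mS (measurable_funTS mF) (fun x _ => F0 x).
rewrite (_ : _ @^-1` _ = @mxsphere R n m); last first.
  by apply/seteqP; split => x; rewrite /mxsphere /preimage /mkset mxnorm2_mulmx.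
move=> <-; apply: eq_measure_integral => [|? A mA _]; first exact: measurable_mulmxl.
transitivity (sphere_measure R n m (mulmx U @^-1` A)) => //.
rewrite sphere_measureE /cone_measure cone_mulmx// leb_mx_mulmx; last 2 first.
- by [].
- exact: measurable_cone.
by rewrite [RHS]sphere_measureE.
Qed.

Section jensen.
Context d (T : measurableType d) (P : {sigma_finite_measure set T -> \bar R}).
Context (n m : nat) (Phi : T -> 'M[R]_n).
Hypothesis (P1 : P setT = 1) (mPhi : measurable_fun setT Phi).
Hypothesis oPhi : forall t, orthogonal_mx (Phi t).

Lemma measurable_mulmx2 d' (S : measurableType d') k l r (f : S -> 'M[R]_(k, l))
    (g : S -> 'M[R]_(l, r)) : measurable_fun setT f -> measurable_fun setT g ->
  measurable_fun setT (fun s => f s *m g s)%R.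
Proof.
move=> mf mg; apply: measurable_fun_mx => i j; under eq_fun do rewrite mxE.
apply: measurable_sum => q; apply: measurable_funM.
  exact: (measurableT_comp (measurable_coord i q) mf).
exact: (measurableT_comp (measurable_coord q j) mg).
Qed.

(** Jensen by hand: 1 <= tent (h) + h pointwise integrates to 1 - s <= \int tent (h), and the
    right-hand side is also nonnegative. *)
Lemma tent_le_integral (h : T -> R) (s : R) : measurable_fun setT h -> (forall t, 0 <= h t)%R ->
  \int[P]_t (h t)%:E = s%:E -> (tent s)%:E <= \int[P]_t (tent (h t))%:E.
Proof.
move=> mh h0 hs.
have mth : measurable_fun setT (fun t => (tent (h t))%:E).
  by apply/measurable_EFinP; apply: measurable_maxr => //; exact: measurable_funB.
have th0 t : 0 <= (tent (h t))%:E by rewrite lee_fin le_max lexx orbT.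
rewrite /tent EFin_max ge_max integral_ge0 ?andbT//; last by move=> t _; exact: th0.
have : \int[P]_t 1%:E <= \int[P]_t ((tent (h t))%:E + (h t)%:E).
  apply: ge0_le_integral => //.
  - by apply: emeasurable_funD => //; exact/measurable_EFinP.
  - move=> t _; rewrite -EFinD lee_fin -lerBlDr /tent le_max lexx//.
rewrite integral_cst//= mul1e P1 ge0_integralD//; last 2 first.
- by move=> t _; rewrite lee_fin.
- exact/measurable_EFinP.
by rewrite hs -leeBlDr.
Qed.

(* Jensen's inequality for the convex function [tent], integrated over the
   space; the two tent integrals are multiples of the two volumes. *)
Lemma volume_rotation_mean (G g : 'M[R]_(n, m) -> R) (p : R) : (0 < p)%R ->
  measurable_fun setT G -> measurable_fun setT g ->
  (forall x, 0 <= G x)%R -> (forall x, 0 <= g x)%R ->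
  (forall r x, 0 < r -> G (r *: x) = r * G x)%R ->
  (forall r x, 0 < r -> g (r *: x) = r * g x)%R ->
  (forall x, \int[P]_t (powR (G (Phi t *m x)) p)%:E = (powR (g x) p)%:E) ->
  leb_mx R n m [set x | g x < 1]%R <= leb_mx R n m [set x | G x < 1]%R.
Proof.
move=> p0 mG mg G0 g0 GZ gZ gG.
have c0 := layer_const_gt0 n m p0; have cy := layer_const_lty n m p0.
rewrite -(lee_pmul2l _ c0) ?ge0_fin_numE ?(ltW c0)//.
rewrite -!layer_cake//.
have mGP : measurable_fun setT (fun z : 'M[R]_(n, m) * T => powR (G (Phi z.2 *m z.1)) p).
  apply: (measurableT_comp (@measurable_powR R p)).
  apply: (measurableT_comp mG); apply: measurable_mulmx2 => //.
  exact: (measurableT_comp mPhi).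
have mtG : measurable_fun setT (fun x => (tent (powR (G x) p))%:E).
  apply/measurable_EFinP; apply: measurable_maxr => //; apply: measurable_funB => //.
  exact: (measurableT_comp (@measurable_powR R p) mG).
have mtGP : measurable_fun setT (fun z : 'M[R]_(n, m) * T =>
   (tent (powR (G (Phi z.2 *m z.1)) p))%:E).
  apply/measurable_EFinP; apply: measurable_maxr => //; exact: measurable_funB.
have t0 s : 0 <= (tent s)%:E by rewrite lee_fin le_max lexx orbT.
apply: (@le_trans _ _ (\int[leb_mx R n m]_x \int[P]_t (tent (powR (G (Phi t *m x)) p))%:E)).
  apply: ge0_le_integral => //.
  - apply/measurable_EFinP; apply: measurable_maxr => //; apply: measurable_funB => //.
    exact: (measurableT_comp (@measurable_powR R p) mg).
  - exact: (measurable_fun_fubini_tonelli_F _ mtGP).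
  move=> x _; apply: tent_le_integral => //; last by move=> t; exact: powR_ge0.
  exact: (measurableT_comp mGP (pair1_measurable x)).
rewrite (fubini_tonelli (fun z : 'M[R]_(n, m) * T =>
   (tent (powR (G (Phi z.2 *m z.1)) p))%:E))//=.
have inv t : \int[leb_mx R n m]_x (tent (powR (G (Phi t *m x)) p))%:E =
    \int[leb_mx R n m]_x (tent (powR (G x) p))%:E.
  by apply: (integral_leb_mx_mulmx (F := fun x => (tent (powR (G x) p))%:E)).
under eq_integral do rewrite inv.
by rewrite integral_cst//= P1 mule1.
Qed.

End jensen.
End orthogonal.

Section gram_schmidt.
Context (R : realType) (n : nat).
Implicit Types (x : nat -> 'rV[R]_n.+1) (X : 'M[R]_n.+1).

(** If a vector depends on the previous ones, its residual is 0 and [dir 0 = 0] is appended: the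
    process is total, but its output is then not orthonormal. *)
Fixpoint gram_schmidt x k : seq 'rV[R]_n.+1 :=
  if k is k'.+1 then
    rcons (gram_schmidt x k')
      (dir (x k' - \sum_(q <- gram_schmidt x k') mxdot (x k') q *: q))
  else [::].

Lemma size_gram_schmidt x k : size (gram_schmidt x k) = k.
Proof. by elim: k => //= k IH; rewrite size_rcons IH. Qed.

Lemma mxdot_mulmxr (U : 'M[R]_n.+1) (v w : 'rV[R]_n.+1) : orthogonal_mx U ->
  mxdot (v *m U) (w *m U) = mxdot v w.
Proof.
move=> /eqP UU; rewrite /mxdot trmx_mul -mulmxA mxtrace_mulC -!mulmxA.
by rewrite UU mulmx1.
Qed.

Lemma dir_mulmxr (U : 'M[R]_n.+1) (v : 'rV[R]_n.+1) : orthogonal_mx U ->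
  dir (v *m U) = dir v *m U.
Proof.
by move=> oU; rewrite /dir /mxnorm2 mxdot_mulmxr// scalemxAl.
Qed.

Lemma gram_schmidt_mulmxr (U : 'M[R]_n.+1) x k : orthogonal_mx U ->
  gram_schmidt (fun i => x i *m U) k = [seq q *m U | q <- gram_schmidt x k].
Proof.
move=> oU; elim: k => //= k ->; rewrite map_rcons -dir_mulmxr//; congr (rcons _ (dir _)).
rewrite mulmxBl big_map mulmx_suml; congr (_ - _); apply: eq_bigr => q _.
by rewrite mxdot_mulmxr// scalemxAl.
Qed.

Definition row_nat X k : 'rV[R]_n.+1 := row (inord k) X.

Definition gs_mx X : 'M[R]_n.+1 :=
  \matrix_(i, j) nth 0 (gram_schmidt (row_nat X) n.+1) i 0 j.

(** This equivariance turns the invariance of Lebesgue measure under right multiplication into the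
    rotation invariance of the law of the frame. *)
Lemma gs_mx_mulmxr (U : 'M[R]_n.+1) X : orthogonal_mx U -> gs_mx (X *m U) = gs_mx X *m U.
Proof.
move=> oU; apply/matrixP => i j; rewrite mxE.
have -> : row_nat (X *m U) = fun k => row_nat X k *m U.
  by apply/funext => k; rewrite /row_nat row_mul.
rewrite gram_schmidt_mulmxr// (nth_map 0) ?size_gram_schmidt// !mxE.
by apply: eq_bigr => l _; rewrite !mxE.
Qed.

Lemma measurable_mxdot2 d (T : measurableType d) k l (f g : T -> 'M[R]_(k, l)) :
  measurable_fun setT f -> measurable_fun setT g ->
  measurable_fun setT (fun t => mxdot (f t) (g t)).
Proof.
move=> mf mg; under eq_fun do rewrite mxdotE.
apply: measurable_sum => i; apply: measurable_sum => j; apply: measurable_funM.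
  exact: (measurableT_comp (measurable_coord i j) mf).
exact: (measurableT_comp (measurable_coord i j) mg).
Qed.

Lemma measurable_gram_schmidt k i : measurable_fun setT
  (fun X => nth 0 (gram_schmidt (row_nat X) k) i).
Proof.
elim: k i => [|k IH] i /=; first by under eq_fun do rewrite nth_nil; exact: measurable_cst.
have mrow : measurable_fun setT (fun X => row_nat X k).
  by apply: measurable_fun_mx => i' j; under eq_fun do rewrite mxE; exact: measurable_coord.
under eq_fun do rewrite nth_rcons size_gram_schmidt.
case: ltnP => _; first exact: IH.
case: (i =P k) => _; last exact: measurable_cst.
have my : measurable_fun setT (fun X => row_nat X k -
    \sum_(q <- gram_schmidt (row_nat X) k) mxdot (row_nat X k) q *: q).
  apply: measurable_fun_mx => i' j; under eq_fun do rewrite !mxE summxE.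
  apply: measurable_funB; first exact: measurable_coord.
  under eq_fun do rewrite (big_nth 0) size_gram_schmidt.
  apply: measurable_sum => l; under eq_fun do rewrite mxE.
  apply: measurable_funM; first exact: measurable_mxdot2.
  exact: (measurableT_comp (measurable_coord i' j)).
exact: (measurableT_comp (@measurable_dir R 1 n.+1) my).
Qed.

Lemma measurable_gs_mx : measurable_fun setT gs_mx.
Proof.
apply: measurable_fun_mx => i j; under eq_fun do rewrite mxE.
exact: (measurableT_comp (measurable_coord 0 j) (measurable_gram_schmidt _ _)).
Qed.

Section unit.
Context (X : 'M[R]_n.+1).
Hypothesis uX : X \in unitmx.

(** The span of the first k rows of X. Keeping the coefficients as a row vector lets the inverse of
    X recover them. *)
Let spanned k (v : 'rV[R]_n.+1) := exists2 c : 'rV[R]_n.+1,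
  (forall i : 'I_n.+1, (k <= i)%N -> c 0 i = 0) & v = c *m X.

Let spannedW k l v : (k <= l)%N -> spanned k v -> spanned l v.
Proof. by move=> kl [c c0 ->]; exists c => // i li; apply: c0; exact: leq_trans li. Qed.

Let spannedD k v w a : spanned k v -> spanned k w -> spanned k (v + a *: w).
Proof.
move=> [c c0 ->] [e e0 ->]; exists (c + a *: e); last by rewrite mulmxDl -scalemxAl.
by move=> i ki; rewrite !mxE c0// e0// mulr0 addr0.
Qed.

Let spanned_row k : (k < n.+1)%N -> spanned k.+1 (row_nat X k).
Proof.
move=> kn; exists (delta_mx 0 (inord k)); last by rewrite /row_nat rowE.
move=> i ki; rewrite mxE eqxx /=; case: (i =P inord k) => // ik; move: ki.
by rewrite ik inordK// ltnn.
Qed.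

Let spanned_proj k (s : seq 'rV[R]_n.+1) v :
  (forall q, q \in s -> spanned k q) ->
  spanned k (\sum_(q <- s) mxdot v q *: q).
Proof.
elim: s => [_|q s IH ss].
  by rewrite big_nil; exists 0; rewrite ?mul0mx// => i _; rewrite mxE.
rewrite big_cons addrC; apply: spannedD; last by apply: ss; rewrite inE eqxx.
by apply: IH => q' q's; apply: ss; rewrite inE q's orbT.
Qed.

Let spanned_gs k : (k <= n.+1)%N -> forall q, q \in gram_schmidt (row_nat X) k -> spanned k q.
Proof.
elim: k => // k IH kn q /=; rewrite mem_rcons inE => /orP[/eqP ->|qs]; last first.
  by apply: spannedW (IH (ltnW kn) _ qs).
set y := _ - _; have sy : spanned k.+1 y.
  rewrite /y -scaleN1r; apply: spannedD; first exact: spanned_row.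
  by apply: spanned_proj => q' q's; apply: spannedW (IH (ltnW kn) _ q's).
rewrite /dir -[_ *: _]add0r; apply: spannedD => //.
by exists 0; rewrite ?mul0mx// => i _; rewrite mxE.
Qed.

(** A zero residual would express row k through the earlier rows; multiplying by the inverse of X,
    the coefficient at k would be both 1 and 0. *)
Let residual_neq0 k : (k < n.+1)%N ->
  row_nat X k - \sum_(q <- gram_schmidt (row_nat X) k) mxdot (row_nat X k) q *: q != 0.
Proof.
move=> kn; apply/eqP => /eqP; rewrite subr_eq0 => /eqP rowE'.
have [c c0] := spanned_proj (row_nat X k) (spanned_gs (ltnW kn)).
rewrite -rowE' /row_nat rowE => /(congr1 (mulmx^~ (invmx X))).
rewrite !mulmxK// => /rowP/(_ (inord k)).
by rewrite mxE !eqxx c0 ?inordK// => /eqP; rewrite oner_eq0.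
Qed.

Lemma gram_schmidt_orthonormal k : (k <= n.+1)%N -> forall i j, (i < k)%N -> (j < k)%N ->
  mxdot (nth 0 (gram_schmidt (row_nat X) k) i) (nth 0 (gram_schmidt (row_nat X) k) j) =
  (i == j)%:R.
Proof.
elim: k => // k IH kn; have {}IH := IH (ltnW kn).
set s := gram_schmidt (row_nat X) k in IH *.
have res := residual_neq0 kn.
move=> /=; rewrite -/s; set y := _ - _.
have sk : size s = k by exact: size_gram_schmidt.
have yq j : (j < k)%N -> mxdot (dir y) (nth 0 s j) = 0.
  move=> jk; rewrite /dir mxdotZl.
  suff -> : mxdot y (nth 0 s j) = 0 by rewrite mulr0.
  apply/eqP; rewrite /y mxdotDl mxdotNl subr_eq0 eq_sym; apply/eqP.
  rewrite (big_nth 0) sk big_mkord (bigD1 (Ordinal jk))//= mxdotDl mxdotZl IH// eqxx mulr1.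
  have -> : mxdot (\sum_(i < k | i != Ordinal jk) mxdot (row_nat X k) s`_i *: s`_i) s`_j = 0.
    elim/big_rec : _ => [|i v ij vj]; first by rewrite mxdot0l.
    rewrite mxdotDl vj mxdotZl IH// addr0.
    have /negPf -> : (i : nat) != j by apply: contra ij => /eqP ij; apply/eqP/val_inj.
    by rewrite mulr0.
  by rewrite addr0.
move=> i j; rewrite !ltnS !nth_rcons sk leq_eqVlt => /orP[/eqP ->|ik].
  rewrite ltnn eqxx leq_eqVlt => /orP[/eqP ->|jk].
    by rewrite ltnn eqxx -mxnorm2_sqr mxnorm2_dir// expr1n.
  by rewrite jk yq//; case: eqP => // kj; rewrite kj ltnn in jk.
rewrite ik leq_eqVlt => /orP[/eqP ->|jk]; last by rewrite jk IH.
rewrite ltnn eqxx mxdotC yq//; case: eqP => // kj; by rewrite kj ltnn in ik.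
Qed.

Lemma orthogonal_gs_mx : orthogonal_mx (gs_mx X).
Proof.
apply/eqP/matrixP => i j; rewrite !mxE.
have := gram_schmidt_orthonormal (leqnn n.+1) (ltn_ord i) (ltn_ord j).
rewrite mxdotE big_ord1 => <-.
by apply: eq_bigr => l _; rewrite !mxE.
Qed.

End unit.
End gram_schmidt.

Section rotation_average.
Context (R : realType) (n' : nat).
Let n := n'.+1.
Local Open Scope ereal_scope.

Lemma continuous_det : continuous (fun X : 'M[R]_n => \det X).
Proof.
rewrite /determinant; apply: continuous_big => [|s _]; first exact: add_continuous.
have cprod : continuous (fun X : 'M[R]_n => \prod_i X i (s i))%R.
  apply: continuous_big => [|i _]; first exact: mul_continuous.
  exact: coord_continuous.
move=> X; apply: (@continuousM R 'M[R]_n (fun=> (-1) ^+ s)%R (fun X => \prod_i X i (s i))%R X).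
  exact: cst_continuous.
exact: cprod.
Qed.

(** Larger than the norm of the identity, so that a neighbourhood of the identity lies in
    [frame_set], which therefore has positive measure. *)
Let radius : R := (mxnorm2 (1%:M : 'M[R]_n) + 1)%R.

(* [frame] orthonormalizes the rows of a random matrix; normalized Lebesgue
   measure on a bounded set of invertible matrices replaces Haar measure. *)
Definition frame_set : set 'M[R]_n :=
  [set X | orthogonal_mx (gs_mx X)] `&` [set X | mxnorm2 X <= radius]%R.

Lemma measurable_frame_set : measurable frame_set.
Proof.
apply: measurableI; last exact: measurable_mxball.
rewrite (_ : mkset _ = (fun X => gs_mx X *m (gs_mx X)^T) @^-1` [set 1%:M%R]).
  apply: measurable_preimage (measurable_set1_mx _).
  apply: measurable_mulmx2; first exact: measurable_gs_mx.
  apply: measurable_fun_mx => i j; under eq_fun do rewrite mxE.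
  exact: (measurableT_comp (measurable_coord j i) (@measurable_gs_mx R n')).
by apply/seteqP; split => X; rewrite /orthogonal_mx /= => /eqP.
Qed.

Lemma leb_mx_frame_set : 0 < leb_mx R n n frame_set < +oo.
Proof.
apply/andP; split; last first.
  apply: le_lt_trans (leb_mx_ball_lty n n radius).
  apply: le_measure; rewrite ?inE; [exact: measurable_frame_set|exact: measurable_mxball|].
  exact: subIsetr.
pose U := (fun X : 'M[R]_n => \det X) @^-1` [set r | r != 0]%R `&`
  @mxnorm2 R n n @^-1` [set r | r < radius]%R.
have oU : open U.
  apply: openI; apply: open_comp.
  - by move=> X _; exact: continuous_det.
  - exact: open_neq.
  - by move=> X _; exact: continuous_mxnorm2.
  - exact: open_lt.
have U0 : U !=set0.
  exists 1%:M%R; split; first by rewrite /preimage /mkset det1 oner_neq0.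
  by rewrite /preimage /mkset /radius ltrDl.
apply: (lt_le_trans (leb_mx_open_gt0 oU U0)).
apply: le_measure; rewrite ?inE; [exact: open_measurable_mx|exact: measurable_frame_set|].
move=> X [dX nX]; split; last exact: ltW.
by apply: orthogonal_gs_mx; rewrite unitmxE unitfE.
Qed.

Lemma frame_set_mulmxr (U : 'M[R]_n) : orthogonal_mx U ->
  mulmxr U @^-1` frame_set = frame_set.
Proof.
move=> oU; have nU X : mxnorm2 (X *m U) = mxnorm2 X.
  by rewrite -mxnorm2_tr trmx_mul mxnorm2_mulmx ?mxnorm2_tr//; exact: orthogonal_mxT.
apply/seteqP; split => X; rewrite /frame_set /preimage /mkset /= nU gs_mx_mulmxr// => -[oX nX];
  split => //; move: oX; rewrite /orthogonal_mx /mkset trmx_mul -mulmxA (mulmxA U) (eqP oU) mul1mx//.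
Qed.

(** The identity is a default value that makes [frame X] orthogonal for every X; it is taken only
    off [frame_set], where [frame_measure] vanishes. *)
Definition frame (X : 'M[R]_n) : 'M[R]_n :=
  if orthogonal_mx (gs_mx X) then gs_mx X else 1%:M%R.

Lemma orthogonal_frame X : orthogonal_mx (frame X).
Proof.
by rewrite /frame; case: ifPn => //; rewrite /orthogonal_mx trmx1 mulmx1.
Qed.

Lemma measurable_frame : measurable_fun setT frame.
Proof.
have h : measurable [set X : 'M[R]_n | orthogonal_mx (gs_mx X)].
  rewrite (_ : mkset _ = (fun X => gs_mx X *m (gs_mx X)^T) @^-1` [set 1%:M%R]).
    apply: measurable_preimage (measurable_set1_mx _).
    apply: measurable_mulmx2; first exact: measurable_gs_mx.
    apply: measurable_fun_mx => i j; under eq_fun do rewrite mxE.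
    exact: (measurableT_comp (measurable_coord j i) (@measurable_gs_mx R n')).
  by apply/seteqP; split => X; rewrite /orthogonal_mx /= => /eqP.
apply: measurable_fun_ifT; [|exact: measurable_gs_mx|exact: measurable_cst].
by apply: (@measurable_fun_bool _ _ _ _ true); rewrite setTI.
Qed.

Lemma frame_measure_ex : {P : {sigma_finite_measure set 'M[R]_n -> \bar R} |
  forall A, P A = (fine (leb_mx R n n frame_set))^-1%:E * leb_mx R n n (A `&` frame_set)}.
Proof.
have /andP[k0 ky] := leb_mx_frame_set.
have c0 : (0 <= (fine (leb_mx R n n frame_set))^-1)%R by rewrite invr_ge0 fine_ge0// ltW.
pose P : {measure set 'M[R]_n -> \bar R} :=
  mscale (NngNum c0) (mrestr (leb_mx R n n) measurable_frame_set).
have sf : sigma_finite setT P.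
  exists (fun=> setT) => [|i]; first by rewrite bigcup_const.
  split => //; rewrite /P /= /mscale /= /mrestr setTI lte_mul_pinfty ?lee_fin//.
by exists (sigma_finite_pack sf).
Qed.

Definition frame_measure := sval frame_measure_ex.

Lemma frame_measureE A : frame_measure A =
  (fine (leb_mx R n n frame_set))^-1%:E * leb_mx R n n (A `&` frame_set).
Proof. by rewrite /frame_measure; case: frame_measure_ex => P /= ->. Qed.

Lemma frame_measureT : frame_measure setT = 1.
Proof.
have /andP[k0 ky] := leb_mx_frame_set.
rewrite frame_measureE setTI -[X in _ * X]fineK ?ge0_fin_numE ?ltW//.
by rewrite -EFinM mulVf// gt_eqF// fine_gt0// k0.
Qed.

(** On [frame_set] one has frame X *m U = frame (X *m U), and X |-> X *m U preserves the frame
    measure. *)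
Lemma integral_frame_mulmxr (U : 'M[R]_n) m (F : 'M[R]_(n, m) -> \bar R) (w : 'M[R]_(n, m)) :
  orthogonal_mx U -> measurable_fun setT F -> (forall x, 0 <= F x) ->
  \int[frame_measure]_X F (frame X *m (U *m w)) = \int[frame_measure]_X F (frame X *m w).
Proof.
move=> oU mF F0.
have mFw v : measurable_fun setT (fun X => F (frame X *m v)).
  apply: (measurableT_comp mF); apply: measurable_mulmx2; first exact: measurable_frame.
  exact: measurable_cst.
transitivity (\int[frame_measure]_X F (frame (X *m U) *m w)).
  (* Equality holds only almost everywhere: the default value of [frame] is not equivariant. *)
  apply: ge0_ae_eq_integral => //.
  - exact: (measurableT_comp (mFw w) (@measurable_mulmxr R n n n U)).
  exists (~` frame_set); split.
  - exact: (measurableC measurable_frame_set).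
  - by apply: (etrans (frame_measureE _)); rewrite setICl measure0 mule0.
  move=> X /= h oX; apply: h => _; have oXU : frame_set (X *m U).
    by have := frame_set_mulmxr oU; move/seteqP => [_ /(_ _ oX)].
  by rewrite /frame (proj1 oX) (proj1 oXU) gs_mx_mulmxr// mulmxA.
have := @ge0_integral_pushforward _ _ _ _ _ _ (@measurable_mulmxr R n n n U)
  frame_measure setT _ measurableT (mFw w) (fun x _ => F0 _).
rewrite preimage_setT => <-; apply: eq_measure_integral => [|? A mA _].
  exact: measurable_mulmxr.
transitivity (frame_measure (mulmxr U @^-1` A)) => //.
rewrite frame_measureE [RHS]frame_measureE; congr (_ * _).
rewrite -[X in _ `&` X](frame_set_mulmxr oU) -preimage_setI leb_mx_mulmxr//.
by apply: measurableI => //; exact: measurable_frame_set.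
Qed.

Definition reflection_mx (w : 'cV[R]_n) : 'M[R]_n :=
  (1%:M - (2 / mxdot w w) *: (w *m w^T))%R.

Lemma reflection_mxE w x : (reflection_mx w *m x = reflection w x)%R.
Proof.
rewrite /reflection_mx /reflection mulmxBl mul1mx -scalemxAl -mulmxA.
have -> : w^T *m x = (mxdot x w)%:M by rewrite mxdotC /mxdot [LHS]mx11_scalar trace_mx11.
by rewrite mul_mx_scalar scalerA mulrAC.
Qed.

Lemma orthogonal_reflection_mx w : orthogonal_mx (reflection_mx w).
Proof.
have -> : orthogonal_mx (reflection_mx w) = (reflection_mx w *m reflection_mx w == 1%:M).
  rewrite /orthogonal_mx; congr (_ *m _ == _).
  by rewrite /reflection_mx linearB linearZ/= trmx_mul trmxK trmx1.
apply/eqP/matrixP => i j.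
have h (x : 'cV[R]_n) : (reflection_mx w *m reflection_mx w *m x = x)%R.
  by rewrite -mulmxA !reflection_mxE reflectionK.
have := h (delta_mx j 0%R) => /matrixP/(_ i 0%R).
by rewrite -colE !mxE eqxx andbT => ->.
Qed.

(** By reflecting w to v, the average over frames is the same for all unit vectors, so it may be
    integrated over the sphere. After exchanging the integrals, invariance of the sphere measure
    removes the rotation. *)
Lemma rotation_average (F : 'cV[R]_n -> \bar R) (w : 'cV[R]_n) : measurable_fun setT F ->
  (forall x, 0 <= F x) -> mxnorm2 w = 1%R ->
  \int[frame_measure]_X F (frame X *m w) * sphere_measure R n 1 (@mxsphere R n 1) =
  \int[sphere_measure R n 1]_(v in @mxsphere R n 1) F v.
Proof.
move=> mF F0 w1; have mS := @measurable_mxsphere R n 1.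
have mFF : measurable_fun setT (fun z : 'cV[R]_n * 'M[R]_n =>
    F (frame z.2 *m z.1) * (\1_(@mxsphere R n 1) z.1)%:E).
  apply: emeasurable_funM.
    apply: (measurableT_comp mF); apply: measurable_mulmx2 => //.
    exact: (measurableT_comp measurable_frame).
  apply/measurable_EFinP; apply: (measurableT_comp _ measurable_fst).
  exact: measurable_indic.
have mFX X : measurable_fun setT (fun v => F (frame X *m v)).
  exact: (measurableT_comp mF (measurable_mulmxl _)).
transitivity (\int[sphere_measure R n 1]_(v in @mxsphere R n 1)
    \int[frame_measure]_X F (frame X *m v)).
  rewrite [RHS](eq_integral (cst (\int[frame_measure]_X F (frame X *m w)))).

    have I0 : 0 <= \int[frame_measure]_X F (frame X *m w) by exact: integral_ge0.
    by rewrite [RHS]integral_cst.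
  move=> v /set_mem v1 /=; rewrite -(@integral_frame_mulmxr (reflection_mx (w - v)) 1 F w)//.
    by apply: eq_integral => X _; rewrite reflection_mxE reflection_swap ?w1.
  exact: orthogonal_reflection_mx.
have patchF (h : 'cV[R]_n -> \bar R) :
    \int[sphere_measure R n 1]_(v in @mxsphere R n 1) h v =
    \int[sphere_measure R n 1]_v (h v * (\1_(@mxsphere R n 1) v)%:E).
  by rewrite integral_mkcond; apply: eq_integral => v _; rewrite epatch_indic.
rewrite patchF.
have Zr v : (\int[frame_measure]_X F (frame X *m v)) * ((\1_(@mxsphere R n 1) : _ -> R) v)%:E =
    \int[frame_measure]_X (F (frame X *m v) * ((\1_(@mxsphere R n 1) : _ -> R) v)%:E).
  rewrite ge0_integralZr//.
  apply: (measurableT_comp mF); apply: measurable_mulmx2; first exact: measurable_frame.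
  exact: measurable_cst.
under eq_integral do rewrite Zr.
rewrite (fubini_tonelli (fun z : 'cV[R]_n * 'M[R]_n =>
    F (frame z.2 *m z.1) * (\1_(@mxsphere R n 1) z.1)%:E))//=; last first.
  by move=> z; rewrite mule_ge0// lee_fin.
under eq_integral => X _ do rewrite -patchF (integral_sphere_mulmx (orthogonal_frame X) mF F0).
rewrite [LHS](@integral_cst _ _ _ frame_measure setT measurableT).
by rewrite [X in _ * X](frame_measureT) mule1.
Qed.

End rotation_average.

(** * Support functions and polarity *)

Section support_function.
Context (R : realType) (m : nat) (Q : set 'rV[R]_m).
Hypothesis HQ : convex_body_o Q.
Local Notation s := (support_fun Q).

Lemma convex_body_bounded : exists2 C : R, 0 < C & forall q, Q q -> mxnorm2 q <= C.
Proof.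
have [cQ _ _ _] := HQ.
have cimg : compact ((@mxnorm2 R 1 m) @` Q).
  by apply: continuous_compact => //; apply: continuous_subspaceT; exact: continuous_mxnorm2.
have [M [_ hM]] := compact_bounded cimg.
exists (`|M| + 1); first by rewrite ltr_pwDr.
move=> q Qq; rewrite -(ger0_norm (mxnorm2_ge0 q)); apply: (hM (`|M| + 1)).
  by rewrite (le_lt_trans (ler_norm _))// ltrDl.
by exists q.
Qed.

Lemma support_has_sup y : has_sup [set mxdot y q | q in Q].
Proof.
have [_ _ _ Q0] := HQ; have [C C0 QC] := convex_body_bounded.
split; first by exists (mxdot y 0); exists 0.
exists (mxnorm2 y * C) => _ [q Qq <-].
by apply: (le_trans (mxdot_le _ _)); rewrite ler_wpM2l ?mxnorm2_ge0//; exact: QC.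
Qed.

Lemma support_ub y q : Q q -> mxdot y q <= s y.
Proof.
by move=> Qq; apply: ub_le_sup; [case: (support_has_sup y)|exists q].
Qed.

Lemma support_le y c : (forall q, Q q -> mxdot y q <= c) -> s y <= c.
Proof.
move=> h; apply: ge_sup; first by case: (support_has_sup y).
by move=> _ [q Qq <-]; exact: h.
Qed.

Lemma support_ge0 y : 0 <= s y.
Proof.
have [_ _ _ Q0] := HQ; apply: le_trans (support_ub y Q0).
by rewrite mxdotC mxdot0l.
Qed.

Lemma supportD y z : s (y + z) <= s y + s z.
Proof.
apply: support_le => q Qq; rewrite mxdotDl lerD//; exact: support_ub.
Qed.

Lemma supportZ r y : 0 < r -> s (r *: y) = r * s y.
Proof.
move=> r0; apply/eqP; rewrite eq_le; apply/andP; split.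
  by apply: support_le => q Qq; rewrite mxdotZl ler_wpM2l ?(ltW r0)//; exact: support_ub.
rewrite -ler_pdivlMl//; apply: support_le => q Qq.
by rewrite ler_pdivlMl// -mxdotZl; exact: support_ub.
Qed.

Lemma support_bounded : exists2 C : R, 0 < C & forall y, s y <= C * mxnorm2 y.
Proof.
have [C C0 QC] := convex_body_bounded; exists C => // y.
apply: support_le => q Qq; apply: (le_trans (mxdot_le _ _)).
by rewrite mulrC ler_wpM2r ?mxnorm2_ge0//; exact: QC.
Qed.

(** The origin may lie on the boundary of Q, so s can vanish at some y != 0. An interior point q0
    gives s z >= z . q0 + r |z|, and the first term is nonnegative for z = y or for z = - y. *)
Lemma support_interior : exists2 r : R, 0 < r &
  forall y, r * mxnorm2 y <= s y \/ r * mxnorm2 y <= s (- y).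
Proof.
have [_ _ [q0 iq0] _] := HQ; move: iq0; rewrite /interior -nbhs_ballE => -[e /= e0 eQ].
have e20 : 0 < e / 2 by rewrite divr_gt0.
exists (e / 2) => // y.
have key (z : 'rV[R]_m) : mxdot z q0 + (e / 2) * mxnorm2 z <= s z.
  have [->|z0] := eqVneq z 0; first by rewrite mxdot0l mxnorm20 mulr0 addr0 support_ge0.
  have nz : mxnorm2 z != 0 by rewrite mxnorm2_eq0.
  pose q := q0 + (e / 2) *: dir z.
  have Qq : Q q.
    apply: eQ; split => // i j; rewrite -ball_normE/= /q mxE opprD addrA subrr add0r normrN mxE.
    rewrite normrM gtr0_norm//.
    apply: (@le_lt_trans _ _ (e / 2)); last by rewrite ltr_pdivrMr// ltr_pMr// ltr1n.
    rewrite ler_piMr ?(ltW e20)//; apply: (le_trans (coord_le_mxnorm2 _ _ _)).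
    by rewrite mxnorm2_dir.
  apply: le_trans (support_ub z Qq); rewrite /q mxdotDr mxdotZr lerD2l ler_wpM2l ?(ltW e20)//.
  by rewrite /dir mxdotZr -mxnorm2_sqr expr2 mulrA mulVf// mul1r.
have [h|h] := leP 0 (mxdot y q0); [left|right].
  by apply: le_trans (key y); rewrite lerDr.
by apply: le_trans (key (- y)); rewrite mxnorm2N mxdotNl lerDr oppr_ge0 ltW.
Qed.

End support_function.

Section sublinear.
Context (R : realType) (n m : nat) (h : 'M[R]_(n, m) -> R) (C : R).
Hypothesis hD : forall x y, h (x + y) <= h x + h y.
Hypothesis hC : forall x, h x <= C * mxnorm2 x.

Lemma sublinear_continuous : continuous h.
Proof.
(* A Lipschitz constant that is positive whatever the sign of C, since it is divided by below. *)
have C0 : 0 <= `|C| + 1 by rewrite addr_ge0.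
have lip x y : `|h x - h y| <= (`|C| + 1) * mxnorm2 (x - y).
  have hC' z : h z <= (`|C| + 1) * mxnorm2 z.
    apply: (le_trans (hC z)); rewrite ler_wpM2r ?mxnorm2_ge0//.
    by rewrite (le_trans (ler_norm _))// lerDl.
  rewrite ler_norml lerBlDr lerNl opprB lerBlDr; apply/andP; split.
    rewrite -mxnorm2N opprB; apply: le_trans (lerD (hC' _) (lexx _)).
    by apply: le_trans (hD _ _); rewrite subrK.
  apply: le_trans (lerD (hC' _) (lexx _)).
  by apply: le_trans (hD _ _); rewrite subrK.
move=> x; apply/(@cvgrPdist_lt _ _ _ (nbhs x) (nbhs_filter x)) => e e0.
have : {for 0, continuous (@mxnorm2 R n m)} by exact: continuous_mxnorm2.
have e1 : 0 < e / (`|C| + 1) by rewrite divr_gt0// ltr_pwDr.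
move=> /cvgrPdist_lt/(_ _ e1); rewrite mxnorm20 => near0.
have cB : (fun y : 'M[R]_(n, m) => x - y) @ x --> (0 : 'M[R]_(n, m)).
  rewrite -(subrr x); apply: (@continuousB _ _ _ (fun=> x) id x); first exact: cst_continuous.
  exact: cvg_id.
have := cB _ near0; apply: (@filterS _ _ (@nbhs_filter _ x)) => y /=; rewrite sub0r normrN ger0_norm ?mxnorm2_ge0// => xy.
by apply: (le_lt_trans (lip _ _)); rewrite mulrC -ltr_pdivlMr// ltr_pwDr.
Qed.

End sublinear.

Section separation.
Context (R : realType) (n m : nat).
Implicit Types (K : set 'M[R]_(n, m)) (x y z : 'M[R]_(n, m)).

Lemma continuous_vec_mx : continuous (@vec_mx R n m).
Proof.
move=> x A /nbhs_ballP[e e0 eA]; apply/nbhs_ballP; exists e => // y [_ xy].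
by apply: eA; split => // i j; rewrite !mxE.
Qed.

Lemma bounded_closed_compact_mx K (r : R) : closed K -> (forall x, K x -> mxnorm2 x <= r) ->
  compact K.
Proof.
move=> cK Kr.
rewrite (_ : K = vec_mx @` (vec_mx @^-1` K)); last first.
  apply/seteqP; split => [x Kx|_ [x Kx <-]//].
  by exists (mxvec x); rewrite /preimage /mkset ?mxvecK.
apply: continuous_compact; first by apply: continuous_subspaceT; exact: continuous_vec_mx.
apply: bounded_closed_compact; last first.
  by apply: closed_comp => // x _; exact: continuous_vec_mx.
exists `|r|; split; first by rewrite num_real.
move=> M rM x /Kr; rewrite mxnorm2_vec => xr.
rewrite /Num.norm/= mx_normrE; apply: bigmax_le.
  by rewrite (le_trans _ (ltW rM)).
move=> i _; apply: (le_trans (coord_le_mxnorm2 _ _ _)).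
by rewrite (le_trans xr)// (le_trans (ler_norm _))// ltW.
Qed.

Lemma continuous_mxnorm2B x : continuous (fun z => mxnorm2 (z - x)).
Proof.
move=> z; have cB : {for z, continuous (fun z : 'M[R]_(n, m) => z - x)}.
  by apply: continuousB; [exact: cvg_id|exact: cst_continuous].
exact: (continuous_comp cB (@continuous_mxnorm2 R n m _)).
Qed.

Lemma mxnorm2_lincomb (t : R) x y :
  mxnorm2 (x + t *: y) ^+ 2 = mxnorm2 x ^+ 2 + 2 * t * mxdot x y + t ^+ 2 * mxnorm2 y ^+ 2.
Proof.
rewrite mxnorm2_sqr !(mxdotDl, mxdotDr, mxdotZl, mxdotZr) (mxdotC y x) -!mxnorm2_sqr; ring.
Qed.

(** The normal y0 = x - z0 at the point z0 of K nearest to x separates, after division by a suitable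
    level. *)
Lemma separation K x : closed K -> K 0 ->
  (forall y z t, K y -> K z -> 0 < t < 1 -> K (y + t *: (z - y))) -> ~ K x ->
  exists2 y, (forall z, K z -> mxdot z y <= 1) & 1 < mxdot x y.
Proof.
move=> cK K0 Kconv Kx.
(* Only points at least as close to x as 0 compete for the minimum; this makes the set compact, and
   it contains 0. *)
pose A := K `&` [set z | mxnorm2 (z - x) <= mxnorm2 x].
have cA : compact A.
  apply: (@bounded_closed_compact_mx _ (2 * mxnorm2 x)).
    apply: closedI => //; apply: (@closed_comp _ _ (fun z => mxnorm2 (z - x)) [set r | r <= mxnorm2 x]).
      by move=> z _; exact: continuous_mxnorm2B.
    exact: closed_le.
  move=> z [_ /= zx]; rewrite -(subrK x z); apply: (le_trans (mxnorm2D _ _)); lra.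
have A0 : A !=set0 by exists 0; split => //=; rewrite sub0r mxnorm2N.
have [z0 /set_mem[Kz0 z0x] minz0] := compact_EVT_min A0 cA
  (continuous_subspaceT (@continuous_mxnorm2B x)).
have proj z : K z -> mxnorm2 (z0 - x) <= mxnorm2 (z - x).
  move=> Kz; have [zx|zx] := leP (mxnorm2 (z - x)) (mxnorm2 x).
    by apply: minz0; apply/mem_set.
  exact: le_trans z0x (ltW zx).
(* First-order condition at the nearest point: move from z0 towards z by t, divide the increase of
   the squared distance by t, and let t tend to 0. *)
have obtuse z : K z -> 0 <= mxdot (z0 - x) (z - z0).
  move=> Kz; pose f (t : R) := 2 * mxdot (z0 - x) (z - z0) + t * mxnorm2 (z - z0) ^+ 2.
  suff : 0 <= f 0 by rewrite /f mul0r addr0 pmulr_rge0.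
  apply: ge_of_right_limit => [|t /andP[t0 t1]].
    apply: continuousD; first exact: cst_continuous.
    by apply: continuousM; [exact: cvg_id|exact: cst_continuous].
  have := proj _ (Kconv _ _ _ Kz0 Kz (introT andP (conj t0 t1))).
  rewrite -(@ler_pXn2r _ 2)// ?nnegrE ?mxnorm2_ge0// addrAC mxnorm2_lincomb.
  rewrite -addrA lerDl (_ : _ + _ = t * f t); last by rewrite /f; ring.
  by rewrite pmulr_rge0.
pose y0 := x - z0.
have y0x : z0 - x = - y0 by rewrite /y0 opprB.
have y00 : 0 < mxnorm2 y0 ^+ 2.
  rewrite exprn_gt0// mxnorm2_gt0; apply/eqP => /subr0_eq xz0.
  by apply: Kx; rewrite xz0.
have z0y0 : 0 <= mxdot z0 y0.
  have := obtuse _ K0; rewrite y0x sub0r mxdotNl mxdotNr opprK mxdotC.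
  by [].
have xy0 : mxdot x y0 = mxdot z0 y0 + mxnorm2 y0 ^+ 2.
  by rewrite mxnorm2_sqr -mxdotDl (_ : z0 + y0 = x)// /y0 addrC subrK.
(* A level halfway between z0 . y0, the maximum over K, and x . y0. It is positive because 0 is in
   K. *)
pose g := mxdot z0 y0 + mxnorm2 y0 ^+ 2 / 2.
have g0 : 0 < g by rewrite /g; lra.
exists (g^-1 *: y0) => [z Kz|]; rewrite mxdotZr.
  rewrite ler_pdivrMl// mulr1.
  have := obtuse _ Kz; rewrite y0x mxdotNl mxdotDr mxdotNr !(mxdotC y0) /g; lra.
by rewrite ltr_pdivlMl// mulr1 xy0 /g; lra.
Qed.

(** A bipolar argument: if h x > 1, separate x from {h <= 1} by some y. Homogeneity upgrades z . y
    <= 1 on that set to z . y <= h z for all z, while x . y > 1. *)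
Lemma sublinear_polar (h : 'M[R]_(n, m) -> R) (C : R) x :
  (forall x y, h (x + y) <= h x + h y) -> (forall x, h x <= C * mxnorm2 x) ->
  (forall x, 0 <= h x) -> (forall r x, 0 < r -> h (r *: x) = r * h x) ->
  (forall y, (forall z, mxdot z y <= h z) -> mxdot x y <= 1) -> h x <= 1.
Proof.
move=> hD hC h0 hZ xP; rewrite leNgt; apply/negP => hx.
have [] := @separation [set z | h z <= 1] x.
- apply: (@closed_comp _ _ h [set r | r <= 1]); last exact: closed_le.
  by move=> z _; exact: (sublinear_continuous hD hC).
- by rewrite /mkset (le_trans (hC _))// mxnorm20 mulr0.
- move=> y z t /= hy hz /andP[t0 t1].
  have t1' : 0 < 1 - t by rewrite subr_gt0.
  rewrite scalerBr addrC addrAC -addrA -[X in _ + (X - _)]scale1r -scalerBl.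
  by apply: (le_trans (hD _ _)); rewrite !hZ//; nra.
- by move=> /=; apply/negP; rewrite -ltNge.
move=> y yK xy; suff : mxdot x y <= 1 by rewrite leNgt xy.
(* z is normalized by h z + e, because h z may be 0. *)
apply: xP => z; apply/ler_addgt0Pr => e e0.
have he : 0 < h z + e by rewrite ltr_wpDl.
have := yK ((h z + e)^-1 *: z); rewrite mxdotZl ler_pdivrMl// mulr1; apply.
by rewrite /mkset hZ ?invr_gt0// ler_pdivrMl// mulr1 lerDl ltW.
Qed.

End separation.

Section mean_support.
Context (R : realType) (n m : nat) (p : R) (Q : set 'rV[R]_m).
Hypotheses (n0 : (0 < n)%N) (p1 : 1 <= p) (HQ : convex_body_o Q).
Local Notation s := (support_fun Q).
Local Notation sigma := (sphere_measure R n 1).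
Local Notation S := (@mxsphere R n 1).
Implicit Types (x : 'M[R]_(n, m)) (v : 'cV[R]_n).

Let p0 : 0 < p. Proof. exact: lt_le_trans p1. Qed.

Lemma support_continuous : continuous (fun y : 'rV[R]_m => s y).
Proof.
have [C C0 sC] := support_bounded HQ.
by apply: sublinear_continuous sC => x y; exact: supportD.
Qed.

Lemma measurable_support : measurable_fun setT (fun y : 'rV[R]_m => s y).
Proof. by apply: continuous_measurable_mx; exact: support_continuous. Qed.

Lemma measurable_trmx k l : measurable_fun setT (fun x : 'M[R]_(k, l) => x^T).
Proof.
apply: measurable_fun_mx => i j; under eq_fun do rewrite mxE.
exact: measurable_coord.
Qed.

Lemma measurable_support_powR d (T : measurableType d) (f : T -> 'cV[R]_n) (g : T -> 'M[R]_(n, m)) :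
  measurable_fun setT f -> measurable_fun setT g ->
  measurable_fun setT (fun t => powR (s ((f t)^T *m g t)) p).
Proof.
move=> mf mg; apply: (measurableT_comp (@measurable_powR R p)).
apply: (measurableT_comp measurable_support); apply: measurable_mulmx2 => //.
exact: (measurableT_comp (@measurable_trmx _ _) mf).
Qed.

Lemma mxnorm2_mulmx_le (v : 'cV[R]_n) x : mxnorm2 (v^T *m x) <= mxnorm2 v * mxnorm2 x.
Proof.
rewrite -(@ler_pXn2r _ 2)// ?nnegrE ?mulr_ge0 ?mxnorm2_ge0// exprMn.
rewrite [leLHS]mxnorm2_sqr mxdotE big_ord1 (mxnorm2_sqr x) mxdotE exchange_big/= mulr_sumr.
apply: ler_sum => j _.
have -> : (v^T *m x) 0 j = mxdot v (col j x).
  by rewrite mxE mxdotE; apply: eq_bigr => i _; rewrite big_ord1 !mxE.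
have -> : \sum_i x i j * x i j = mxnorm2 (col j x) ^+ 2.
  by rewrite mxnorm2_sqr mxdotE; apply: eq_bigr => i _; rewrite big_ord1 !mxE.
rewrite -expr2 -exprMn -[leLHS]real_normK ?num_real//.
rewrite ler_pXn2r ?nnegrE ?mulr_ge0 ?mxnorm2_ge0// ler_norml mxdot_le andbT.
by rewrite lerNl -mxdotNl -(mxnorm2N v); exact: mxdot_le.
Qed.

Local Open Scope ereal_scope.

Lemma sphere_measure_lty : sigma setT < +oo.
Proof.
rewrite sphere_measureE /cone_measure lte_mul_pinfty// ?lee_fin//.
apply: le_lt_trans (leb_mx_ball_lty n 1 1%R).
apply: le_measure; rewrite ?inE; [exact: measurable_cone|exact: measurable_mxball|].
by move=> x [].
Qed.

(** Every nonzero vector has its direction on the sphere, so the cone over the complement is at most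
    the origin. *)
Lemma sphere_measureC : sigma (~` S) = 0.
Proof.
rewrite sphere_measureE /cone_measure (_ : leb_mx R n 1 _ = 0) ?mule0//.
apply/eqP; rewrite -measure_le0 -(leb_mx_set0 R (_ : 0 < n * 1)%N) ?muln1//.
apply: le_measure; rewrite ?inE.
- by apply: measurable_cone; apply: measurableC; exact: measurable_mxsphere.
- exact: measurable_set1_mx.
move=> v [_ Sv]; apply: contrapT => /eqP v0; apply: Sv; exact/mxsphere_dir.
Qed.

Lemma integral_sphereT (f : 'cV[R]_n -> \bar R) : measurable_fun setT f -> (forall v, 0 <= f v) ->
  \int[sigma]_(v in S) f v = \int[sigma]_v f v.
Proof.
move=> mf f0; rewrite [RHS](ge0_negligible_integral (N := ~` S))//.
- by rewrite setTD setCK.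
- by apply: measurableC; exact: measurable_mxsphere.
- exact: sphere_measureC.
Qed.

Definition mean_supportp x : \bar R := \int[sigma]_(v in S) (powR (s (v^T *m x)) p)%:E.

(** The function h of the overview: the support function of the projection body of the ball, with
    the cone measure in place of the Hausdorff measure. *)
Definition mean_support x : R := powR (fine (mean_supportp x)) p^-1.

Lemma measurable_support_slice x :
  measurable_fun setT (fun v => (powR (s (v^T *m x)) p)%:E).
Proof. by apply/measurable_EFinP; exact: measurable_support_powR. Qed.

Lemma mean_supportp_le : exists2 C : R, (0 < C)%R &
  forall x, mean_supportp x <= (powR (C * mxnorm2 x) p)%:E.
Proof.
have [C C0 sC] := support_bounded HQ.
have sf : sigma setT \is a fin_num by rewrite ge0_fin_numE// sphere_measure_lty.
pose k := (fine (sigma setT) + 1)%R.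
have k0 : (0 < k)%R by rewrite ltr_wpDl// fine_ge0.
exists (powR k p^-1 * C)%R; first by rewrite mulr_gt0// powR_gt0.
move=> x; apply: (@le_trans _ _ (\int[sigma]_(v in S) (powR (C * mxnorm2 x) p)%:E)).
  apply: ge0_le_integral => //.
  - exact: measurable_mxsphere.
  - by move=> v _; rewrite lee_fin powR_ge0.
  - exact: measurable_funTS (measurable_support_slice x).
  move=> v v1; rewrite lee_fin.
  apply: ge0_ler_powR; rewrite ?nnegrE ?(support_ge0 HQ) ?mulr_ge0 ?mxnorm2_ge0 ?(ltW p0) ?(ltW C0)//.
  apply: (le_trans (sC _)); rewrite ler_wpM2l ?(ltW C0)//.
  by apply: (le_trans (mxnorm2_mulmx_le _ _)); rewrite v1 mul1r.
rewrite integral_cst; last exact: measurable_mxsphere.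
have Cx : (0 <= C * mxnorm2 x)%R by rewrite mulr_ge0 ?mxnorm2_ge0// ltW.
rewrite (_ : powR (_ * _ * _) p = powR (C * mxnorm2 x) p * k)%R; last first.
  by rewrite -mulrA powRM ?powR_ge0// -powRrM mulVf ?gt_eqF// powRr1 ?(ltW k0)// mulrC.
rewrite EFinM lee_pmul ?lee_fin ?powR_ge0//.
apply: (@le_trans _ _ (sigma setT)).
  by apply: le_measure; rewrite ?inE//; exact: measurable_mxsphere.
by rewrite -(fineK sf) lee_fin lerDl.
Qed.

Lemma mean_supportp_ge0 x : 0 <= mean_supportp x.
Proof. by apply: integral_ge0 => v _; rewrite lee_fin powR_ge0. Qed.

Lemma mean_supportp_fin x : mean_supportp x \is a fin_num.
Proof.
have [C _ hC] := mean_supportp_le.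
by rewrite ge0_fin_numE ?mean_supportp_ge0// (le_lt_trans (hC _))// ltry.
Qed.

Lemma mean_supportE x : (powR (mean_support x) p)%:E = mean_supportp x.
Proof.
rewrite /mean_support -powRrM mulVf ?gt_eqF// powRr1 ?fineK ?mean_supportp_fin//.
by rewrite fine_ge0// mean_supportp_ge0.
Qed.

Lemma mean_support_ge0 x : (0 <= mean_support x)%R.
Proof. exact: powR_ge0. Qed.

Lemma mean_support_le : exists2 C : R, (0 < C)%R & forall x, (mean_support x <= C * mxnorm2 x)%R.
Proof.
have [C C0 hC] := mean_supportp_le; exists C => // x.
have Cx : (0 <= C * mxnorm2 x)%R by rewrite mulr_ge0 ?mxnorm2_ge0// ltW.
rewrite -[leRHS](powRr1 Cx) -(@mulfV _ p) ?gt_eqF// powRrM.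
apply: ge0_ler_powR; rewrite ?nnegrE ?invr_ge0 ?powR_ge0 ?(ltW p0) ?fine_ge0 ?mean_supportp_ge0//.
by rewrite -lee_fin fineK ?mean_supportp_fin.
Qed.

Lemma mean_supportZ r x : (0 < r)%R -> mean_support (r *: x) = (r * mean_support x)%R.
Proof.
move=> r0.
have e : mean_supportp (r *: x) = (powR r p)%:E * mean_supportp x.
  rewrite /mean_supportp -ge0_integralZl//.
  - apply: eq_integral => v _; rewrite -scalemxAr (supportZ HQ)// powRM ?(ltW r0) ?(support_ge0 HQ)//.
  - exact: measurable_mxsphere.
  - exact: measurable_funTS (measurable_support_slice x).
  - by move=> v _; rewrite lee_fin powR_ge0.
  - by rewrite lee_fin powR_ge0.
rewrite /mean_support e fineM ?mean_supportp_fin//= powRM ?powR_ge0 ?fine_ge0 ?mean_supportp_ge0//.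
by rewrite -powRrM mulfV ?gt_eqF// powRr1// ltW.
Qed.

Lemma mean_support_Lnorm x :
  (mean_support x)%:E = Lnorm sigma p%:E (EFin \o (fun v => s (v^T *m x))).
Proof.
rewrite unlock /Lnorm.
under eq_integral do rewrite /= ger0_norm ?(support_ge0 HQ)//.
rewrite -integral_sphereT//; last 2 first.
- exact: measurable_support_slice.
- by move=> v; rewrite lee_fin powR_ge0.
by rewrite /mean_support -/(mean_supportp x) -{2}(fineK (mean_supportp_fin x)).
Qed.

(** Subadditivity of s pointwise, then Minkowski's inequality in L^p, where p >= 1 enters. *)
Lemma mean_supportD x y : (mean_support (x + y) <= mean_support x + mean_support y)%R.
Proof.
have ms z : measurable_fun setT (fun v => s (v^T *m z)).
  apply: (measurableT_comp measurable_support); apply: measurable_mulmx2 => //.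
  exact: measurable_trmx.
pose L z := Lnorm sigma p%:E (EFin \o (fun v : 'cV[R]_n => s (v^T *m z))).
suff: L (x + y)%R <= L x + L y.
  by rewrite /L; do 3! rewrite -mean_support_Lnorm.
rewrite /L.
apply: le_trans (minkowski_EFin _ (ms x) (ms y) p1).
rewrite unlock /Lnorm.
apply: gt0_ler_poweR; rewrite ?invr_ge0 ?(ltW p0)//.
- by rewrite in_itv/= leey andbT integral_ge0// => v _; rewrite lee_fin powR_ge0.
- by rewrite in_itv/= leey andbT integral_ge0// => v _; rewrite lee_fin powR_ge0.
apply: ge0_le_integral => //.
- by move=> v _; rewrite lee_fin powR_ge0.
- apply/measurable_EFinP; apply: (measurableT_comp (@measurable_powR R p)).
  exact: (measurableT_comp (@normr_measurable R setT) (ms _)).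
- apply/measurable_EFinP; apply: (measurableT_comp (@measurable_powR R p)).
  by apply: (measurableT_comp (@normr_measurable R setT)); exact: measurable_funD.
move=> v _; rewrite lee_fin; apply: ge0_ler_powR; rewrite ?nnegrE ?(ltW p0)//.
rewrite !ger0_norm ?addr_ge0 ?(support_ge0 HQ)// mulmxDr; exact: supportD.
Qed.

Lemma continuous_mean_support : continuous mean_support.
Proof.
have [C _ hC] := mean_support_le; exact: sublinear_continuous mean_supportD hC.
Qed.

(** By [support_interior], s (v0^T x) > 0 for some v0. By continuity the value stays above a
    positive level on a set of directions whose cone contains a nonempty open set, so that this set
    has positive measure. *)
Lemma mean_support_neq0 x : x != 0%R -> (0 < mean_support x)%R.
Proof.
move=> x0; rewrite powR_gt0// fine_gt0//; apply/andP; split; last first.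
  by rewrite -ge0_fin_numE ?mean_supportp_ge0// mean_supportp_fin.
have [v0 sv0] : exists v0 : 'cV[R]_n, (0 < s (v0^T *m x))%R.
  have [r r0 hr] := support_interior HQ.
  have /matrix0Pn[i [j xij]] := x0.
  have ry : (0 < r * mxnorm2 ((delta_mx i 0%R : 'cV[R]_n)^T *m x))%R.
    rewrite mulr_gt0// mxnorm2_gt0 trmx_delta -rowE; apply/eqP => /rowP/(_ j).
    by rewrite !mxE; exact/eqP.
  have [h|h] := hr ((delta_mx i 0%R : 'cV[R]_n)^T *m x)%R.
    by exists (delta_mx i 0%R); exact: lt_le_trans h.
  by exists (- delta_mx i 0%R)%R; rewrite linearN mulNmx; exact: lt_le_trans h.
(* Small enough that s (v0^T x) > d |v0|. Comparing with d |v| makes the condition invariant under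
   positive scaling of v, so it passes to directions. *)
pose d := (s (v0^T *m x) / (2 * (mxnorm2 v0 + 1)))%R.
have k0 : (0 < 2 * (mxnorm2 v0 + 1))%R by rewrite mulr_gt0// ltr_wpDl ?mxnorm2_ge0.
have d0 : (0 < d)%R by rewrite divr_gt0.
pose g (v : 'cV[R]_n) : R := (s (v^T *m x) - d * mxnorm2 v)%R.
have [C C0 sC] := support_bounded HQ.
have cs : continuous (fun v : 'cV[R]_n => s (v^T *m x)).
  apply: (@sublinear_continuous _ _ _ _ (C * mxnorm2 x)%R) => [v w|v].
    by rewrite linearD mulmxDl; exact: supportD.
  apply: (le_trans (sC _)); rewrite -mulrA ler_wpM2l ?(ltW C0)// mulrC.
  exact: mxnorm2_mulmx_le.
have cg : continuous g.
  move=> v.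
  have h2 : {for v, continuous (fun v : 'cV[R]_n => d * mxnorm2 v)%R}.
    apply: (@continuousM R 'cV[R]_n (fun=> d) (@mxnorm2 R n 1) v).
      exact: cst_continuous.
    exact: continuous_mxnorm2.
  have h1 : {for v, continuous (fun v : 'cV[R]_n => s (v^T *m x))} := cs v.
  exact: (continuousB h1 h2).
pose U := @mxnorm2 R n 1 @^-1` [set r | r < 1]%R `&` g @^-1` [set r | r > 0]%R.
have oU : open U.
  apply: openI; apply: open_comp.
  - by move=> v _; exact: continuous_mxnorm2.
  - exact: open_lt.
  - by move=> v _; exact: cg.
  - exact: open_gt.
have U0 : U !=set0.
  pose t := (mxnorm2 v0 + 1)^-1%R.
  have t0 : (0 < t)%R by rewrite invr_gt0 ltr_wpDl ?mxnorm2_ge0.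
  exists (t *: v0)%R; split; rewrite /preimage /mkset.
    by rewrite mxnorm2Z gtr0_norm// mulrC ltr_pdivrMr ?mul1r ?ltrDl// ltr_wpDl ?mxnorm2_ge0.
  rewrite /g linearZ/= -scalemxAl (supportZ HQ)// mxnorm2Z gtr0_norm//.
  rewrite (mulrCA d) -mulrBr mulr_gt0// subr_gt0 /d -mulrA.
  rewrite gtr_pMr// mulrC ltr_pdivrMr// mul1r.
  by have := mxnorm2_ge0 v0; lra.
pose A := S `&` [set v | d < s (v^T *m x)]%R.
have mA : measurable A.
  apply: measurableI; first exact: measurable_mxsphere.
  apply: open_measurable_mx.
  have -> : [set v | d < s (v^T *m x)]%R =
      (fun v : 'cV[R]_n => s (v^T *m x)) @^-1` [set r | r > d]%R by [].
  by apply: open_comp => [v _|]; [exact: cs|exact: open_gt].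
have UA : U `<=` cone A.
  move=> v [v1]; rewrite /g /preimage /mkset subr_gt0 => dv.
  have v00 : v != 0%R.
    apply/eqP => v00; move: dv; rewrite v00 mxnorm20 mulr0 trmx0 mul0mx => h.
    have := sC 0%R; rewrite mxnorm20 mulr0; by rewrite leNgt h.
  split; first exact: ltW.
  split; first exact/mxsphere_dir.
  have nv : (0 < (mxnorm2 v)^-1)%R by rewrite invr_gt0 mxnorm2_gt0.
  by rewrite /mkset /dir linearZ/= -scalemxAl (supportZ HQ)// ltr_pdivlMl ?mxnorm2_gt0// mulrC.
apply: (@lt_le_trans _ _ (\int[sigma]_(v in A) (powR d p)%:E)).
  rewrite integral_cst// mule_gt0 ?lte_fin ?powR_gt0//.
  rewrite [ltRHS]sphere_measureE /cone_measure mule_gt0 ?lte_fin ?ltr0n ?muln1//.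
  apply: (lt_le_trans (leb_mx_open_gt0 oU U0)); apply: le_measure; rewrite ?inE//.
    exact: open_measurable_mx.
  exact: measurable_cone.
apply: (@le_trans _ _ (\int[sigma]_(v in A) (powR (s (v^T *m x)) p)%:E)).
  apply: ge0_le_integral => //.
  - by move=> v _; rewrite lee_fin powR_ge0.
  - exact: measurable_funTS (measurable_support_slice x).
  move=> v [_ /= dv]; rewrite lee_fin.
  by apply: ge0_ler_powR; rewrite ?nnegrE ?(support_ge0 HQ) ?(ltW p0) ?(ltW d0) ?(ltW dv).
apply: ge0_subset_integral => //.
- exact: measurable_mxsphere.
- exact: measurable_funTS (measurable_support_slice x).
- by move=> v _; rewrite lee_fin powR_ge0.
- exact: subIsetl.
Qed.

End mean_support.

(** * The capacity inequality *)

Section poweRV_theory.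
Context (R : realType).
Local Open Scope ereal_scope.

Lemma poweRV_EFin (r a : R) : (0 < r)%R -> poweRV r%:E a = (powR r (- a))%:E.
Proof. by move=> r0; rewrite /poweRV eqe gt_eqF. Qed.

Lemma poweRV_ge0 (x : \bar R) a : 0 <= poweRV x a.
Proof. by rewrite /poweRV; case: ifPn => // _; case: ifPn => // _; exact: poweR_ge0. Qed.

Lemma poweRV_anti (x y : \bar R) a : (0 < a)%R -> 0 <= x -> x <= y -> poweRV y a <= poweRV x a.
Proof.
move=> a0 x0 xy; rewrite {2}/poweRV; case: ifPn => [_|xN0]; first by rewrite leey.
have {}x0 : 0 < x by rewrite lt0e xN0.
case: y xy => [y| |]; last by rewrite leeNy_eq => /eqP xE; rewrite xE in x0.
  case: x x0 {xN0} => [x| |]//; rewrite lte_fin lee_fin => x0 xy.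
  have y0 := lt_le_trans x0 xy; rewrite poweRV_EFin//= lee_fin !powRN.
  rewrite lef_pV2 ?posrE ?powR_gt0//; apply: ge0_ler_powR => //; rewrite ?nnegrE ltW//.
by move=> _; rewrite {1}/poweRV /=; case: ifPn => // _; exact: poweR_ge0.
Qed.

End poweRV_theory.

Section hausdorff0.
Context (R : realType).
Local Open Scope ereal_scope.

Lemma hausdorff_set0 n m k : hausdorff k (set0 : set 'M[R]_(n, m)) = 0.
Proof.
have content0 d : hausdorff_content k d (set0 : set 'M[R]_(n, m)) = 0.
  apply/eqP; rewrite eq_le; apply/andP; split.
    apply: ereal_inf_lbound; exists (fun=> set0).
      split => [x //|i]; apply: ge_ereal_sup => _ [x []].
    by apply: eseries0 => i _ _; rewrite /hausdorff_weight eqxx.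
  apply: le_ereal_inf_tmp => _ [F _ <-]; apply: nneseries_ge0 => i _ _.
  exact: hausdorff_weight_ge0.
apply/eqP; rewrite eq_le; apply/andP; split.
  by apply: ge_ereal_sup => _ [d _ <-]; rewrite content0.
by apply: ereal_sup_ubound; exists 1%R => //; rewrite /mkset ltr01.
Qed.

Lemma integral_sphere_le_hausdorff n m k (F : 'M[R]_(n, m) -> \bar R) : (n * m = k.+1)%N ->
  (forall x, 0 <= F x) ->
  \int[sphere_measure R n m]_(x in @mxsphere R n m) F x <=
  \int[hausdorff k]_(x in @mxsphere R n m) F x.
Proof.
move=> nmk F0; apply: le_integral_set_function => //; first exact: hausdorff_set0.
move=> A mA AS; apply: le_trans (hausdorff_ge nmk mA AS).
by rewrite le_eqVlt (_ : (_ == _) = true)//; apply/eqP; exact: sphere_measureE.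
Qed.

End hausdorff0.

Section mean_volume.
Context (R : realType) (n m : nat) (p : R) (Q : set 'rV[R]_m).
Hypotheses (n0 : (0 < n)%N) (m0 : (0 < m)%N) (p1 : 1 <= p) (HQ : convex_body_o Q).
Local Notation N := (n * m)%N.
Local Notation h := (@mean_support R n m p Q).
Local Notation sigma := (sphere_measure R n 1).
Local Notation S := (@mxsphere R n 1).
Local Open Scope ereal_scope.

Let p0 : (0 < p)%R. Proof. exact: lt_le_trans p1. Qed.

Let hZ r x : (0 < r)%R -> h (r *: x)%R = (r * h x)%R. Proof. exact: mean_supportZ. Qed.

Let ch : continuous h. Proof. exact: continuous_mean_support. Qed.

Definition mean_ball : set 'M[R]_(n, m) := [set x | h x < 1]%R.

Lemma open_mean_ball : open mean_ball.
Proof.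
have -> : mean_ball = h @^-1` [set r | r < 1]%R by [].
by apply: open_comp => [x _|]; [exact: ch|exact: open_lt].
Qed.

Lemma measurable_mean_ball : measurable mean_ball.
Proof. exact: open_measurable_mx open_mean_ball. Qed.

Lemma mean_volume_gt0 : 0 < leb_mx R n m mean_ball.
Proof.
apply: leb_mx_open_gt0; first exact: open_mean_ball.
exists 0%R; have [C _ hC] := mean_support_le n p1 HQ.
by rewrite /mean_ball /mkset (le_lt_trans (hC _))// mxnorm20 mulr0.
Qed.

(** The minimum of h over the compact unit sphere is positive; it makes the mean ball bounded, hence
    of finite volume. *)
Lemma mean_support_lower : exists2 c : R, (0 < c)%R & forall x, (c * mxnorm2 x <= h x)%R.
Proof.
have cS : compact (@mxsphere R n m).
  apply: (@bounded_closed_compact_mx _ _ _ _ 1%R) => [|x ->//].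
  have -> : @mxsphere R n m = @mxnorm2 R n m @^-1` [set 1%R] by [].
  apply: closed_comp => [x _|]; first exact: continuous_mxnorm2.
  exact/accessible_closed_set1/hausdorff_accessible/norm_hausdorff.
have S0 : @mxsphere R n m !=set0.
  exists (delta_mx (Ordinal n0) (Ordinal m0)).
  by rewrite /mxsphere /mkset /mxnorm2 mxdot_delta mxE !eqxx sqrtr1.
have [z /set_mem Sz minz] := compact_EVT_min S0 cS (continuous_subspaceT ch).
exists (h z).
  apply: mean_support_neq0 => //; apply/eqP => z0.
  by move: Sz; rewrite z0 /mxsphere /mkset mxnorm20 => /eqP; rewrite eq_sym oner_eq0.
move=> x; have [->|x0] := eqVneq x 0%R; first by rewrite mxnorm20 mulr0; exact: mean_support_ge0.
have nx : (0 < mxnorm2 x)%R by rewrite mxnorm2_gt0.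
have nx1 : (0 < (mxnorm2 x)^-1)%R by rewrite invr_gt0.
rewrite -(ler_pdivlMr _ _ nx) [leRHS]mulrC -(hZ x nx1).
by apply: minz; apply/mem_set; exact: mxnorm2_dir.
Qed.

Lemma mean_volume_lty : leb_mx R n m mean_ball < +oo.
Proof.
have [c c0 hc] := mean_support_lower.
apply: le_lt_trans (leb_mx_ball_lty n m c^-1).
apply: le_measure; rewrite ?inE; [exact: measurable_mean_ball|exact: measurable_mxball|].
move=> x hx; rewrite /mkset -[leRHS]mul1r ler_pdivlMr// mulrC.
by apply: ltW; exact: le_lt_trans hx.
Qed.

Definition mean_volume : R := fine (leb_mx R n m mean_ball).

Lemma mean_volumeE : leb_mx R n m mean_ball = mean_volume%:E.
Proof. by rewrite fineK// ge0_fin_numE// mean_volume_lty. Qed.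

Lemma mean_volume_pos : (0 < mean_volume)%R.
Proof. by rewrite fine_gt0// mean_volume_gt0 mean_volume_lty. Qed.

Lemma leb_mx_mean_ballZ r : (0 < r)%R ->
  leb_mx R n m [set x | r * h x < 1]%R = (r ^- N * mean_volume)%:E.
Proof.
move=> r0; rewrite EFinM -mean_volumeE -leb_mx_scale//; last exact: measurable_mean_ball.
by congr (leb_mx R n m _); apply/seteqP; split => x; rewrite /mean_ball /preimage /mkset hZ.
Qed.

(** Passes from h < 1 to h <= 1: the closed set lies in the dilate of the mean ball by 1 + e, and e
    tends to 0. *)
Lemma mean_volume_closed A : measurable A -> A `<=` [set x | h x <= 1]%R ->
  leb_mx R n m A <= mean_volume%:E.
Proof.
move=> mA Ah.
have key e : (0 < e)%R -> leb_mx R n m A <= ((1 + e) ^+ N * mean_volume)%:E.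
  move=> e0; have r0 : (0 < (1 + e)^-1)%R by rewrite invr_gt0 addr_gt0.
  have := leb_mx_mean_ballZ r0; rewrite exprVn invrK => <-; apply: le_measure; rewrite ?inE//.
    have -> : [set x | (1 + e)^-1 * h x < 1]%R = *:%R (1 + e)^-1%R @^-1` mean_ball.
      by apply/seteqP; split => x; rewrite /mean_ball /preimage /mkset hZ.
    by apply: measurable_preimage measurable_mean_ball; exact: measurable_scalemx.
  move=> x /Ah hx; rewrite /mkset mulrC ltr_pdivrMr ?addr_gt0// mul1r.
  by apply: (le_lt_trans hx); rewrite ltrDl.
have fA : leb_mx R n m A \is a fin_num.
  by rewrite ge0_fin_numE// (le_lt_trans (key 1%R _))// ltry.
rewrite -(fineK fA) lee_fin.
have := @ge_of_right_limit R (fun e => (1 + e) ^+ N * mean_volume)%R (fine (leb_mx R n m A)).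
rewrite addr0 expr1n mul1r; apply.
  apply: (@continuousM R R (fun e => (1 + e) ^+ N)%R (fun=> mean_volume) 0%R).
    have c1 : {for 0%R, continuous (fun e : R => 1 + e)%R}.
      by apply: (@continuousD R R R (fun=> 1%R) id 0%R); [exact: cst_continuous|exact: cvg_id].
    exact: (continuous_comp c1 (@exprn_continuous R N _)).
  exact: cst_continuous.
by move=> e /andP[e0 _]; rewrite -lee_fin fineK//; exact: key.
Qed.

Lemma mean_support_le_hausdorff x : (h x)%:E <=
  poweR (\int[hausdorff n.-1]_(v in S) (powR (support_fun Q (v^T *m x)) p)%:E) p^-1.
Proof.
apply: (@le_trans _ _ (poweR (mean_supportp p Q x) p^-1)).
  by rewrite -(mean_supportE p1 HQ) poweR_EFin -powRrM mulfV ?gt_eqF// powRr1// mean_support_ge0.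
have i1 := mean_supportp_ge0 p Q x.
have i2 : mean_supportp p Q x <=
    \int[hausdorff n.-1]_(v in S) (powR (support_fun Q (v^T *m x)) p)%:E.
  apply: integral_sphere_le_hausdorff => [|v]; first by rewrite muln1 prednK.
  by rewrite lee_fin powR_ge0.
apply: gt0_ler_poweR => //; rewrite ?invr_ge0 ?(ltW p0)//.
- by rewrite in_itv/= leey andbT.
- by rewrite in_itv/= leey andbT (le_trans i1).
Qed.

(** The body with support function h is contained in the projection body, because h is below the
    Hausdorff integral. Polarity reverses the inclusion, and by [sublinear_polar] the polar of the
    former lies in {h <= 1}. *)
Lemma leb_mx_polar_projection_body :
  leb_mx R n m (polar (projection_body_ball p Q)) <= mean_volume%:E.
Proof.
apply: mean_volume_closed.
  apply: closed_measurable_mx.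
  have -> : polar (@projection_body_ball R n m p Q) =
      \bigcap_(y in projection_body_ball p Q) [set x | mxdot x y <= 1]%R by [].
  apply: closed_bigI => y _.
  have -> : [set x | mxdot x y <= 1]%R = (fun x : 'M[R]_(n, m) => mxdot x y) @^-1` [set r | r <= 1]%R by [].
  by apply: closed_comp => [x _|]; [exact: continuous_mxdotr|exact: closed_le].
have [C _ hC] := mean_support_le n p1 HQ.
move=> x Px; apply: (sublinear_polar (C := C)) => //.
- by move=> y z; exact: mean_supportD.
- by move=> y; exact: mean_support_ge0.
move=> y hy; apply: Px => z; apply: le_trans (mean_support_le_hausdorff z).
by rewrite lee_fin.
Qed.

(** The cone over the whole space is the unit ball; hence the normalization in [d_const] is met
    exactly, without any comparison with Hausdorff measure. *)
Lemma sphere_measureT : sigma setT = n%:R%:E * omega R n.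
Proof.
rewrite [LHS]sphere_measureE /cone_measure omegaE.
have -> : cone [set: 'cV[R]_n] = [set x | mxnorm2 x <= 1]%R.
  by apply/seteqP; split => x; [case|].
by rewrite leb_mx_rV vec_mx_ball muln1.
Qed.

End mean_volume.

Section directional_mean.
Context (R : realType) (n' m : nat) (p : R) (Q : set 'rV[R]_m).
Local Notation n := n'.+1.
Hypotheses (p1 : 1 <= p) (HQ : convex_body_o Q).
Local Notation s := (support_fun Q).
Local Notation sigma := (sphere_measure R n 1).
Local Notation S := (@mxsphere R n 1).
Local Notation P := (frame_measure R n').
(** Stands for the gradient of an admissible function; for the averaging, only its measurability
    matters. *)
Variable gr : 'cV[R]_n -> 'cV[R]_n.
Hypothesis mgr : measurable_fun setT gr.
Local Open Scope ereal_scope.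

Let p0 : (0 < p)%R. Proof. exact: lt_le_trans p1. Qed.

Definition sphere_area : R := fine (sigma setT).

Lemma sphere_areaE : sigma setT = sphere_area%:E.
Proof. by rewrite fineK// ge0_fin_numE// sphere_measure_lty. Qed.

Lemma sphere_area_gt0 : (0 < sphere_area)%R.
Proof.
rewrite fine_gt0// sphere_measure_lty andbT sphere_measureT omegaE.
by rewrite mule_gt0 ?leb_rV_ball_gt0// lte_fin ltr0n.
Qed.

Lemma sphere_areaS : sigma S = sphere_area%:E.
Proof.
rewrite -sphere_areaE -(setvU S) measureU//.
- by rewrite [X in X + _](_ : _ = 0) ?add0e//; exact: sphere_measureC.
- by apply: measurableC; exact: measurable_mxsphere.
- exact: measurable_mxsphere.
- by rewrite setICl.
Qed.

Definition energy : \bar R := \int[leb_mx R n 1]_x (powR (mxnorm2 (gr x)) p)%:E.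

Definition dir_energy (u : 'M[R]_(n, m)) : \bar R :=
  \int[leb_mx R n 1]_x (powR (s ((gr x)^T *m u)) p)%:E.

Let menergy : measurable_fun setT (fun x => (powR (mxnorm2 (gr x)) p)%:E).
Proof.
apply/measurable_EFinP; apply: (measurableT_comp (@measurable_powR R p)).
exact: (measurableT_comp (@measurable_mxnorm2 R n 1) mgr).
Qed.

Let mdir_energy d (T : measurableType d) (g : T -> 'M[R]_(n, m)) : measurable_fun setT g ->
  measurable_fun setT (fun z : T * 'cV[R]_n => (powR (s ((gr z.2)^T *m g z.1)) p)%:E).
Proof.
move=> mg; apply/measurable_EFinP.
apply: (measurable_support_powR _ HQ).
  exact: (measurableT_comp mgr measurable_snd).
exact: (measurableT_comp mg measurable_fst).
Qed.

Let mdir_energy1 u : measurable_fun setT (fun x => (powR (s ((gr x)^T *m u)) p)%:E).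
Proof. by apply/measurable_EFinP; exact: measurable_support_powR. Qed.

Lemma energy_ge0 : 0 <= energy.
Proof. by apply: integral_ge0 => x _; rewrite lee_fin powR_ge0. Qed.

Lemma dir_energy_ge0 u : 0 <= dir_energy u.
Proof. by apply: integral_ge0 => x _; rewrite lee_fin powR_ge0. Qed.

Lemma dir_energy_lty u : energy < +oo -> dir_energy u < +oo.
Proof.
move=> Ey; have [C C0 sC] := support_bounded HQ.
have Cu : (0 <= C * mxnorm2 u)%R by rewrite mulr_ge0 ?mxnorm2_ge0// ltW.
apply: (@le_lt_trans _ _ ((powR (C * mxnorm2 u) p)%:E * energy)); last first.
  by rewrite lte_mul_pinfty ?lee_fin ?powR_ge0.
rewrite -ge0_integralZl//; last 2 first.
- by move=> x _; rewrite lee_fin powR_ge0.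
- by rewrite lee_fin powR_ge0.
apply: ge0_le_integral => //.
- by move=> x _; rewrite lee_fin powR_ge0.
- by apply: measurable_funeM.
move=> x _; rewrite -EFinM lee_fin -powRM ?mxnorm2_ge0//.
apply: ge0_ler_powR; rewrite ?nnegrE ?(ltW p0) ?(support_ge0 HQ)//.
  by rewrite mulr_ge0 ?mxnorm2_ge0.
apply: (le_trans (sC _)); rewrite -mulrA ler_wpM2l ?(ltW C0)// mulrC.
exact: mxnorm2_mulmx_le.
Qed.

Lemma measurable_dir_energy : measurable_fun setT dir_energy.
Proof.
apply: (@measurable_fun_fubini_tonelli_F _ _ _ _ _ (leb_mx R n 1)
  (fun z : 'M[R]_(n, m) * 'cV[R]_n => (powR (s ((gr z.2)^T *m z.1)) p)%:E)).
  by apply: (@mdir_energy _ _ id); exact: measurable_id.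
by move=> z; rewrite lee_fin powR_ge0.
Qed.

(** Write w as its norm times its direction: the norm comes out by homogeneity, and a random
    rotation of a unit vector is uniform on the sphere. *)
Lemma support_rotation_average (u : 'M[R]_(n, m)) (w : 'cV[R]_n) :
  \int[P]_X (powR (s ((frame X *m w)^T *m u)) p)%:E =
  (powR (mxnorm2 w) p)%:E * (mean_supportp p Q u * sphere_area^-1%:E).
Proof.
have [->|w0] := eqVneq w 0%R.
  rewrite mxnorm20 powR0 ?gt_eqF// mul0e integral0_eq// => X _.
  rewrite mulmx0 trmx0 mul0mx (_ : s 0 = 0)%R ?powR0 ?gt_eqF//.
  have [C _ sC] := support_bounded HQ.
  apply/eqP; rewrite eq_le support_ge0// andbT.
  by have := sC 0%R; rewrite mxnorm20 mulr0.
have wn : (0 < mxnorm2 w)%R by rewrite mxnorm2_gt0.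
have mF := measurable_support_slice p HQ u.
have F0 v : 0 <= (powR (s (v^T *m u)) p)%:E by rewrite lee_fin powR_ge0.
have <- : \int[P]_X (powR (s ((frame X *m dir w)^T *m u)) p)%:E =
    mean_supportp p Q u * sphere_area^-1%:E.
  rewrite /mean_supportp -(rotation_average mF F0 (mxnorm2_dir w0)) sphere_areaS.
  by rewrite -muleA -EFinM mulfV ?mule1// gt_eqF// sphere_area_gt0.
rewrite -ge0_integralZl//; last 2 first.
- apply: (measurableT_comp mF); apply: measurable_mulmx2; first exact: measurable_frame.
  exact: measurable_cst.
- by rewrite lee_fin powR_ge0.
apply: eq_integral => X _; rewrite -EFinM -powRM ?mxnorm2_ge0 ?(support_ge0 HQ)//.
have -> : (frame X *m w = mxnorm2 w *: (frame X *m dir w))%R.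
  by rewrite scalemxAr /dir scalerA mulfV ?scale1r// gt_eqF.
by rewrite [X in (X *m u)%R]linearZ/= -scalemxAl (supportZ HQ).
Qed.

(** Tonelli, then [support_rotation_average] at w = gr x for each x; transposition moves the
    rotation from u to gr x. *)
Lemma dir_energy_average u :
  \int[P]_X dir_energy ((frame X)^T *m u) = energy * (mean_supportp p Q u * sphere_area^-1%:E).
Proof.
pose f (z : 'M[R]_n * 'cV[R]_n) : \bar R := (powR (s ((gr z.2)^T *m ((frame z.1)^T *m u))) p)%:E.
have mf : measurable_fun setT f.
  apply: (@mdir_energy _ _ (fun X => (frame X)^T *m u)); apply: measurable_mulmx2.
    by apply: (measurableT_comp (@measurable_trmx R n n)); exact: measurable_frame.
  exact: measurable_cst.
have f0 z : 0 <= f z by rewrite lee_fin powR_ge0.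
transitivity (\int[P]_X \int[leb_mx R n 1]_x f (X, x)) => //.
rewrite (fubini_tonelli f mf f0) /energy -ge0_integralZr//; last 2 first.
- by move=> x _; rewrite lee_fin powR_ge0.
- by rewrite mule_ge0 ?mean_supportp_ge0// lee_fin invr_ge0 ltW// sphere_area_gt0.
apply: eq_integral => x _; rewrite -support_rotation_average.
by apply: eq_integral => X _; rewrite /f /= mulmxA -trmx_mul.
Qed.

End directional_mean.

Lemma powRVK (R : realType) (a q : R) : 0 < q -> 0 <= a -> powR (powR a q^-1) q = a.
Proof. by move=> q0 a0; rewrite -powRrM mulVf ?gt_eqF// powRr1. Qed.

Lemma powRKV (R : realType) (a q : R) : 0 < q -> 0 <= a -> powR (powR a q) q^-1 = a.
Proof. by move=> q0 a0; rewrite -powRrM mulfV ?gt_eqF// powRr1. Qed.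

Section capacity_bound.
Context (R : realType) (n' m : nat) (p : R) (Q : set 'rV[R]_m).
Local Notation n := n'.+1.
Local Notation N := (n * m)%N.
Hypotheses (m0 : (0 < m)%N) (p1 : 1 <= p) (HQ : convex_body_o Q).
Local Notation s := (support_fun Q).
Local Notation h := (@mean_support R n m p Q).
Local Notation V := (mean_volume n p Q).
Local Notation area := (sphere_area R n').
Local Open Scope ereal_scope.

Let n0 : (0 < n)%N. Proof. by []. Qed.

Let p0 : (0 < p)%R. Proof. exact: lt_le_trans p1. Qed.

Let N0 : (0 < N%:R :> R)%R. Proof. by rewrite ltr0n muln_gt0 m0. Qed.

Let pN0 : (0 < p / N%:R)%R. Proof. by rewrite divr_gt0. Qed.

Let V0 : (0 < V)%R. Proof. exact: mean_volume_pos. Qed.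

Let area0 : (0 < area)%R. Proof. exact: sphere_area_gt0. Qed.

Section vector_field.
Variable gr : 'cV[R]_n -> 'cV[R]_n.
Hypotheses (mgr : measurable_fun setT gr) (Ey : energy p gr < +oo).
Local Notation E := (energy p gr).
Local Notation A := (@dir_energy R n' m p Q gr).

Let G (u : 'M[R]_(n, m)) : R := powR (fine (A u)) p^-1.

Let Efin : E = (fine E)%:E.
Proof. by rewrite fineK// ge0_fin_numE// energy_ge0. Qed.

Let E0 : (0 <= fine E)%R. Proof. by rewrite fine_ge0// energy_ge0. Qed.

Let Afin u : A u \is a fin_num.
Proof. by rewrite ge0_fin_numE; [exact: dir_energy_lty|exact: dir_energy_ge0]. Qed.

Let A0 u : (0 <= fine (A u))%R. Proof. by rewrite fine_ge0// dir_energy_ge0. Qed.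

Let GE u : poweR (A u) p^-1 = (G u)%:E.
Proof. by rewrite -(fineK (Afin u)) poweR_EFin. Qed.

Let Gp u : (powR (G u) p)%:E = A u.
Proof. exact: etrans (congr1 EFin (powRVK p0 (A0 u))) (fineK (Afin u)). Qed.

Let mG : measurable_fun setT G.
Proof.
apply: (measurableT_comp (@measurable_powR R p^-1)).
by apply: (measurableT_comp (fine_measurable measurableT)); exact: measurable_dir_energy.
Qed.

Let G0 u : (0 <= G u)%R. Proof. exact: powR_ge0. Qed.

Let GZ r u : (0 < r)%R -> G (r *: u)%R = (r * G u)%R.
Proof.
move=> r0.
have AZ : A (r *: u)%R = (powR r p)%:E * A u.
  rewrite /dir_energy -ge0_integralZl//.
  - apply: eq_integral => x _.
    by rewrite -scalemxAr (supportZ HQ)// -EFinM powRM ?(support_ge0 HQ) ?(ltW r0).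
  - by apply/measurable_EFinP; exact: measurable_support_powR.
  - by move=> x _; rewrite lee_fin powR_ge0.
  - by rewrite lee_fin powR_ge0.
by rewrite /G AZ fineM ?Afin//= powRM ?powR_ge0 ?A0// powRKV// ltW.
Qed.

(** Normalized so that g^p, with g = c h, is the rotation average of G^p. *)
Let c := powR (fine E / area) p^-1.

Let g (u : 'M[R]_(n, m)) : R := (c * h u)%R.

Let c0 : (0 <= c)%R. Proof. exact: powR_ge0. Qed.

Let g0 u : (0 <= g u)%R.
Proof. by rewrite mulr_ge0//; exact: mean_support_ge0. Qed.

Let mg : measurable_fun setT g.
Proof.
apply: measurable_funM; first exact: measurable_cst.
by apply: continuous_measurable_mx; exact: continuous_mean_support.
Qed.

Let gZ r u : (0 < r)%R -> g (r *: u)%R = (r * g u)%R.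
Proof. by move=> r0; rewrite /g (mean_supportZ p1 HQ)// mulrCA. Qed.

Let G_average u : \int[frame_measure R n']_X (powR (G ((frame X)^T *m u)) p)%:E = (powR (g u) p)%:E.
Proof.
transitivity (\int[frame_measure R n']_X A ((frame X)^T *m u)).
  by apply: eq_integral => X _; exact: Gp.
have -> : powR (g u) p = (fine E / area * powR (h u) p)%R.
  rewrite /g powRM ?mean_support_ge0//; congr (_ * _)%R.
  by rewrite /c -powRrM mulVf ?gt_eqF// powRr1// divr_ge0// ltW.
rewrite (dir_energy_average p1 HQ mgr) Efin -(mean_supportE p1 HQ) -!EFinM.
by congr _%:E; rewrite mulrA mulrAC.
Qed.

Let measurable_lt1 (k : 'M[R]_(n, m) -> R) : measurable_fun setT k ->
  measurable [set x | k x < 1]%R.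
Proof.
move=> mk; have -> : [set x | k x < 1]%R = k @^-1` `]-oo, 1%R[%classic.
  by apply/seteqP; split => x /=; rewrite in_itv.
exact: measurable_preimage (measurable_itv _).
Qed.

(** The rate r may exceed c: if the energy is 0 then c = 0 and {c h < 1} is the whole space, whereas
    {r h < 1} always has volume r^(-N) V. *)
Lemma dir_energy_volume (r : R) : (0 < r)%R -> (fine E / area <= powR r p)%R ->
  (N%:R * (r ^- N * V))%:E <=
  \int[hausdorff N.-1]_(u in @mxsphere R n m) poweRV (poweR (A u) p^-1) N%:R.
Proof.
move=> r0 Er.
have cr : (c <= r)%R.
  rewrite -[leRHS](powRr1 (ltW r0)) -(@mulfV _ p) ?gt_eqF// powRrM.
  by apply: ge0_ler_powR; rewrite ?nnegrE ?invr_ge0 ?powR_ge0 ?(ltW p0) ?divr_ge0 ?(ltW area0).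
have oF X : orthogonal_mx (frame X : 'M[R]_n)^T by apply: orthogonal_mxT; exact: orthogonal_frame.
have mF : measurable_fun setT (fun X : 'M[R]_n => (frame X)^T).
  by apply: (measurableT_comp (@measurable_trmx R n n)); exact: measurable_frame.
have vol := volume_rotation_mean (frame_measureT R n') mF oF p0 mG mg G0 g0 GZ gZ G_average.
have rG : (r ^- N * V)%:E <= leb_mx R n m [set x | G x < 1]%R.
  apply: le_trans vol; rewrite -(leb_mx_mean_ballZ n0 m0 p1 HQ r0).
  apply: le_measure; rewrite ?inE; [|exact: measurable_lt1|].
    apply: measurable_lt1; apply: measurable_funM; first exact: measurable_cst.
    by apply: continuous_measurable_mx; exact: continuous_mean_support.
  move=> x; rewrite /mkset; apply: le_lt_trans; rewrite /g ler_wpM2r//.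
  exact: mean_support_ge0.
have mD : measurable [set x | x != 0%R /\ (G x < 1)%R].
  rewrite (_ : mkset _ = ~` [set 0%R] `&` [set x | G x < 1]%R).
    by apply: measurableI; [apply: measurableC; exact: measurable_set1_mx|exact: measurable_lt1].
  by apply/seteqP; split => x [/eqP].
(* [radial_volume] excludes the origin, which is a null set as N > 0. *)
have G1 : leb_mx R n m [set x | G x < 1]%R <= leb_mx R n m [set x | x != 0%R /\ (G x < 1)%R].
  rewrite -[leRHS]add0e -(leb_mx_set0 R (_ : 0 < N)%N); last by rewrite muln_gt0 m0.
  apply: (@le_trans _ _ (leb_mx R n m ([set 0%R] `|` [set x | x != 0%R /\ (G x < 1)%R]))).
    apply: le_measure; rewrite ?inE; [exact: measurable_lt1| |].
      by apply: measurableU => //; exact: measurable_set1_mx.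
    by move=> x Gx; have [->|x0] := eqVneq x 0%R; [left|right].
  by apply: measureU2 => //; exact: measurable_set1_mx.
have NS : (n * m = N.-1.+1)%N by rewrite prednK// muln_gt0 m0.
have pos u : 0 <= poweRV (poweR (A u) p^-1) N%:R by exact: poweRV_ge0.
apply: le_trans (integral_sphere_le_hausdorff NS pos).
under eq_integral do rewrite GE.
apply: le_trans (radial_volume mG G0 GZ).
by rewrite EFinM lee_wpmul2l ?lee_fin ?ler0n// (le_trans rG).
Qed.

Lemma dir_energy_capacity :
  poweRV (\int[hausdorff N.-1]_(u in @mxsphere R n m) poweRV (poweR (A u) p^-1) N%:R) (p / N%:R) <=
  (area^-1 * powR (N%:R * V) (- (p / N%:R)))%:E * E.
Proof.
set J := integral _ _ _; set D := powR (N%:R * V) _.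
have NV : (0 < N%:R * V)%R by rewrite mulr_gt0.
have D0 : (0 < D)%R by rewrite powR_gt0.
apply/lee_addgt0Pr => e e0.
(* With r = a^(1/p), the power -p/N of N r^(-N) V is D a. The excess e / D keeps a positive and
   contributes exactly e to the bound. *)
pose a := (fine E / area + e / D)%R.
have a0 : (0 < a)%R by rewrite ltr_wpDl ?divr_gt0// divr_ge0// ltW.
have r0 : (0 < powR a p^-1)%R by rewrite powR_gt0.
have rp : powR (powR a p^-1) p = a by rewrite -powRrM mulVf ?gt_eqF// powRr1// ltW.
have := @dir_energy_volume (powR a p^-1) r0; rewrite rp => /(_ _).
have ea : (fine E / area <= a)%R by rewrite lerDl ltW// divr_gt0.
move=> /(_ ea) J_ge.
have rN : (0 < powR a p^-1 ^- N)%R by rewrite invr_gt0 exprn_gt0.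
apply: (le_trans (poweRV_anti pN0 _ J_ge)).
  by rewrite lee_fin mulr_ge0// mulr_ge0// ltW.
rewrite poweRV_EFin; last by rewrite mulr_gt0// mulr_gt0.
rewrite mulrCA [X in powR X]mulrC powRM ?(ltW NV) ?(ltW rN)// -/D.
have -> : powR (powR a p^-1 ^- N) (- (p / N%:R)) = a.
  have alg (k : R) : (0 < k -> p^-1 * - k * - (p / k) = 1)%R.
    by move=> k0; field; rewrite !gt_eqF.
  have -> : (powR a p^-1 ^- N = powR a (p^-1 * - N%:R))%R.
    by rewrite powRrM powRN powR_mulrn// powR_ge0.
  by rewrite -powRrM (alg _ N0) powRr1// ltW.
rewrite [in leRHS]Efin -EFinM -EFinD lee_fin /a mulrDr (mulrCA D e) mulfV ?gt_eqF// mulr1.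
by rewrite lerD2r le_eqVlt; apply/orP; left; apply/eqP; ring.
Qed.

End vector_field.

(** The polar body has volume at most V, and the power -p/N is decreasing. *)
Lemma d_const_ge : (area^-1 * powR (N%:R * V) (- (p / N%:R)))%:E <= d_const n p Q.
Proof.
have NV : (0 < N%:R * V)%R by rewrite mulr_gt0.
rewrite /d_const -sphere_measureT sphere_areaE inver gt_eqF// EFinM lee_pmul//.
- by rewrite lee_fin invr_ge0 ltW.
- by rewrite lee_fin powR_ge0.
rewrite -poweRV_EFin//; apply: poweRV_anti => //.
  by rewrite mule_ge0 ?lee_fin// lebesgue_mxE.
rewrite EFinM lee_wpmul2l ?lee_fin ?ler0n// lebesgue_mxE.
exact: leb_mx_polar_projection_body.
Qed.

Lemma measurable_gradient (f : 'cV[R]_n -> R) : smooth f -> measurable_fun setT (gradient f).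
Proof.
move=> sf; apply: measurable_fun_mx => i j; under eq_fun do rewrite mxE.
apply: continuous_measurable_mx; exact: (sf [:: i]).1.
Qed.

Lemma affine_capacity_le (K : set 'cV[R]_n) :
  affine_capacity p Q K <= d_const n p Q * variational_capacity p K.
Proof.
have NV : (0 < N%:R * V)%R by rewrite mulr_gt0.
set d := (area^-1 * powR (N%:R * V) (- (p / N%:R)))%R.
have d0 : (0 < d)%R by rewrite mulr_gt0 ?invr_gt0// powR_gt0.
apply: (@le_trans _ _ (d%:E * variational_capacity p K)); last first.
  apply: lee_wpmul2r d_const_ge; apply: le_ereal_inf_tmp => _ [f _ <-].
  by rewrite lebesgue_mxE; exact: energy_ge0.
(* Dividing by d > 0 leaves the infimum alone on one side, so that the bound can be checked for one
   f at a time. *)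
rewrite muleC -lee_pdivrMr//; apply: le_ereal_inf_tmp => _ [f Kf <-].
rewrite lee_pdivrMr// muleC lebesgue_mxE -/(energy p (gradient f)).
have mf : measurable_fun setT (gradient f) by apply: measurable_gradient; case: Kf => -[].
have [Ey|] := ltP (energy p (gradient f)) +oo; last first.
  by rewrite leye_eq => /eqP ->; rewrite gt0_muley ?lte_fin// leey.
have e : support_Lp p Q f = fun u : 'M[R]_(n, m) => poweR (dir_energy p Q (gradient f) u) p^-1.
  by rewrite /support_Lp lebesgue_mxE.
have := dir_energy_capacity mf Ey; apply: le_trans.
by apply: ereal_inf_lbound; exists f; [exact: Kf|rewrite e].
Qed.

End capacity_bound.

Theorem theorem4p2 (R : realType) (n m : nat) (p : R)
    (Q : set 'rV[R]_m) (K : set 'cV[R]_n) :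
  (0 < n)%N -> (0 < m)%N -> 1 <= p -> convex_body_o Q -> compact K ->
  (affine_capacity p Q K <= d_const n p Q * variational_capacity p K)%E.
Proof.
by case: n K => [//|n] K _ m0 p1 HQ _; exact: affine_capacity_le.
Qed.
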